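(* Assume that the coefficients $a_{-r},\dots,a_p$ satisfy the Scheme Hypothesis and that the scheme together with its boundary coefficients $b_{\ell,\nu}$ satisfies the Lopatinskii Hypothesis (both stated in the context). Then the operator $\mathcal{T}$ on $\mathcal{H}$ is power bounded: there exists a constant $C>0$ such that $$\sup_{n\in\mathbb{N}}\,\|\mathcal{T}^n\|_{\mathcal{H}\to\mathcal{H}}\le C .$$ Equivalently, the numerical scheme $u_j^{n+1}=\sum_{\ell=-r}^p a_\ell u_{j+\ell}^n$ ($j\ge1$), $u_\nu^{n+1}=\sum_{\ell=1}^{p_b} b_{\ell,\nu}u_\ell^{n+1}$ ($\nu=1-r,\dots,0$) is stable: for every $f\in\mathcal{H}$ the solution with $u^0=f$ satisfies $\sup_{n\in\mathbb{N}}\|u^n\|_{\mathcal{H}}\le C\|f\|_{\mathcal{H}}$.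
   Context: Notation: $\mathcal{U}=\{\zeta\in\mathbb{C}:|\zeta|>1\}$, $\mathbb{D}=\{|\zeta|<1\}$, $\mathbb{S}^1=\{|\zeta|=1\}$. Data: real numbers $\lambda>0$, $a>0$; integers $r,p$ with $\min(r,p)\ge1$; real coefficients $a_{-r},\dots,a_p$; an integer $1\le p_b\le p$ and real coefficients $b_{\ell,\nu}$ for $1\le\ell\le p_b$, $1-r\le\nu\le0$. Scheme Hypothesis: (i) $\sum_{\ell=-r}^p a_\ell=1$ and $\sum_{\ell=-r}^p\ell a_\ell=-\lambda a<0$; (ii) $a_{-r}a_p\neq0$; (iii) $\left|\sum_{\ell=-r}^p a_\ell e^{i\ell\theta}\right|<1$ for all $\theta\in[-\pi,\pi]\setminus\{0\}$; (iv) for some positive integer $\mu$ and some real $\beta>0$, $\sum_{\ell=-r}^p a_\ell e^{i\ell\theta}=\exp\left(-i\lambda a\theta-\beta\theta^{2\mu}+O(\theta^{2\mu+1})\right)$ as $\theta\to0$. Operator: $\mathcal{H}$ is the Hilbert space of complex sequences $(w_j)_{j\ge1-r}\in\ell^2$ such that $w_\nu=\sum_{\ell=1}^{p_b}b_{\ell,\nu}w_\ell$ for $\nu=1-r,\dots,0$, with norm $\|w\|_{\mathcal{H}}^2=\sum_{j\ge1}|w_j|^2$. An element of $\mathcal{H}$ is determined by its values for $j\ge1$, and $\mathcal{T}:\mathcal{H}\to\mathcal{H}$ is the bounded operator with $(\mathcal{T}w)_j=\sum_{\ell=-r}^p a_\ell w_{j+\ell}$ for $j\ge1$. Matrices: for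 $z\in\mathbb{C}$, $\mathbb{M}(z)\in\mathcal{M}_{p+r}(\mathbb{C})$ is the companion matrix whose first row is $\left(\frac{\delta_{\ell,0}z-a_\ell}{a_p}\right)_{\ell=p-1,p-2,\dots,-r}$ (in this order, $\delta$ the Kronecker symbol), with $1$'s on the subdiagonal and $0$ elsewhere. $\mathcal{B}\in\mathcal{M}_{r,p+r}(\mathbb{R})$ is the matrix of the linear map sending $(w_p,\dots,w_1,w_0,w_{-1},\dots,w_{1-r})^T$ to the vector with entries $w_\nu-\sum_{\ell=1}^{p_b}b_{\ell,\nu}w_\ell$, $\nu=0,-1,\dots,1-r$. Stable subspace: under the Scheme Hypothesis, for $z$ in a neighborhood of each point of $\overline{\mathcal{U}}\setminus\{1\}$ (where $\overline{\mathcal{U}}=\mathcal{U}\cup\mathbb{S}^1$), $\mathbb{M}(z)$ has no eigenvalue on $\mathbb{S}^1$, and has $r$ eigenvalues in $\mathbb{D}$ and $p$ in $\mathcal{U}$ (with multiplicity); $\mathbb{E}^s(z)$ denotes the $r$-dimensional span of the generalized eigenvectors of $\mathbb{M}(z)$ associated with eigenvalues in $\mathbb{D}$; it depends holomorphically on $z$. The matrix $\mathbb{M}(1)$ has $1$ as a simple eigenvalue and $r-1$ eigenvalues in $\mathbb{D}$; one sets $\mathbb{E}^s(1):=\mathbb{E}^{ss}(1)\oplus\mathrm{Span}\,(1,1,\dots,1)^T$, with $\mathbb{E}^{ss}(1)$ the span of the generalized eigenvectors of $\mathbb{M}(1)$ for eigenvalues in $\mathbb{D}$ (this is the holomorphic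 extension of $\mathbb{E}^s(z)$ to $z=1$). Lopatinskii Hypothesis: for every $z\in\mathcal{U}\cup\{1\}$, $\mathbb{C}^{p+r}=\mathrm{Ker}\,\mathcal{B}\oplus\mathbb{E}^s(z)$, i.e. $\mathcal{B}|_{\mathbb{E}^s(z)}$ is an isomorphism onto $\mathbb{C}^r$. Moreover, choosing a holomorphic basis $e_1(z),\dots,e_r(z)$ of $\mathbb{E}^s(z)$ near each point of $\mathbb{S}^1\setminus\{1\}$, the function $\Delta(z)=\det[\mathcal{B}e_1(z)\ \cdots\ \mathcal{B}e_r(z)]$ has finitely many zeros in $\mathbb{S}^1\setminus\{1\}$, all of them simple (locations and multiplicities of zeros do not depend on the choice of basis). *)

(* Defs.v *)
From mathcomp Require Import all_boot all_order all_algebra.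
From mathcomp Require Export complex.
From mathcomp Require Import all_classical all_reals all_analysis.

Set Implicit Arguments.
Unset Strict Implicit.
Unset Printing Implicit Defensive.
Import Order.TTheory GRing.Theory Num.Theory.
Import numFieldNormedType.Exports.
Local Open Scope classical_set_scope.
Local Open Scope ring_scope.
Local Open Scope complex_scope.

(* Coefficient families are total functions: only the values [a l] with
   -r <= l <= p, and [b l nu] with 1 <= l <= pb and 1 - r <= nu <= 0, matter. *)

(* The sum of [F l] over -r <= l <= p. *)
Definition stencil_sum (V : nmodType) (r p : nat) (F : int -> V) : V :=
  \sum_(k < (p + r).+1) F (k%:Z - r%:Z).

Definition cexp (R : realType) (z : R[i]) : R[i] :=
  (expR (complex.Re z))%:C * (cos (complex.Im z) +i* sin (complex.Im z)).

Definition symbol (R : realType) (r p : nat) (a : int -> R) (theta : R) : R[i] :=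
  stencil_sum r p (fun l => (a l)%:C * cexp (0 +i* (l%:~R * theta))).

Record scheme_hypothesis (R : realType) (lambda vel : R) (r p : nat)
    (a : int -> R) : Prop := SchemeHypothesis {
  consistency0 : stencil_sum r p a = 1;
  consistency1 :
    stencil_sum r p (fun l => l%:~R * a l) = - (lambda * vel) /\
    - (lambda * vel) < 0;
  noncharacteristic : a (- r%:Z) * a p%:Z != 0;
  dissipativity : forall theta : R,
    - pi <= theta <= pi -> theta != 0 -> `|symbol r p a theta| < 1;
  (* [rho] is the remainder inside the exponential. *)
  diffusivity : exists (mu : nat) (beta : R) (rho : R -> R[i]),
    [/\ (0 < mu)%N, 0 < beta,
        \forall theta \near (0 : R), symbol r p a theta =
          cexp (- (beta * theta ^+ (2 * mu)) +i* (- (lambda * vel * theta))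
                + rho theta)
      & (fun theta => Normc.normc (rho theta)) =O_ (0 : R)
          (fun theta => theta ^+ (2 * mu + 1))]
}.

(* A sequence (w_j) with j >= 1 - r is encoded as [w : int -> R[i]]; the values
   of [w] at indices below 1 - r are ignored everywhere. *)

Definition boundary_value (R : realType) (pb : nat) (b : nat -> int -> R)
    (w : int -> R[i]) (nu : int) : R[i] :=
  \sum_(1 <= l < pb.+1) (b l nu)%:C * w l%:Z.

Definition in_H (R : realType) (r pb : nat) (b : nat -> int -> R)
    (w : int -> R[i]) : Prop :=
  (\esum_(j in [set j : int | (1 - r%:Z <= j)%R])
     ((Normc.normc (w j) ^+ 2)%:E) < +oo)%E /\
  forall nu : int, 1 - r%:Z <= nu <= 0 -> w nu = boundary_value pb b w nu.

Definition normH (R : realType) (w : int -> R[i]) : \bar R :=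
  ((\esum_(j in [set j : int | (1 <= j)%R])
      ((Normc.normc (w j) ^+ 2)%:E)) `^ 2^-1)%E.

Definition convolution (R : realType) (r p : nat) (a : int -> R)
    (w : int -> R[i]) (j : int) : R[i] :=
  stencil_sum r p (fun l => (a l)%:C * w (j + l)).

Definition scheme_op (R : realType) (r p pb : nat) (a : int -> R)
    (b : nat -> int -> R) (w : int -> R[i]) : int -> R[i] :=
  fun j => if 1 <= j then convolution r p a w j
           else boundary_value pb b (convolution r p a w) j.

(* Operator norm on H of (the restriction to H of) [F]. *)
Definition opnormH (R : realType) (r pb : nat) (b : nat -> int -> R)
    (F : (int -> R[i]) -> (int -> R[i])) : \bar R :=
  ereal_sup [set normH (F w) | w in [set w | in_H r pb b w /\ (normH w <= 1)%E]].

Definition scheme_solution (R : realType) (r p pb : nat) (a : int -> R)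
    (b : nat -> int -> R) (f : int -> R[i]) (u : nat -> int -> R[i]) : Prop :=
  [/\ forall j : int, 1 - r%:Z <= j -> u 0%N j = f j,
      forall (n : nat) (j : int), 1 <= j ->
        u n.+1 j = stencil_sum r p (fun l => (a l)%:C * u n (j + l))
    & forall (n : nat) (nu : int), 1 - r%:Z <= nu <= 0 ->
        u n.+1 nu = \sum_(1 <= l < pb.+1) (b l nu)%:C * u n.+1 l%:Z].

(* Column j corresponds to the index l = p - 1 - j. *)
Definition companion (R : realType) (r p : nat) (a : int -> R) (z : R[i]) :
    'M[R[i]]_(p + r) :=
  \matrix_(i < p + r, j < p + r)
    if i == 0%N :> nat then
      let l := p%:Z - 1 - j%:Z in ((l == 0)%:R * z - (a l)%:C) / (a p%:Z)%:C
    else (i == j.+1 :> nat)%:R.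

(* The matrix of the map (w_p, ..., w_{1-r}) |-> (w_nu - sum_l b_{l,nu} w_l),
   for nu = 0, ..., 1 - r, whose column j is the image of the basis vector
   [w] with w_{p-j} = 1. *)
Definition boundary_mx (R : realType) (r p pb : nat) (b : nat -> int -> R) :
    'M[R]_(r, p + r) :=
  \matrix_(i < r, j < p + r)
    let w (k : int) : R := (k == p%:Z - j%:Z)%:R in
    let nu := - i%:Z in
    w nu - \sum_(1 <= l < pb.+1) b l nu * w l%:Z.

Definition boundary_mxC (R : realType) (r p pb : nat) (b : nat -> int -> R) :
    'M[R[i]]_(r, p + r) :=
  map_mx (real_complex R) (boundary_mx r p pb b).

(* Subspaces of C^n are row spaces, whose elements are the transposes of the
   column vectors of the mathematical setting: hence the transposed matrices
   below. *)

Definition eigenvalues (R : realType) (n : nat) (A : 'M[R[i]]_n) : seq R[i] :=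
  sval (closed_field_poly_normal (char_poly A)).

Definition stable_space (R : realType) (n : nat) (A : 'M[R[i]]_n) :
    'M[R[i]]_n :=
  (\sum_(kappa <- eigenvalues A | (`|kappa| < 1)%R) geigenspace A^T kappa)%MS.

Definition Es (R : realType) (r p : nat) (a : int -> R) (z : R[i]) :
    'M[R[i]]_(p + r) :=
  if z == 1 then
    (stable_space (companion r p a 1) + (const_mx 1 : 'rV[R[i]]_(p + r)))%MS
  else stable_space (companion r p a z).

(* The columns of [e z] form a basis of E^s(z), holomorphic in z near z0;
   derivability is over the field R[i], so it is complex differentiability. *)
Definition holomorphic_basis (R : realType) (r p : nat) (a : int -> R)
    (z0 : R[i]) (e : R[i] -> 'M[R[i]]_(p + r, r)) : Prop :=
  \forall z \near (z0 : R[i]^o),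
    [/\ row_free (e z)^T, ((e z)^T == Es r p a z)%MS
      & forall i k, derivable ((fun x => e x i k) : R[i]^o -> R[i]^o) z 1].

Definition Lopatinskii_det (R : realType) (r p pb : nat) (b : nat -> int -> R)
    (e : R[i] -> 'M[R[i]]_(p + r, r)) (z : R[i]) : R[i] :=
  \det (boundary_mxC r p pb b *m e z).

Record Lopatinskii_hypothesis (R : realType) (r p pb : nat) (a : int -> R)
    (b : nat -> int -> R) : Prop := LopatinskiiHypothesis {
  Lopatinskii_direct : forall z : R[i], 1 < `|z| \/ z = 1 ->
    let K := kermx (boundary_mxC r p pb b)^T in
    (K + Es r p a z == 1%:M)%MS /\ mxdirect (K + Es r p a z);
  Lopatinskii_finite : finite_set [set z : R[i] | [/\ `|z| = 1, z != 1
    & exists e : R[i] -> 'M[R[i]]_(p + r, r),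
        holomorphic_basis a z e /\ Lopatinskii_det pb b e z = 0]];
  Lopatinskii_simple : forall (z : R[i]) (e : R[i] -> 'M[R[i]]_(p + r, r)),
    `|z| = 1 -> z != 1 -> holomorphic_basis a z e ->
    Lopatinskii_det pb b e z = 0 ->
    'D_1 (Lopatinskii_det pb b e : R[i]^o -> R[i]^o) z != 0
}.

(* Main.v *)
Require Import Defs.
From mathcomp Require Import all_boot all_order all_algebra.
From mathcomp Require Import separable cyclic cyclotomic.
From mathcomp Require Import all_classical all_reals all_analysis.
From mathcomp Require Import ring lra zify.

(* Eliminating the ghost values w_nu, nu <= 0, turns the scheme into an operator T
   on l^2(N) that is a convolution up to a finite-dimensional trace.

   Resolvent. The equation (z - T) w = F is a recurrence with characteristic
   polynomial Q_z = S_z U_z, where S_z has its roots in the open disc and U_z outside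
   of it. Inverting U_z is bounded, and the window (w_p, ..., w_(1-r)) then solves a
   linear system whose matrix L(S_z) stacks the shifts of S_z above the boundary
   matrix. Its determinant is the Lopatinskii determinant up to a nonvanishing factor,
   so that |q(z)| |trace w| <= C |F| up to the unit circle, with q the product of the
   z - z_k over the simple zeros z_k.

   Spectral decomposition. Near z_k this estimate excludes Jordan chains, hence every
   f can be written as a sum of eigenvectors for the z_k plus q(T) g.

   Energy. Since the symbol is bounded by 1, |T w|^2 <= |w|^2 + |trace w|^2. Along the
   orbit of q(T) g the traces are square summable, uniformly in time: apply the
   resolvent estimate to a truncated Laplace transform in time on the circles |z| = rho
   and the Parseval identity, and let rho decrease to 1. *)

Set Implicit Arguments.
Unset Strict Implicit.
Unset Printing Implicit Defensive.
Import Order.TTheory GRing.Theory Num.Theory.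
Import numFieldNormedType.Exports.
Local Open Scope classical_set_scope.
Local Open Scope ring_scope.
Local Open Scope complex_scope.

(** * Square-summable sequences and recurrences *)

(** The traces along an orbit of T itself need not be square summable: near a simple zero z_k the
    resolvent estimate loses a factor 1/|z - z_k|, as an eigenvector on the unit circle forces.
    Applying q(T) compensates exactly this loss, and the eigenvectors stay bounded because |z_k| =
    1.

    The obstacle is a circularity. The Laplace transform of an orbit is cut off after finitely many
    steps, and the cut leaves a remainder governed by the growth of T^n that is to be bounded. A
    cutoff of slope 1/K leaves, for squared norms, a remainder of order M_K M / K, where M bounds
    the growth up to time N and M_K the growth over K steps. So once K is large compared with M_K, a
    bound over K steps yields a bound for every N whose constant depends neither on N nor on rho. At
    the large radius R0 the growth is controlled trivially. Lowering rho by a factor 1 + e with e of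
    order 1/K at most doubles M_K, so the argument can be repeated until rho is as close to 1 as
    desired.

    Fourier analysis enters only through finite sums over roots of unity. *)

Local Notation modc := Normc.normc.

Section Modulus.
Context {R : realType}.
Implicit Types (x y : R[i]) (t : R).

Lemma normE x : `|x| = (modc x)%:C.
Proof. by rewrite normc_def; case: x. Qed.

Lemma modc_ge0 x : 0 <= modc x.
Proof. by rewrite -lecR -normE normr_ge0. Qed.

Lemma modcM x y : modc (x * y) = modc x * modc y.
Proof. exact: Normc.normcM. Qed.

Lemma modcD x y : modc (x + y) <= modc x + modc y.
Proof. exact: le_normcD. Qed.

Lemma modcN x : modc (- x) = modc x.
Proof. exact: normcN. Qed.

Lemma modcB x y : modc (x - y) <= modc x + modc y.
Proof. by rewrite (le_trans (modcD _ _)) // modcN. Qed.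

Lemma modcV x : modc x^-1 = (modc x)^-1.
Proof. exact: Normc.normcV. Qed.

Lemma modc0 : modc (0 : R[i]) = 0.
Proof. exact: Normc.normc0. Qed.

Lemma modc1 : modc (1 : R[i]) = 1.
Proof. exact: Normc.normc1. Qed.

Lemma modc_eq0 x : (modc x == 0) = (x == 0).
Proof.
apply/eqP/eqP => [|->]; last exact: modc0.
exact: Normc.eq0_normc.
Qed.

Lemma modc_gt0 x : (0 < modc x) = (x != 0).
Proof. by rewrite lt_neqAle modc_ge0 andbT eq_sym modc_eq0. Qed.

Lemma modcX x n : modc (x ^+ n) = modc x ^+ n.
Proof. by elim: n => [|n IH]; rewrite ?expr0 ?modc1 // !exprS modcM IH. Qed.

Lemma modc_real t : modc t%:C = `|t|.
Proof. by rewrite /modc /= expr0n /= addr0 sqrtr_sqr. Qed.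

Lemma modc_sum (I : Type) (s : seq I) (P : pred I) (F : I -> R[i]) :
  modc (\sum_(i <- s | P i) F i) <= \sum_(i <- s | P i) modc (F i).
Proof.
elim/big_ind2: _ => [|x1 t1 x2 t2 h1 h2|//]; first by rewrite modc0.
by rewrite (le_trans (modcD _ _)) // lerD.
Qed.

Lemma modc_prod (I : Type) (s : seq I) (P : pred I) (F : I -> R[i]) :
  modc (\prod_(i <- s | P i) F i) = \prod_(i <- s | P i) modc (F i).
Proof.
by elim/big_ind2: _ => [|x1 t1 x2 t2 <- <-|//]; rewrite ?modc1 ?modcM.
Qed.

Lemma modc_sqr x : (modc x ^+ 2)%:C = x * conjc x.
Proof. by rewrite rmorphXn /= -normE sqr_normc. Qed.

Lemma modc_lt1 x : (`|x| < 1) = (modc x < 1).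
Proof. by rewrite normE -[1]/(1%:C) ltcR. Qed.

Lemma modc_gt1 x : (1 < `|x|) = (1 < modc x).
Proof. by rewrite normE -[X in X < _]/(1%:C) ltcR. Qed.

Lemma modc_eq1 x : `|x| = 1 <-> modc x = 1.
Proof.
rewrite normE; split=> [|->] // h.
by apply: (@complexI R); rewrite h.
Qed.

(* Convexity of the square: x + y is the mean of x / t and y / (1 - t). *)
Lemma modcD_sqr t x y : 0 < t < 1 ->
  modc (x + y) ^+ 2 <= modc x ^+ 2 / t + modc y ^+ 2 / (1 - t).
Proof.
move=> /andP[t0 t1]; have s0 : 0 < 1 - t by rewrite subr_gt0.
apply: (@le_trans _ _ ((modc x + modc y) ^+ 2)).
  by rewrite lerXn2r ?nnegrE ?modc_ge0 ?addr_ge0 ?modc_ge0 ?modcD.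
rewrite -subr_ge0.
have -> : modc x ^+ 2 / t + modc y ^+ 2 / (1 - t) - (modc x + modc y) ^+ 2 =
    ((1 - t) * modc x - t * modc y) ^+ 2 / (t * (1 - t)).
  by field; rewrite !lt0r_neq0.
by rewrite divr_ge0 ?sqr_ge0 // mulr_ge0 // ltW.
Qed.

Lemma modcD_sqr2 x y :
  modc (x + y) ^+ 2 <= 2 * modc x ^+ 2 + 2 * modc y ^+ 2.
Proof.
have /(modcD_sqr x y) : 0 < (2^-1 : R) < 1 by lra.
rewrite invrK (_ : 1 - 2^-1 = 2^-1 :> R) ?invrK; last by lra.
by rewrite ![_ * 2]mulrC.
Qed.

Lemma modc_sum_sqr n (F : nat -> R[i]) :
  modc (\sum_(i < n) F i) ^+ 2 <= n%:R * \sum_(i < n) modc (F i) ^+ 2.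
Proof.
elim: n => [|n IH]; first by rewrite !big_ord0 modc0 expr0n mul0r.
rewrite !big_ord_recr /=.
case: n IH => [|n] IH.
  by rewrite !big_ord0 !add0r mul1r.
set S := \sum_(i < n.+1) _ in IH *; set Q := \sum_(i < n.+1) _ in IH *.
have nn : 0 < n.+1%:R :> R by rewrite ltr0n.
have hn : n.+2%:R = n.+1%:R + 1 :> R by rewrite -natr1.
(* With m = n + 1 terms in [S], the weight m / (m + 1) gives both the induction hypothesis and the
   new term the factor m + 1. *)
have /(modcD_sqr S (F n.+1)) : 0 < (n.+1%:R / n.+2%:R : R) < 1.
  by rewrite divr_gt0 //= ltr_pdivrMr // mul1r ltr_nat.
move=> /le_trans; apply; rewrite mulrDr lerD //; last first.
  rewrite mulrC ler_wpM2r ?sqr_ge0 // hn.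
  suff -> : (1 - n.+1%:R / (n.+1%:R + 1))^-1 = n.+1%:R + 1 :> R by [].
  by field; rewrite !lt0r_neq0 //; lra.
rewrite invf_div mulrA ler_pdivrMr //.
  by move: (modc S ^+ 2) IH => s2 IH; nra.
Qed.

End Modulus.

Section L2.
Context {R : realType}.
Local Notation C := R[i].
Implicit Types (u v w x f : nat -> C) (A B : R).

(** [A] bounds the square of the norm. Stating this through partial sums reduces every estimate
    below to an inequality between finite sums. *)
Definition l2le w A := forall n, \sum_(i < n) modc (w i) ^+ 2 <= A.

Definition ell2 w := exists A, l2le w A.

Definition sqnorm w : R := sup (range (fun n => \sum_(i < n) modc (w i) ^+ 2)).

Lemma l2le_ge0 w A : l2le w A -> 0 <= A.
Proof. by move=> /(_ 0%N); rewrite big_ord0. Qed.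

Lemma l2leW w A B : l2le w A -> A <= B -> l2le w B.
Proof. by move=> h AB n; apply: le_trans AB. Qed.

Lemma l2le_coord w A i : l2le w A -> modc (w i) ^+ 2 <= A.
Proof.
move=> /(_ i.+1); rewrite big_ord_recr /=; apply: le_trans.
by rewrite lerDr sumr_ge0 // => k _; rewrite sqr_ge0.
Qed.

Lemma l2leD u v A B : l2le u A -> l2le v B -> l2le (u + v) (2 * A + 2 * B).
Proof.
move=> hu hv n; apply: (@le_trans _ _ (\sum_(i < n)
    (2 * modc (u i) ^+ 2 + 2 * modc (v i) ^+ 2))).
  by apply: ler_sum => i _; exact: modcD_sqr2.
by rewrite big_split /= -!mulr_sumr lerD // ler_wpM2l // ?hu ?hv.
Qed.

Lemma l2leZ c u A : l2le u A -> l2le (c *: u) (modc c ^+ 2 * A).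
Proof.
move=> hu n; under eq_bigr do rewrite modcM exprMn.
by rewrite -mulr_sumr ler_wpM2l ?sqr_ge0 ?hu.
Qed.

Lemma l2leN u A : l2le u A -> l2le (- u) A.
Proof. by move=> hu n; under eq_bigr do rewrite modcN; exact: hu. Qed.

Lemma l2leB u v A B : l2le u A -> l2le v B -> l2le (u - v) (2 * A + 2 * B).
Proof. by move=> hu /l2leN; exact: l2leD. Qed.

Lemma l2le0 : l2le (0 : nat -> C) 0.
Proof. by move=> n; rewrite big1 // => i _; rewrite modc0 expr0n. Qed.

Lemma l2le_shift w A k : l2le w A -> l2le (fun i => w (i + k)%N) A.
Proof.
move=> h n; apply: le_trans (h (n + k)%N).
rewrite addnC big_split_ord /=; under [in X in _ <= _ + X]eq_bigr do rewrite addnC.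
by rewrite lerDr sumr_ge0 // => i _; rewrite sqr_ge0.
Qed.

Lemma l2le_sum n (F : nat -> nat -> C) (A : nat -> R) :
  (forall k, (k < n)%N -> l2le (F k) (A k)) ->
  l2le (\sum_(k < n) F k) (n%:R * \sum_(k < n) A k).
Proof.
move=> h m.
apply: (@le_trans _ _ (\sum_(i < m) n%:R * \sum_(k < n) modc (F k i) ^+ 2)).
  by apply: ler_sum => i _; rewrite fct_sumE; exact: (modc_sum_sqr n (F ^~ i)).
rewrite -mulr_sumr exchange_big /= ler_wpM2l //.
by apply: ler_sum => k _; exact: h.
Qed.

Lemma sqnorm_has_sup w : ell2 w ->
  has_sup (range (fun n => \sum_(i < n) modc (w i) ^+ 2)).
Proof.
case=> A hA; split; first by exists (\sum_(i < 0) modc (w i) ^+ 2), 0%N.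
by exists A => _ [n _ <-].
Qed.

Lemma l2le_sqnorm w : ell2 w -> l2le w (sqnorm w).
Proof.
by move=> /sqnorm_has_sup hw n; apply: sup_upper_bound => //; exists n.
Qed.

Lemma sqnorm_le w A : l2le w A -> sqnorm w <= A.
Proof.
move=> h; apply: ge_sup.
  by exists (\sum_(i < 0) modc (w i) ^+ 2), 0%N.
by move=> _ [n _ <-].
Qed.

Lemma sqnorm_ge0 w : ell2 w -> 0 <= sqnorm w.
Proof. by move=> /l2le_sqnorm/l2le_ge0. Qed.

(** Partial sums are nondecreasing, so finitely many suprema are approached at one common index. *)
Lemma sum_sqnorm_le m (F : nat -> nat -> C) B :
  (forall k, (k < m)%N -> ell2 (F k)) ->
  (forall n, \sum_(k < m) \sum_(i < n) modc (F k i) ^+ 2 <= B) ->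
  \sum_(k < m) sqnorm (F k) <= B.
Proof.
move=> hF hB; apply/ler_addgt0Pr => e e0.
pose d := e / m.+1%:R; have d0 : 0 < d by rewrite divr_gt0.
have /choice[n hn] : forall k : 'I_m, exists n,
    sqnorm (F k) - d < \sum_(i < n) modc (F k i) ^+ 2.
  move=> k; have /(sup_adherent d0) := sqnorm_has_sup (hF k (ltn_ord k)).
  by move=> [_ [n _ <-] hn]; exists n.
apply: (@le_trans _ _ (\sum_(k < m)
    (\sum_(i < \max_k n k) modc (F k i) ^+ 2 + d))).
  apply: ler_sum => k _; rewrite -lerBlDr (le_trans (ltW (hn k))) //.
  have h : (n k <= \max_k n k)%N by apply: (leq_bigmax_cond (F := n)).
  rewrite -(subnKC h) big_split_ord /= lerDl.
  by rewrite sumr_ge0 // => i _; rewrite sqr_ge0.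
rewrite big_split /= lerD ?hB // sumr_const card_ord -mulr_natr /d.
by rewrite mulrAC ler_pdivrMr ?ltr0n // ler_pM2l // ler_nat.
Qed.

End L2.

Section FirstOrderRecurrences.
Context {R : realType}.
Local Notation C := R[i].
Implicit Types (v w f : nat -> C) (A B : R).

Lemma sum_recl w n :
  \sum_(i < n) modc (w i.+1) ^+ 2 <= \sum_(i < n.+1) modc (w i) ^+ 2.
Proof. by rewrite big_ord_recl /= lerDr sqr_ge0. Qed.

Lemma unstable_sum (u : C) (t : R) w f B n : 1 < t -> t <= modc u ->
  (forall i, w i.+1 - u * w i = f i) -> l2le f B ->
  t ^+ 2 * (\sum_(i < n) modc (w i) ^+ 2) <=
  t * (\sum_(i < n) modc (w i.+1) ^+ 2) + t / (t - 1) * B.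
Proof.
move=> t1 tu hw hf; have t0 : 0 < t by lra.
apply: (@le_trans _ _ (\sum_(i < n) (t * modc (w i.+1) ^+ 2
    + t / (t - 1) * modc (f i) ^+ 2))).
  rewrite mulr_sumr; apply: ler_sum => i _.
  apply: (@le_trans _ _ (modc (u * w i) ^+ 2)).
    rewrite modcM exprMn ler_wpM2r ?sqr_ge0 //.
    by rewrite lerXn2r ?nnegrE ?modc_ge0 // ltW.
  have -> : u * w i = w i.+1 + - f i by rewrite -hw; ring.
  have /(modcD_sqr (w i.+1) (- f i)) : 0 < t^-1 < 1.
    by rewrite invr_gt0 t0 invf_lt1.
  rewrite invrK modcN [_ * t]mulrC => /le_trans; apply.
  rewrite lerD2l mulrC ler_wpM2r ?sqr_ge0 //.
  suff -> : (1 - t^-1)^-1 = t / (t - 1) by [].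
  by field; rewrite !lt0r_neq0 //; lra.
rewrite big_split /= -!mulr_sumr lerD2l ler_wpM2l ?hf //.
by rewrite divr_ge0 //; lra.
Qed.

(** For |u| > 1 the homogeneous solutions u^i grow, so boundedness alone selects the solution and no
    initial value enters. Square summability comes first: the shifted sum exceeds the sum by at most
    [M], and t^2 > t. Inserting [sqnorm w] on both sides then removes [M] from the bound. *)
Lemma unstable_bound (u : C) (t : R) w f B : 1 < t -> t <= modc u ->
  (exists M, forall i, modc (w i) ^+ 2 <= M) ->
  (forall i, w i.+1 - u * w i = f i) -> l2le f B ->
  l2le w (B / (t - 1) ^+ 2).
Proof.
move=> t1 tu [M hM] hw hf; have t0 : 0 < t by lra.
have s0 : 0 < t - 1 by lra.
have {M hM}lw : ell2 w.
  exists ((t * M + t / (t - 1) * B) / (t ^+ 2 - t)) => n.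
  rewrite ler_pdivlMr; last by rewrite expr2; nra.
  have := unstable_sum n t1 tu hw hf; rewrite expr2.
  have : \sum_(i < n) modc (w i.+1) ^+ 2 <= \sum_(i < n) modc (w i) ^+ 2 + M.
    by rewrite (le_trans (sum_recl _ _)) // big_ord_recr /= lerD2l.
  rewrite -(ler_pM2l t0); set S := \sum_(i < n) _; set S' := \sum_(i < n) _.
  by set c := t / _ * B; lra.
have hA := l2le_sqnorm lw; set A := sqnorm w in hA *.
suff : A <= B / (t - 1) ^+ 2 by exact: l2leW.
have : A <= (t * A + t / (t - 1) * B) / t ^+ 2.
  apply: sqnorm_le => n; rewrite ler_pdivlMr ?exprn_gt0 // mulrC.
  apply: (le_trans (unstable_sum n t1 tu hw hf)); rewrite lerD2r ler_pM2l //.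
  exact: le_trans (sum_recl _ _) _.
rewrite ler_pdivlMr ?exprn_gt0 // => h; rewrite ler_pdivlMr ?exprn_gt0 //.
have hc : t / (t - 1) * B * (t - 1) = t * B by field; rewrite !lt0r_neq0 //; lra.
move: (t / (t - 1) * B) hc h => c hc h; rewrite -(ler_pM2l t0) -hc.
have : (A * t ^+ 2 - t * A) * (t - 1) <= c * (t - 1).
  by rewrite ler_wpM2r ?(ltW s0) // lerBlDl.
by apply: le_trans; rewrite le_eqVlt; apply/orP; left; apply/eqP; ring.
Qed.

(** Taking the weight t in [modcD_sqr] leaves the factor |s|^2 / t <= t < 1, which is absorbed on
    the left. Homogeneous solutions now decay, whence the initial value in the bound. *)
Lemma stable_bound (s : C) (t : R) w f B : 0 < t < 1 -> modc s <= t ->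
  (forall i, w i.+1 - s * w i = f i) -> l2le f B ->
  l2le w ((modc (w 0%N) ^+ 2 + B / (1 - t)) / (1 - t)).
Proof.
move=> /andP[t0 t1] st hw hf n; have s0 : 0 < 1 - t by lra.
have B0 := l2le_ge0 hf.
suff : \sum_(i < n.+1) modc (w i) ^+ 2 <=
    (modc (w 0%N) ^+ 2 + B / (1 - t)) / (1 - t).
  by apply: le_trans; rewrite big_ord_recr /= lerDl sqr_ge0.
rewrite ler_pdivlMr // mulrBr mulr1 lerBlDr.
rewrite [leLHS]big_ord_recl /= -addrA lerD2l.
apply: (@le_trans _ _ (\sum_(i < n)
    (t * modc (w i) ^+ 2 + (1 - t)^-1 * modc (f i) ^+ 2))).
  apply: ler_sum => i _.
  have -> : w (bump 0 i) = s * w i + f i by rewrite -hw /bump add1n; ring.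
  have /(modcD_sqr (s * w i) (f i)) : 0 < t < 1 by rewrite t0.
  move=> /le_trans; apply; rewrite [X in _ + X]mulrC lerD2r.
  rewrite ler_pdivrMr // modcM exprMn [leRHS]mulrAC ler_wpM2r ?sqr_ge0 //.
  by rewrite -expr2 lerXn2r ?nnegrE ?modc_ge0 // ltW.
rewrite big_split /= -!mulr_sumr addrC lerD //.
  by rewrite mulrC ler_wpM2r ?hf // invr_ge0 ltW.
rewrite mulrC ler_wpM2r ?(ltW t0) //.
by rewrite big_ord_recr /= lerDl sqr_ge0.
Qed.

End FirstOrderRecurrences.

Section ShiftAction.
Context {R : realType}.
Local Notation C := R[i].
Implicit Types (P Q : {poly C}) (v w f : nat -> C) (A B : R).

(** This is P evaluated at the left shift. By [actM], a factorization of the characteristic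
    polynomial becomes a succession of simpler recurrences. *)
Definition act P w : nat -> C := fun i => \sum_(k < size P) P`_k * w (i + k)%N.

Lemma act_widen n P w i : (size P <= n)%N ->
  act P w i = \sum_(k < n) P`_k * w (i + k)%N.
Proof.
move=> h; rewrite /act (big_ord_widen n (fun k => P`_k * w (i + k)%N)) //.
rewrite big_mkcond /=; apply: eq_bigr => k _; case: ltnP => // hk.
by rewrite nth_default // mul0r.
Qed.

Lemma actZ P c w : act P (c *: w) = c *: act P w.
Proof.
apply/funext => i; change (act P (c *: w) i = c * act P w i).
by rewrite /act mulr_sumr; apply: eq_bigr => k _; exact: mulrCA.
Qed.

Lemma actD P v w : act P (v + w) = act P v + act P w.
Proof.
apply/funext => i; change (act P (v + w) i = act P v i + act P w i).
by rewrite /act -big_split; apply: eq_bigr => k _; exact: mulrDr.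
Qed.

Lemma actDl P Q w : act (P + Q) w = act P w + act Q w.
Proof.
apply/funext => i; pose n := maxn (size P) (size Q).
change (act (P + Q) w i = act P w i + act Q w i).
rewrite !(@act_widen n) ?leq_maxl ?leq_maxr //; last first.
  by rewrite (leq_trans (size_polyD _ _)).
by rewrite -big_split; apply: eq_bigr => k _; rewrite coefD mulrDl.
Qed.

Lemma actZl c P w : act (c *: P) w = c *: act P w.
Proof.
apply/funext => i; change (act (c *: P) w i = c * act P w i).
rewrite (@act_widen (size P)) ?size_scale_leq // mulr_sumr.
by apply: eq_bigr => k _; rewrite coefZ mulrA.
Qed.

Lemma act_mulX P w i : act (P * 'X) w i = act P w i.+1.
Proof.
rewrite (@act_widen (size P).+1); last first.
  by rewrite (leq_trans (size_polyMleq _ _)) // size_polyX addn2.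
rewrite big_ord_recl /= coefMX mul0r add0r; apply: eq_bigr => k _.
by rewrite coefMX /= /bump add1n addnS.
Qed.

Lemma actC c w : act c%:P w = c *: w.
Proof.
apply/funext => i; rewrite (@act_widen 1) ?size_polyC_leq1 // big_ord1 coefC /=.
by rewrite addn0.
Qed.

Lemma act_XsubC c w i : act ('X - c%:P) w i = w i.+1 - c * w i.
Proof.
rewrite (@act_widen 2) ?size_XsubC // !big_ord_recl big_ord0 /=.
by rewrite !coefB !coefX !coefC /= addn0 addn1 /=; ring.
Qed.

Lemma actM P Q w : act (P * Q) w = act P (act Q w).
Proof.
elim/poly_ind: P => [|P c IH].
  by rewrite mul0r /act size_poly0; apply/funext => i; rewrite !big_ord0.
rewrite mulrDl !actDl mul_polyC actZl actC; congr (_ + _).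
apply/funext => i; rewrite act_mulX -IH -mulrA [_ * Q]mulrC mulrA act_mulX.
by [].
Qed.

Lemma ell2_act P w : ell2 w -> ell2 (act P w).
Proof.
case=> A hA.
exists ((size P)%:R * \sum_(k < size P) (modc P`_k ^+ 2 * A)).
have -> : act P w = \sum_(k < size P) (P`_k *: (fun i => w (i + k)%N)).
  by apply/funext => i; rewrite fct_sumE.
apply: (@l2le_sum _ _ (fun k => P`_k *: (fun i => w (i + k)%N))
  (fun k => modc P`_k ^+ 2 * A)) => k _.
by apply: l2leZ; exact: l2le_shift.
Qed.

Lemma bounded_ell2 w : ell2 w -> exists M, forall i, modc (w i) ^+ 2 <= M.
Proof. by case=> A hA; exists A => i; exact: l2le_coord. Qed.

Lemma unstable_act (t : R) (us : seq C) w B : 1 < t -> all (fun u => t <= modc u) us ->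
  ell2 w -> l2le (act (\prod_(u <- us) ('X - u%:P)) w) B ->
  l2le w (B / ((t - 1) ^+ 2) ^+ size us).
Proof.
move=> t1; elim: us B => [|u us IH] B /=.
  by rewrite big_nil actC scale1r expr0 divr1.
move=> /andP[ut ht] lw; rewrite big_cons actM => h.
have : l2le (act (\prod_(j <- us) ('X - j%:P)) w) (B / (t - 1) ^+ 2).
  apply: (unstable_bound t1 ut (bounded_ell2 (ell2_act _ lw)) _ h) => i.
  by rewrite act_XsubC.
move=> /IH -/(_ ht lw).
by rewrite -mulrA -invfM -exprS.
Qed.

Lemma modc_le_ReIm (z : C) : modc z <= `|complex.Re z| + `|complex.Im z|.
Proof.
case: z => a b /=; rewrite -[leRHS]ger0_norm ?addr_ge0 // -sqrtr_sqr.
rewrite ler_wsqrtr // sqrrD -!normrX !(ger0_norm (sqr_ge0 _)).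
by rewrite [leRHS]addrAC lerDl mulrn_wge0 // mulr_ge0.
Qed.

Lemma Re_le_modc (z : C) : `|complex.Re z| <= modc z.
Proof. by case: z => a b; rewrite /modc /= -sqrtr_sqr ler_wsqrtr // lerDl sqr_ge0. Qed.

Lemma Im_le_modc (z : C) : `|complex.Im z| <= modc z.
Proof. by case: z => a b; rewrite /modc /= -sqrtr_sqr ler_wsqrtr // lerDr sqr_ge0. Qed.

Lemma modc_geometric_sum (u : C) f (M : R) i n : 1 < modc u ->
  (forall j, modc (f j) <= M) ->
  modc (\sum_(k < n) u ^- k.+1 * f (i + k)%N) <= M / (modc u - 1).
Proof.
move=> u1 hM; have u0 : 0 < modc u - 1 by rewrite subr_gt0.
have ug0 : 0 < modc u by rewrite (lt_trans ltr01).
have M0 : 0 <= M by rewrite (le_trans _ (hM 0%N)) ?modc_ge0.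
apply: (le_trans (modc_sum _ _ _)).
apply: (@le_trans _ _ (M * \sum_(k < n) (modc u) ^- k.+1)).
  rewrite mulr_sumr; apply: ler_sum => k _.
  by rewrite modcM modcV modcX mulrC ler_wpM2r ?hM // invr_ge0 exprn_ge0 ?modc_ge0.
rewrite ler_wpM2l // -[leRHS]mul1r ler_pdivlMr //.
suff -> : (\sum_(k < n) (modc u) ^- k.+1) * (modc u - 1) = 1 - modc u ^- n.
  by rewrite gerBl invr_ge0 exprn_ge0 ?modc_ge0.
elim: n => [|n IH]; first by rewrite big_ord0 expr0 invr1; ring.
by rewrite big_ord_recr /= mulrDl IH !exprS; field; rewrite expf_neq0 lt0r_neq0.
Qed.

Lemma cvg_geometric_sum (u : C) f (M : R) i : 1 < modc u ->
  (forall j, modc (f j) <= M) ->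
  exists S : C,
  (fun n => modc (\sum_(k < n) u ^- k.+1 * f (i + k)%N - S)) @ \oo --> (0 : R).
Proof.
move=> u1 hM.
pose g (F : C -> R) k := F (u ^- k.+1 * f (i + k)%N).
have hg F : (forall z, `|F z| <= modc z) -> cvgn (series (g F)).
  move=> hF; apply: normed_cvg.
  apply: (@series_le_cvg _ _ (fun k => M * (modc u)^-1 ^+ k)).
  - by move=> k /=.
  - move=> k; rewrite mulr_ge0 ?exprn_ge0 ?invr_ge0 ?modc_ge0 //.
    by rewrite (le_trans _ (hM 0%N)) ?modc_ge0.
  - move=> k /=; rewrite (le_trans (hF _)) // modcM modcV modcX mulrC -exprVn.
    rewrite ler_pM ?modc_ge0 ?exprn_ge0 ?invr_ge0 ?modc_ge0 //.
    rewrite exprS ler_piMl ?exprn_ge0 ?invr_ge0 ?modc_ge0 //.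
    by rewrite invf_le1 ?(ltW u1) // (lt_trans ltr01 u1).
  - apply: is_cvg_geometric_series; rewrite ger0_norm ?invr_ge0 ?modc_ge0 //.
    by rewrite invf_lt1 //; lra.
have hsum (F : C -> R) n : (forall x y, F (x + y) = F x + F y) -> F 0 = 0 ->
    F (\sum_(k < n) u ^- k.+1 * f (i + k)%N) = series (g F) n.
  move=> hD h0; rewrite /series /= big_mkord /g.
  by elim/big_ind2: _ => // x1 x2 y1 y2 <- <-.
set a := limn (series (g (@complex.Re R))).
set b := limn (series (g (@complex.Im R))).
exists (a +i* b).
have hre : (fun n => complex.Re (\sum_(k < n) u ^- k.+1 * f (i + k)%N)) @ \oo --> a.
  rewrite (_ : (fun n => _) = series (g (@complex.Re R))).
    by apply: hg; exact: Re_le_modc.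
  by apply/funext => n; apply: hsum => // -[? ?] [? ?].
have him : (fun n => complex.Im (\sum_(k < n) u ^- k.+1 * f (i + k)%N)) @ \oo --> b.
  rewrite (_ : (fun n => _) = series (g (@complex.Im R))).
    by apply: hg; exact: Im_le_modc.
  by apply/funext => n; apply: hsum => // -[? ?] [? ?].
apply: (@squeeze_cvgr _ _ _ _ (fun=> 0)
  (fun n => `|complex.Re (\sum_(k < n) u ^- k.+1 * f (i + k)%N) - a| +
            `|complex.Im (\sum_(k < n) u ^- k.+1 * f (i + k)%N) - b|)).
- near=> n; rewrite modc_ge0 /=.
  set z := \sum_(k < n) _; apply: le_trans (modc_le_ReIm _) _.
  by case: z.
- exact: cvg_cst.
- have h (x : nat -> R) l : x @ \oo --> l -> `|x n - l| @[n --> \oo] --> (0 : R).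
    move=> hx; have : `|x n - l| @[n --> \oo] --> `|l - l|.
      by apply: cvg_norm; apply: cvgB => //; exact: cvg_cst.
    by rewrite subrr normr0.
  by rewrite -[X in _ --> X]addr0; apply: cvgD; exact: h.
Unshelve. all: by end_near.
Qed.

(** The recurrence is solved backwards from infinity: w_i is minus the sum over k of u^(-k-1)
    f_(i+k). This series is bounded in i, and [unstable_bound] upgrades boundedness to square
    summability. *)
Lemma unstable_exists1 (u : C) f : 1 < modc u -> ell2 f ->
  exists w, ell2 w /\ forall i, w i.+1 - u * w i = f i.
Proof.
move=> u1 [B hB].
have fM j : modc (f j) <= 1 + B.
  have := l2le_coord j hB; have := modc_ge0 (f j); nra.
have /choice[S hS] := fun i => cvg_geometric_sum i u1 fM.
have u0 : u != 0 by rewrite -modc_gt0 (lt_trans ltr01).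
have rel i : u * S i = f i + S i.+1.
  apply/eqP; rewrite -subr_eq0 -modc_eq0; apply/eqP.
  suff h : modc (u * S i - (f i + S i.+1)) @[_ --> \oo] --> (0 : R).
    exact: (cvg_unique (@Rhausdorff R) (cvg_cst _) h).
  set P := fun i n => \sum_(k < n) u ^- k.+1 * f (i + k)%N in hS.
  apply: (@squeeze_cvgr _ _ _ _ (fun=> 0)
     (fun n => modc u * modc (P i n.+1 - S i) + modc (P i.+1 n - S i.+1))).
  - near=> n; rewrite modc_ge0 /=.
    have -> : u * S i - (f i + S i.+1) =
       - (u * (P i n.+1 - S i)) + (P i.+1 n - S i.+1).
      have -> : P i n.+1 = u^-1 * (f i + P i.+1 n).
        rewrite /P big_ord_recl /= addn0 expr1 mulrDr mulr_sumr; congr (_ + _).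
        apply: eq_bigr => k _; rewrite /bump add1n addnS addSn mulrA; congr (_ * _).
        by rewrite [in LHS]exprS invfM.
      by field.
    by rewrite (le_trans (modcD _ _)) // modcN modcM.
  - exact: cvg_cst.
  - rewrite -[X in _ --> X]addr0 -[X in _ --> X + _](mulr0 (modc u)).
    apply: cvgD; last exact: hS.
    apply: cvgM; first exact: cvg_cst.
    by rewrite (cvg_shiftS (fun n => modc (P i n - S i))); exact: hS.
exists (fun i => - S i).
have rel' i : - S i.+1 - u * - S i = f i by rewrite mulrN opprK rel; ring.
split=> //; exists (B / (modc u - 1) ^+ 2).
apply: (unstable_bound u1 (lexx _) _ rel' hB).
exists (((1 + B) / (modc u - 1)) ^+ 2) => i; rewrite modcN.
rewrite lerXn2r ?nnegrE ?modc_ge0 //.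
  by rewrite divr_ge0 ?subr_ge0 ?(ltW u1) // (le_trans _ (fM 0%N)) ?modc_ge0.
apply/ler_addgt0Pr => e e0.
have /cvgrPdist_lt/(_ e e0)[n _ /(_ n (leqnn n)) /=] := hS i.
rewrite sub0r normrN ger0_norm ?modc_ge0 // => /ltW hn.
set P := \sum_(k < n) _ in hn; rewrite (_ : S i = P - (P - S i)); last by ring.
rewrite (le_trans (modcB _ _)) // lerD //.
exact: modc_geometric_sum.
Unshelve. all: by end_near.
Qed.

End ShiftAction.

Section Recurrences.
Context {R : realType}.
Local Notation C := R[i].
Implicit Types (P Q : {poly C}) (v w f : nat -> C) (A B : R).

Lemma unstable_exists (us : seq C) f : all (fun u => 1 < modc u) us -> ell2 f ->
  exists w, ell2 w /\ act (\prod_(u <- us) ('X - u%:P)) w = f.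
Proof.
elim: us f => [|u us IH] f /=.
  by move=> _ hf; exists f; rewrite big_nil actC scale1r.
move=> /andP[u1 hus] hf; have [g [lg hg]] := unstable_exists1 u1 hf.
have [w [lw hw]] := IH g hus lg.
exists w; split=> //; rewrite big_cons actM hw.
by apply/funext => i; rewrite act_XsubC.
Qed.

(** Each factor X - s costs one more initial value: the first entry of [act P w] is a combination of
    w_0, ..., w_d with d the degree of P. *)
Lemma stable_act (t : R) (ss : seq C) : 0 < t < 1 -> all (fun s => modc s <= t) ss ->
  exists K, 0 <= K /\ forall w B, l2le (act (\prod_(s <- ss) ('X - s%:P)) w) B ->
  l2le w (K * (\sum_(i < size ss) modc (w i) ^+ 2 + B)).
Proof.
move=> ht; have /andP[t0 t1] := ht; have s0 : 0 < 1 - t by lra.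
elim: ss => [|s ss IH] /=.
  exists 1; split=> // w B.
  by rewrite big_nil actC scale1r big_ord0 add0r mul1r.
move=> /andP[st hss]; have [K [K0 hK]] := IH hss.
set P := \prod_(s <- ss) ('X - s%:P) in hK.
have sP : size P = (size ss).+1 by rewrite /P size_prod_XsubC.
pose c := (size P)%:R * \sum_(k < size P) modc P`_k ^+ 2.
have i0 : 0 <= (1 - t)^-1 by rewrite invr_ge0 ltW.
have c0 : 0 <= c by rewrite mulr_ge0 // sumr_ge0 // => k _; rewrite sqr_ge0.
exists (K * (1 + (c + (1 - t)^-1) / (1 - t))); split.
  by rewrite mulr_ge0 // addr_ge0 // mulr_ge0 // addr_ge0.
move=> w B; rewrite big_cons -/P actM => h.
have B0 := l2le_ge0 h.
have := stable_bound ht st (fun i => esym (act_XsubC s (act P w) i)) h.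
move=> /hK /l2leW; apply.
rewrite -mulrA ler_wpM2l //.
set S := \sum_(i < (size ss).+1) _.
have S0 : 0 <= S by apply: sumr_ge0 => i _; rewrite sqr_ge0.
have h1 : \sum_(i < size ss) modc (w i) ^+ 2 <= S.
  by rewrite /S big_ord_recr /= lerDl sqr_ge0.
have h2 : modc (act P w 0) ^+ 2 <= c * S.
  rewrite /act; apply: (le_trans (modc_sum_sqr _ (fun k => P`_k * w (0 + k)%N))).
  rewrite /c -mulrA ler_wpM2l // mulr_suml; apply: ler_sum => k _.
  rewrite modcM exprMn ler_wpM2l ?sqr_ge0 //.
  have hk : (k < (size ss).+1)%N by rewrite -sP.
  rewrite add0n /S (bigD1 (Ordinal hk)) //= lerDl.
  by rewrite sumr_ge0 // => i _; rewrite sqr_ge0.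
apply: (@le_trans _ _ (S + (c * S + B / (1 - t)) / (1 - t))).
  by rewrite lerD // ler_wpM2r // lerD2r.
have -> : (1 + (c + (1 - t)^-1) / (1 - t)) * (S + B) =
   S + (c * S + B / (1 - t)) / (1 - t) +
   (B + (c * B + S / (1 - t)) / (1 - t)) by ring.
by rewrite lerDl addr_ge0 // mulr_ge0 // addr_ge0 // mulr_ge0.
Qed.

Lemma act_exists P (x v : nat -> C) : P \is monic ->
  exists w, act P w = v /\ forall i, (i.+1 < size P)%N -> w i = x i.
Proof.
move=> mP; have sP : (0 < size P)%N by rewrite size_poly_gt0 monic_neq0.
have [P1|r0] := leqP (size P) 1.
  exists v; split=> [|i]; last by rewrite ltnNge (leq_trans P1).
  apply/funext => i; rewrite (@act_widen _ 1) // big_ord1 addn0.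
  suff -> : P`_0 = 1 by rewrite mul1r.
  move/monicP: mP; rewrite lead_coefE.
  by rewrite (_ : size P = 1)%N //; apply/eqP; rewrite eqn_leq P1.
set r := (size P).-1; have rP : size P = r.+1 by rewrite /r prednK.
(* The state at time n is the window (w_n, ..., w_(n+r-1)). *)
pose new n (h : nat -> C) := v n - \sum_(k < r) P`_k * h k.
pose step n (h : nat -> C) k := if (k.+1 < r)%N then h k.+1 else new n h.
pose st := fix st n := if n is n'.+1 then step n' (st n') else
    x.
have stE k n : (k < r)%N -> st n k = st (n + k)%N 0%N.
  elim: k n => [|k IH] n kr; first by rewrite addn0.
  by rewrite addnS -addSn -IH ?(ltnW kr) //= /step kr.
exists (fun n => st n 0%N); split; last first.
  by move=> i; rewrite rP ltnS => ir; rewrite -(stE i 0%N ir).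
apply/funext => n; rewrite /act rP big_ord_recr /=.
have -> : P`_r = 1 by move/monicP: mP; rewrite lead_coefE.
have -> : \sum_(i < r) P`_i * st (n + i)%N 0%N = \sum_(k < r) P`_k * st n k.
  by apply: eq_bigr => k _; rewrite -stE.
have {}r0 : (0 < r)%N by rewrite /r -ltnS prednK.
rewrite mul1r -(prednK r0) addnS -addSn -(stE r.-1 n.+1) ?prednK //=.
by rewrite /step prednK // ltnn /new addrC subrK.
Qed.

End Recurrences.

(** * Discrete Fourier transform *)

From mathcomp Require Import separable cyclic cyclotomic.

Section DiscreteFourier.
Context {R : realType}.
Local Notation C := R[i].

Lemma primitive_root_exists M : (0 < M)%N -> exists w : C, M.-primitive_root w.
Proof.
move=> M0; pose p : {poly C} := 'X^M - 1.
have [rs def_p] := closed_field_poly_normal p.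
have lp : lead_coef p = 1 by rewrite lead_coefXnsubC.
rewrite lp scale1r in def_p.
have rn1 : all M.-unity_root rs.
  apply/allP => z; rewrite -root_prod_XsubC -def_p.
  by rewrite unity_rootE /root !hornerE subr_eq0.
have : has M.-primitive_root rs.
  apply: has_prim_root => //.
    rewrite -separable_prod_XsubC -def_p separable_Xn_sub_1 //.
    by rewrite pnatr_eq0 -lt0n.
  by rewrite -ltnS -(size_prod_XsubC rs id) -def_p size_XnsubC.
by case/hasP => w _ hw; exists w.
Qed.

Lemma modc_prim_root M (w : C) : M.-primitive_root w -> modc w = 1.
Proof.
move=> hw; have M0 := prim_order_gt0 hw.
apply/eqP; rewrite -(@pexpr_eq1 _ _ M) ?modc_ge0 //.
by rewrite -modcX (prim_expr_order hw) modc1.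
Qed.

Lemma sum_expr_unity M (x : C) : x ^+ M = 1 ->
  \sum_(m < M) x ^+ m = (x == 1)%:R * M%:R.
Proof.
move=> xM; case: eqP => [->|/eqP x1].
  by under eq_bigr do rewrite expr1n; rewrite sumr_const card_ord mul1r.
rewrite mul0r; apply: (@mulfI _ (x - 1)); first by rewrite subr_eq0.
by rewrite -subrX1 xM subrr mulr0.
Qed.

(** As L <= M, the powers w^i with i < L are distinct, so only the diagonal terms survive the sum
    over m. *)
Lemma parseval M L (w : C) (y : nat -> C) : M.-primitive_root w -> (L <= M)%N ->
  \sum_(m < M) modc (\sum_(i < L) y i * w ^+ (m * i)) ^+ 2 =
  M%:R * \sum_(i < L) modc (y i) ^+ 2.
Proof.
move=> hw LM; apply: (@complexI R).
have w0 : w != 0 by rewrite -modc_eq0 (modc_prim_root hw) oner_eq0.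
have wJ : conjc w = w^-1.
  apply: (mulfI w0); rewrite -modc_sqr (modc_prim_root hw) expr1n divff //.
rewrite rmorph_sum rmorphM rmorph_nat rmorph_sum /=.
transitivity (\sum_(i < L) \sum_(j < L) y i * conjc (y j) *
    \sum_(m < M) (w ^+ i / w ^+ j) ^+ m).
  under eq_bigr => m _.
    rewrite modc_sqr rmorph_sum big_distrlr /=; over.
  rewrite exchange_big; apply: eq_bigr => i _; rewrite exchange_big.
  apply: eq_bigr => j _; rewrite mulr_sumr; apply: eq_bigr => m _ /=.
  have -> : conjc (y j * w ^+ (m * j)) = conjc (y j) * w^-1 ^+ (m * j).
    by rewrite -wJ [LHS](rmorphM (@conjc R)) -[in RHS](rmorphXn (@conjc R)).
  rewrite exprMn -exprVn -!exprM ![(m * _)%N]mulnC.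
  by rewrite mulrACA.
rewrite mulr_sumr; apply: eq_bigr => i _; rewrite (bigD1 i) //= [X in _ + X]big1 => [|j ji].
  rewrite addr0 divff ?expf_neq0 // sum_expr_unity ?expr1n // eqxx mul1r.
  by rewrite -modc_sqr mulrC.
rewrite sum_expr_unity; last first.
  by rewrite exprMn exprVn -!exprM ![(_ * M)%N]mulnC !exprM (prim_expr_order hw) !expr1n invr1 mulr1.
have -> : (w ^+ i / w ^+ j == 1) = (w ^+ i == w ^+ j).
  apply/eqP/eqP => [h|->]; last by rewrite divff ?expf_neq0.
  by rewrite -[LHS](divfK (expf_neq0 j w0)) h mul1r.
rewrite (eq_prim_root_expr hw) !modn_small ?(leq_trans (ltn_ord _) LM) //.
by rewrite -val_eqE /= eq_sym in ji; rewrite (negPf ji) mul0r mulr0.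
Qed.

Lemma sum_nat_shift (V : nmodType) m n (F : nat -> V) :
  \sum_(m <= i < m + n) F i = \sum_(i < n) F (i + m)%N.
Proof. by rewrite -{1}[m]add0n big_addn addKn big_mkord. Qed.

(* Truncating w beyond the indices that matter makes the finite Fourier
   transform turn the convolution into a product. *)
Lemma convolution_contraction N (al : nat -> C) (w : nat -> C) (A : R) :
  (forall k : C, modc k = 1 -> modc (\sum_(l < N.+1) al l * k ^+ l) <= 1) ->
  l2le w A -> l2le (fun i => \sum_(l < N.+1) al l * w (i + l)%N) A.
Proof.
move=> hal hw n.
pose L := (n + N + N)%N.
(* Only the first n + N values of w influence the first n values of the convolution. The N zeros on
   the left and those from [L] on let the sums over [l, l + L) and [0, L) agree for every shift l <=
   N. *)
pose g i : C := if (N <= i < n + N + N)%N then w (i - N)%N else 0.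
pose y i : C := \sum_(l < N.+1) al l * g (i + l)%N.
have [M LM M0] : exists2 M, (L + N.+1 <= M)%N & (0 < M)%N.
  by exists (L + N.+1)%N => //; rewrite addnS.
have [z hz] := primitive_root_exists M0; pose om := z^-1.
have om1 : modc om = 1 by rewrite modcV (modc_prim_root hz) invr1.
have om0 : om != 0 by rewrite -modc_eq0 om1 oner_eq0.
pose F (v : nat -> C) m := \sum_(i < L) v i * om^-1 ^+ (m * i).
have homV : M.-primitive_root om^-1 by rewrite invrK.
clearbody om.
have hF m : F y m = (\sum_(l < N.+1) al l * (om ^+ m) ^+ l) * F g m.
  rewrite /F /y; under eq_bigr do rewrite mulr_suml.
  rewrite exchange_big mulr_suml; apply: eq_bigr => l _ /=.
  rewrite mulr_sumr.
  have lN : (l <= N)%N by rewrite -ltnS.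
  pose h i := al l * (om ^+ m) ^+ l * (g i * om^-1 ^+ (m * i)).
  have g0 i : (i < N)%N || (L <= i)%N -> h i = 0.
    move=> hi; rewrite /h /g ifF ?mul0r ?mulr0 //.
    by move: hi; rewrite /L; lia.
  transitivity (\sum_(l <= i < l + L) h i).
    rewrite sum_nat_shift.
    apply: eq_bigr => i _; rewrite /h !exprVn mulnDr exprD -exprM.
    by field; rewrite ?expf_neq0.
  rewrite -(big_mkord xpredT h) (@big_cat_nat _ _ _ L) /=; [|lia|lia].
  rewrite [X in _ + X]big1_seq ?addr0; last first.
    by move=> i; rewrite mem_index_iota => /andP[_ hi]; apply: g0; lia.
  rewrite [RHS](@big_cat_nat _ _ _ l) /=; [|lia|rewrite /L; lia].
  rewrite [X in _ = X + _]big1_seq ?add0r // => i.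
  by rewrite mem_index_iota => /andP[_ hi]; apply: g0; lia.
have hP v : \sum_(m < M) modc (F v m) ^+ 2 = M%:R * \sum_(i < L) modc (v i) ^+ 2.
  by apply: parseval => //; lia.
have : \sum_(m < M) modc (F y m) ^+ 2 <= \sum_(m < M) modc (F g m) ^+ 2.
  apply: ler_sum => m _; rewrite hF modcM exprMn ler_piMl ?sqr_ge0 //.
  by rewrite exprn_ile1 ?modc_ge0 // hal // modcX om1 expr1n.
rewrite !hP ler_pM2l ?ltr0n // => hyg.
apply: (@le_trans _ _ (\sum_(i < L) modc (y i) ^+ 2)).
  rewrite -(big_mkord xpredT (fun i => modc (y i) ^+ 2)).
  rewrite (@big_cat_nat _ _ _ N) /=; [|lia|rewrite /L; lia].
  rewrite [X in _ + X](@big_cat_nat _ _ _ (n + N)) /=; [|lia|rewrite /L; lia].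
  rewrite [X in _ <= _ + (X + _)](_ : _ =
     \sum_(i < n) modc (\sum_(l < N.+1) al l * w (i + l)%N) ^+ 2).
    rewrite addrCA lerDl addr_ge0 // sumr_ge0 // => i _; exact: sqr_ge0.
  rewrite addnC sum_nat_shift; apply: eq_bigr => i _.
  congr (modc _ ^+ 2); apply: eq_bigr => l _; congr (_ * _).
  rewrite /g ifT; first by congr w; lia.
  have := ltn_ord i; have := ltn_ord l; lia.
apply: (le_trans hyg); apply: le_trans (hw (n + N)%N).
rewrite -(big_mkord xpredT (fun i => modc (g i) ^+ 2)).
rewrite (@big_cat_nat _ _ _ N) /=; [|lia|rewrite /L; lia].
rewrite big1_seq ?add0r; last first.
  move=> i; rewrite mem_index_iota /g => /andP[_ hi].
  by rewrite ifF ?modc0 ?expr0n //; lia.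
rewrite /L [(n + N + N)%N]addnC sum_nat_shift.
rewrite le_eqVlt; apply/orP; left; apply/eqP/eq_bigr => i _.
rewrite /g ifT ?addnK //; have := ltn_ord i; lia.
Qed.

End DiscreteFourier.

(** * From resolvent estimates to power bounds *)

Section PowerBound.
Context {R : realType}.
Local Notation C := R[i].
Local Notation seqC := (nat -> C).

Variables (T : seqC -> seqC) (r : nat) (tr : nat -> seqC -> C).
Variables (zs : seq C) (R0 Ktr KA KD : R).

Definition trace_energy (x : seqC) : R := \sum_(i < r) modc (tr i x) ^+ 2.

Definition shifted_product (s : seq C) (x : seqC) : seqC :=
  foldr (fun z y => T y - z *: y) x s.

Local Notation E := trace_energy.
Local Notation qT := (shifted_product zs).

Hypothesis TD : forall x y : seqC, T (x + y) = T x + T y.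
Hypothesis TZ : forall c (x : seqC), T (c *: x) = c *: T x.
Hypothesis trD : forall i (x y : seqC), tr i (x + y) = tr i x + tr i y.
Hypothesis trZ : forall i c (x : seqC), tr i (c *: x) = c * tr i x.
Hypothesis energy : forall x A, l2le x A -> l2le (T x) (A + E x).
Hypothesis Ktr0 : 0 <= Ktr.
Hypothesis trace_bound : forall x A, l2le x A -> E x <= Ktr * A.
Hypothesis R0_gt1 : 1 < R0.
Hypothesis R0_large : 1 + Ktr <= R0 ^+ 2.
Hypothesis zs1 : forall z : C, z \in zs -> modc z = 1.
Hypothesis KA0 : 0 <= KA.
Hypothesis apriori : forall z x B, 1 < modc z <= R0 -> ell2 x ->
  l2le (z *: x - T x) B ->
  modc (\prod_(k <- zs) (z - k)) ^+ 2 * E x <= KA * B.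
Hypothesis KD0 : 0 <= KD.
Hypothesis decomposition : forall f B, l2le f B -> exists (phi : nat -> seqC) g,
  [/\ f = \sum_(k < size zs) phi k + qT g,
      forall k, (k < size zs)%N -> T (phi k) = zs`_k *: phi k /\ l2le (phi k) (KD * B)
    & l2le g (KD * B)].

Lemma T0 : T 0 = 0.
Proof. by rewrite -(scale0r (0 : seqC)) TZ !scale0r. Qed.

Lemma TN x : T (- x) = - T x.
Proof. by rewrite -scaleN1r TZ scaleN1r. Qed.

Lemma Tsum (n : nat) (F : nat -> seqC) : T (\sum_(k < n) F k) = \sum_(k < n) T (F k).
Proof. by elim: n => [|n IH]; rewrite ?big_ord0 ?T0 // !big_ord_recr /= TD IH. Qed.

Lemma tr_sum i (n : nat) (F : nat -> seqC) :
  tr i (\sum_(k < n) F k) = \sum_(k < n) tr i (F k).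
Proof.
elim: n => [|n IH]; last by rewrite !big_ord_recr /= trD IH.
by rewrite !big_ord0 -(scale0r (0 : seqC)) trZ mul0r.
Qed.

Lemma E_ge0 x : 0 <= E x.
Proof. by apply: sumr_ge0 => i _; rewrite sqr_ge0. Qed.

Lemma ED x y : E (x + y) <= 2 * E x + 2 * E y.
Proof.
rewrite /E !mulr_sumr -big_split; apply: ler_sum => i _.
by rewrite trD; exact: modcD_sqr2.
Qed.

Lemma EZ c x : E (c *: x) = modc c ^+ 2 * E x.
Proof.
by rewrite /E mulr_sumr; apply: eq_bigr => i _; rewrite trZ modcM exprMn.
Qed.

Lemma l2le_T x A : l2le x A -> l2le (T x) ((1 + Ktr) * A).
Proof.
by move=> h; apply: l2leW (energy h) _; rewrite mulrDl mul1r lerD2l trace_bound.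
Qed.

Lemma l2le_iterT n x A : l2le x A -> l2le (iter n T x) ((1 + Ktr) ^+ n * A).
Proof.
move=> h; elim: n => [|n IH]; first by rewrite expr0 mul1r.
by rewrite /= exprS -mulrA; exact: l2le_T.
Qed.

Lemma spD s x y : shifted_product s (x + y) = shifted_product s x + shifted_product s y.
Proof. by elim: s => //= z s ->; rewrite TD scalerDr opprD addrACA. Qed.

Lemma spZ s c x : shifted_product s (c *: x) = c *: shifted_product s x.
Proof. by elim: s => //= z s ->; rewrite TZ scalerBr scalerA mulrC -scalerA. Qed.

Lemma spT s x : shifted_product s (T x) = T (shifted_product s x).
Proof. by elim: s => //= z s ->; rewrite TD TN TZ. Qed.

Lemma sp_iter s n x : shifted_product s (iter n T x) = iter n T (shifted_product s x).
Proof. by elim: n => //= n <-; exact: spT. Qed.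

Lemma sp_sum s (n : nat) (F : nat -> seqC) :
  shifted_product s (\sum_(k < n) F k) = \sum_(k < n) shifted_product s (F k).
Proof.
elim: n => [|n IH]; last by rewrite !big_ord_recr /= spD IH.
by rewrite !big_ord0 -(scale0r (0 : seqC)) spZ !scale0r.
Qed.

Lemma iterTD n x y : iter n T (x + y) = iter n T x + iter n T y.
Proof. by elim: n => //= n ->; rewrite TD. Qed.

Lemma iterT_sum n m (F : nat -> seqC) :
  iter n T (\sum_(k < m) F k) = \sum_(k < m) iter n T (F k).
Proof. by elim: n => //= n ->; rewrite (@Tsum m (fun k => iter n T (F k))). Qed.

Lemma l2le_sp s : (forall z, z \in s -> modc z = 1) ->
  exists2 c, 0 <= c & forall x B, l2le x B -> l2le (shifted_product s x) (c * B).
Proof.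
elim: s => [|z s IH] hs; first by exists 1 => // x B; rewrite mul1r.
have [|c c0 hc] := IH; first by move=> y ys; apply: hs; rewrite inE ys orbT.
have Kp : 0 <= 1 + Ktr by rewrite addr_ge0.
exists (2 * ((1 + Ktr) * c) + 2 * c) => [|x B hx /=].
  by rewrite addr_ge0 ?mulr_ge0.
have h := hc _ _ hx; have := l2leB (l2le_T h) (l2leZ z h).
by rewrite hs ?inE ?eqxx // expr1n mul1r => /l2leW; apply; lra.
Qed.

Lemma modc_prodB (s : seq C) (z : C) : (forall k, k \in s -> modc k = 1) ->
  modc z <= R0 -> modc (\prod_(k <- s) (z - k)) <= (R0 + 1) ^+ size s.
Proof.
move=> hs zR; elim: s hs => [|k s IH] hs; first by rewrite big_nil modc1.
rewrite big_cons modcM exprS ler_pM ?modc_ge0 //.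
  by rewrite (le_trans (modcB _ _)) // lerD // hs // inE eqxx.
by apply: IH => j js; apply: hs; rewrite inE js orbT.
Qed.

(* Modulo (z - T)x, the polynomial in T acts on x as the scalar prod (z - k). *)
Lemma sp_resolvent s : (forall z, z \in s -> modc z = 1) ->
  exists2 c, 0 <= c & forall z x B, modc z <= R0 -> l2le (z *: x - T x) B ->
    l2le (shifted_product s x - (\prod_(k <- s) (z - k)) *: x) (c * B).
Proof.
elim: s => [|k s IH] hs.
  exists 0 => // z x B zR h /=; rewrite big_nil scale1r subrr mul0r; exact: l2le0.
have [|c c0 hc] := IH; first by move=> y ys; apply: hs; rewrite inE ys orbT.
have Kp : 0 <= 1 + Ktr by rewrite addr_ge0.
exists (2 * ((R0 + 1) ^+ 2) ^+ size s + 2 * (2 * ((1 + Ktr) * c) + 2 * c)).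
  by rewrite !(addr_ge0, mulr_ge0) // !exprn_ge0 // addr_ge0 // ltW // (lt_trans ltr01).
move=> z x B zR h; have B0 := l2le_ge0 h; have {hc}hG := hc z x B zR h.
set q := \prod_(k <- s) (z - k) in hG; set y := shifted_product s x in hG.
rewrite big_cons /= -/q -/y; set G := y - q *: x in hG.
have -> : T y - k *: y - ((z - k) * q) *: x =
    (- q) *: (z *: x - T x) + (T G - k *: G).
  have -> : y = q *: x + G by rewrite /G addrC subrK.
  rewrite TD TZ; apply/funext => i; rewrite /= !fctE /=.
  by rewrite /GRing.scale /=; ring.
have h1 := l2leZ (- q) h.
have h2 := l2leB (l2le_T hG) (l2leZ k hG).
apply: l2leW (l2leD h1 h2) _.
rewrite (hs k) ?inE ?eqxx // expr1n mul1r modcN.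
have : modc q ^+ 2 <= ((R0 + 1) ^+ 2) ^+ size s.
  rewrite -exprM mulnC exprM lerXn2r ?nnegrE ?modc_ge0 ?exprn_ge0 //.
    by rewrite addr_ge0 // ltW // (lt_trans ltr01).
  by apply: modc_prodB => // j js; apply: hs; rewrite inE js orbT.
move=> hq; rewrite [leRHS]mulrDl lerD //; last by rewrite le_eqVlt; apply/orP; left; apply/eqP; ring.
by rewrite -[leRHS]mulrA ler_wpM2l // ler_wpM2r.
Qed.

(** The vanishing factor |q(z)| disappears from the estimate: q(T) x equals q(z) x up to a term
    controlled by (z - T) x. The constant is therefore uniform as |z| decreases to 1. *)
Lemma apriori_sp : exists2 c, 0 <= c & forall z x B, 1 < modc z <= R0 -> ell2 x ->
  l2le (z *: x - T x) B -> E (qT x) <= c * B.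
Proof.
have [c c0 hc] := sp_resolvent zs1.
exists (2 * KA + 2 * (Ktr * c)) => [|z x B zR lx h].
  by rewrite !(addr_ge0, mulr_ge0).
have /andP[_ zR0] := zR.
have h1 := hc z x B zR0 h; have h2 := apriori zR lx h.
set q := \prod_(k <- zs) (z - k) in h1 h2.
have -> : qT x = q *: x + (qT x - q *: x) by rewrite addrC subrK.
apply: (le_trans (ED _ _)); rewrite EZ [leRHS]mulrDl.
apply: lerD; rewrite -[leRHS]mulrA ler_pM2l // -mulrA.
exact: trace_bound.
Qed.

(* Cutting the Laplace transform off linearly over K steps leaves a remainder of
   size 1 / K. *)
Definition cutoff (N K n : nat) : R :=
  if (n <= N)%N then 1 else ((N + K)%:R - n%:R) / K%:R.

(** Summation by parts: z - T telescopes the terms z^(-n-1) T^n f and leaves the increments of the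
    cutoff, which are 0 up to N and -1/K at the K following times. *)
Lemma cutoff_summation (N K : nat) (z : C) (f : seqC) : (0 < K)%N -> z != 0 ->
  let u n := iter n T f in
  let x := \sum_(n < N + K) ((cutoff N K n)%:C * z ^- n.+1) *: u n in
  z *: x - T x = f - \sum_(i < K) ((K%:R^-1)%:C * z ^- (N.+1 + i)) *: u (N.+1 + i)%N.
Proof.
move=> K0 z0 u x.
pose c n := (cutoff N K n)%:C.
have c1 n : (n <= N)%N -> c n = 1 by rewrite /c /cutoff => ->.
have cS n : (N < n)%N -> c n = c n.-1 - (K%:R^-1)%:C.
  case: n => // n Nn; rewrite /c -rmorphB; congr (_%:C).
  rewrite /cutoff leqNgt Nn /= -natr1; case: leqP => hn.
    have -> : n = N by apply/eqP; rewrite eqn_leq hn -ltnS.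
    by rewrite natrD; field; rewrite pnatr_eq0 -lt0n.
  by field; rewrite pnatr_eq0 -lt0n.
have cL : c (N + K)%N = 0.
  by rewrite /c /cutoff leqNgt -[X in (X < _)%N]addn0 ltn_add2l K0 subrr mul0r.
pose v n := z ^- n *: u n.
have term n : z *: ((c n * z ^- n.+1) *: u n) - T ((c n * z ^- n.+1) *: u n) =
    c n *: v n - c n *: v n.+1.
  rewrite TZ /v !scalerA; congr (_ *: _ - _).
  by rewrite exprS; field; rewrite z0 expf_neq0.
(* Since [0.-1] is 0, the increment at n = 0 vanishes and [f] accounts for the start of the sum. *)
have partial L : z *: (\sum_(n < L) (c n * z ^- n.+1) *: u n)
     - T (\sum_(n < L) (c n * z ^- n.+1) *: u n) =
     \sum_(n < L) (c n - c n.-1) *: v n + f - c L.-1 *: v L.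
  rewrite scaler_sumr (@Tsum L (fun n => (c n * z ^- n.+1) *: u n)) -sumrB.
  elim: L => [|L IH]; first by rewrite !big_ord0 add0r c1 // /v expr0 invr1 !scale1r subrr.
  rewrite !big_ord_recr /= IH term scalerBl.
  by apply/funext => i; rewrite /= !fctE /=; ring.
have -> : z *: x - T x = \sum_(n < N.+1 + K) (c n - c n.-1) *: v n + f.
  by rewrite /x partial addSn big_ord_recr /= cL sub0r scaleNr addrAC.
rewrite big_split_ord /= big1 ?add0r => [|i _]; last first.
  rewrite !c1 ?subrr ?scale0r // -ltnS //.
  by rewrite (leq_ltn_trans (leq_pred _)).
rewrite addrC -sumrN; congr (_ + _); apply: eq_bigr => i _.
rewrite cS; last by rewrite addSn ltnS leq_addr.
by rewrite /= addrAC subrr add0r scaleNr /v scalerA.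
Qed.

(** [apriori_sp] is applied at the points rho w^(-m) of a circle, w a root of unity, and summed over
    m. Parseval's identity turns both sides into sums over time. On the right the datum has weight 1
    and the K remainder terms have squared weight 1/K^2 each, in total 1/K. *)
Lemma weighted_trace_sum : exists2 c, 0 <= c & forall (rho : R) N K f B0 B1,
  1 < rho <= R0 -> (0 < K)%N -> l2le f B0 ->
  (forall n, (N < n <= N + K)%N -> l2le (iter n T f) (rho ^+ (2 * n) * B1)) ->
  \sum_(n < N.+1) rho ^- (2 * n.+1) * E (qT (iter n T f)) <=
    c * (B0 + B1 / K%:R).
Proof.
have [c c0 hc] := apriori_sp; exists c => // rho N K f B0 B1 hrho K0 hf hu.
have /andP[rho1 rhoR] := hrho.
have rho0 : 0 < rho by rewrite (lt_trans ltr01).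
have Kr0 : (0 : R) < K%:R by rewrite ltr0n.
pose u n := iter n T f.
(* As many roots of unity as time indices 0, ..., N + K in [F], so that Parseval's identity applies
   without aliasing. *)
pose L := (N.+1 + K)%N.
have M0 : (0 < L)%N by rewrite /L addSn.
have [w hw] := @primitive_root_exists R L M0.
have w1 := modc_prim_root hw.
pose z m : C := (rho^-1%:C * w ^+ m)^-1.
have zm m : modc (z m) = rho.
  rewrite modcV modcM modc_real modcX w1 expr1n mulr1 ger0_norm ?invrK //.
  by rewrite invr_ge0 ltW.
have z0 m : z m != 0 by rewrite -modc_gt0 zm.
have zV m n : z m ^- n = (rho ^- n)%:C * w ^+ (m * n).
  by rewrite -exprVn invrK exprMn -exprM -rmorphXn /= exprVn.
pose x m := \sum_(n < N + K) ((cutoff N K n)%:C * z m ^- n.+1) *: u n.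
pose F m := z m *: x m - T (x m).
have B10 : 0 <= B1.
  have := hu N.+1; rewrite leqnn -addn1 leq_add2l K0 => /(_ isT)/l2le_ge0.
  by rewrite pmulr_rge0 // exprn_gt0.
pose a n : R := if n == 0%N then 1 else if (N < n)%N then - K%:R^-1 else 0.
have FE m : F m = \sum_(n < L) ((a n)%:C * z m ^- n) *: u n.
  have e := @cutoff_summation N K (z m) f K0 (z0 m); rewrite /= in e.
  rewrite /F /x e /L big_split_ord /=; congr (_ + _).
    rewrite big_ord_recl /= expr0 invr1 mulr1 scale1r big1 ?addr0 // => i _.
    by rewrite /a /= ltnNge /bump /= add1n ltn_ord /= mul0r scale0r.
  rewrite -sumrN; apply: eq_bigr => i _.
  rewrite /a addSn /= ltnS leq_addr -scaleNr; congr (_ *: _).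
  by rewrite rmorphN mulNr.
have lu n : ell2 (u n) by exists ((1 + Ktr) ^+ n * B0); exact: l2le_iterT.
have ell2_comb k (F' : nat -> C) : ell2 (\sum_(n < k) F' n *: u n).
  have /choice[A hA] := lu.
  exists (k%:R * \sum_(n < k) modc (F' n) ^+ 2 * A n).
  by apply: (@l2le_sum _ _ (fun n => F' n *: u n) (fun n => modc (F' n) ^+ 2 * A n)) => n _; apply: l2leZ.
have lx m : ell2 (x m).
  exact: (ell2_comb _ (fun n => (cutoff N K n)%:C * z m ^- n.+1)).
have lF m : ell2 (F m).
  by rewrite FE; exact: (ell2_comb _ (fun n => (a n)%:C * z m ^- n)).
have hE m : E (qT (x m)) <= c * sqnorm (F m).
  by apply: (hc (z m) _ _ _ (lx m) (l2le_sqnorm (lF m))); rewrite zm.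
have Fi m i : F m i = \sum_(n < L) (a n * rho ^- n)%:C * u n i * w ^+ (m * n).
  rewrite FE fct_sumE; apply: eq_bigr => n _.
  change ((a n)%:C * z m ^- n * u n i = (a n * rho ^- n)%:C * u n i * w ^+ (m * n)).
  by rewrite zV rmorphM; ring.
have Hi i : \sum_(m < L) modc (F m i) ^+ 2 =
    L%:R * \sum_(n < L) (a n * rho ^- n) ^+ 2 * modc (u n i) ^+ 2.
  under eq_bigr do rewrite Fi.
  rewrite (@parseval _ L L w (fun n => (a n * rho ^- n)%:C * u n i)) //.
  congr (_ * _); apply: eq_bigr => n _.
  by rewrite modcM exprMn modc_real real_normK ?num_real.
have hF : \sum_(m < L) sqnorm (F m) <= L%:R * (B0 + B1 / K%:R).
  apply: sum_sqnorm_le => [m _|J]; first exact: lF.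
  rewrite exchange_big /=; under eq_bigr do rewrite Hi.
  rewrite -mulr_sumr ler_pM2l ?ltr0n // exchange_big /=.
  under eq_bigr => n _ do rewrite -mulr_sumr.
  rewrite /L big_split_ord /= lerD //.
    rewrite big_ord_recl /= [X in _ + X]big1 ?addr0 => [|i _].
      rewrite expr0 invr1 mulr1 expr1n mul1r.
      exact: hf.
    by rewrite /a /= ltnNge /bump /= add1n ltn_ord /= mul0r expr0n mul0r.
  apply: (@le_trans _ _ (\sum_(i < K) (B1 / K%:R ^+ 2))).
    apply: ler_sum => i _.
    have hN : (N < N.+1 + i <= N + K)%N.
      by rewrite addSn ltnS leq_addr -addnS leq_add2l ltn_ord.
    have := hu _ hN J; rewrite -/(u _) /a {hN} addSn /= ltnS leq_addr.
    set S := \sum_(_ < J) _; set n0 := (N + i).+1 => h.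
    have -> : (- K%:R^-1 / rho ^+ n0) ^+ 2 * S = S / rho ^+ (2 * n0) / K%:R ^+ 2.
      by rewrite mulnC exprM; field; rewrite gt_eqF //= expf_neq0 // gt_eqF.
    rewrite ler_wpM2r ?invr_ge0 ?exprn_ge0 // ler_pdivrMr ?exprn_gt0 //.
    by rewrite mulrC.
  rewrite sumr_const card_ord -mulr_natr expr2.
  by rewrite le_eqVlt; apply/orP; left; apply/eqP; field; rewrite gt_eqF.
have trx i m : tr i (qT (x m)) =
    \sum_(n < N + K) ((cutoff N K n * rho ^- n.+1)%:C * tr i (qT (u n)) * w ^+ (m * n)) * w ^+ m.
  rewrite /x (@sp_sum _ _ (fun n => ((cutoff N K n)%:C * z m ^- n.+1) *: u n)).
  rewrite (@tr_sum _ _ (fun n => qT (((cutoff N K n)%:C * z m ^- n.+1) *: u n))).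
  apply: eq_bigr => n _; rewrite spZ trZ zV mulnS exprD rmorphM /=; ring.
have hsum : \sum_(m < L) E (qT (x m)) = L%:R *
    \sum_(i < r) \sum_(n < N + K) modc ((cutoff N K n * rho ^- n.+1)%:C * tr i (qT (u n))) ^+ 2.
  rewrite /E exchange_big mulr_sumr; apply: eq_bigr => i _.
  rewrite -(@parseval _ L (N + K) w (fun n => (cutoff N K n * rho ^- n.+1)%:C * tr i (qT (u n)))) //.
  by apply: eq_bigr => m _; rewrite trx -mulr_suml modcM modcX w1 expr1n mulr1.
have : L%:R * (\sum_(i < r) \sum_(n < N + K) modc ((cutoff N K n * rho ^- n.+1)%:C * tr i (qT (u n))) ^+ 2)
    <= L%:R * (c * (B0 + B1 / K%:R)).
  rewrite -hsum [leRHS]mulrCA; apply: le_trans (ler_wpM2l c0 hF).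
  by rewrite mulr_sumr; apply: ler_sum => m _.
rewrite ler_pM2l ?ltr0n //; apply: le_trans.
(* The times n <= N have cutoff 1 and give the left side; the other K - 1 terms are nonnegative and
   dropped. *)
rewrite exchange_big /= -(prednK K0) addnS -addSn big_split_ord /= -[leLHS]addr0 lerD //.
  apply: ler_sum => n _; rewrite /E mulr_sumr; apply: ler_sum => i _.
  rewrite /cutoff -ltnS ltn_ord mul1r modcM exprMn modc_real real_normK ?num_real //.
  by rewrite mulnC exprM -exprVn.
by apply: sumr_ge0 => n _; apply: sumr_ge0 => i _; rewrite sqr_ge0.
Qed.

(** Iterated energy inequality, with the weights of [weighted_trace_sum] built in: the trace at time
    m gets the factor rho^(2(n - m - 1)) >= 1. *)
Lemma weighted_energy rho x A n : 1 <= rho -> l2le x A ->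
  l2le (iter n T x) (rho ^+ (2 * n) *
    (A + \sum_(m < n) rho ^- (2 * m.+1) * E (iter m T x))).
Proof.
move=> rho1 hx; have rho0 : 0 < rho by rewrite (lt_le_trans ltr01).
elim: n => [|n IH]; first by rewrite big_ord0 addr0 muln0 expr0 mul1r.
apply: l2leW (energy IH) _; rewrite big_ord_recr /=.
set S := \sum_(m < n) _ in IH *; set e := E _.
have S0 : 0 <= A + S.
  by have := l2le_ge0 IH; rewrite pmulr_rge0 // exprn_gt0.
rewrite addrA [leRHS]mulrDr mulrA divff ?mul1r ?expf_neq0 ?gt_eqF // lerD2r.
rewrite ler_wpM2r // mulnS exprD ler_peMl ?exprn_ge0 ?(ltW rho0) //.
by rewrite exprn_ege1.
Qed.

(** [M] refers to squared norms. For fixed N some M is available at once; what has to be gained is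
    independence of N and rho. *)
Definition growth rho (N : nat) (M : R) := forall f B, l2le f B ->
  forall n, (n <= N)%N -> l2le (iter n T f) (rho ^+ (2 * n) * (M * B)).

Lemma iter_eigen n z x : T x = z *: x -> iter n T x = z ^+ n *: x.
Proof.
move=> h; elim: n => [|n IH]; first by rewrite expr0 scale1r.
by rewrite /= IH TZ h scalerA exprSr.
Qed.

(* As soon as c * MK <= K / 2, bounds over K steps only give bounds for every N,
   which allows rho to be lowered towards 1. *)
Lemma growth_step : exists2 c, 1 <= c & forall rho N K M MK,
  1 < rho <= R0 -> (0 < K)%N -> 0 <= M -> 0 <= MK ->
  growth rho N M -> growth rho K MK -> growth rho N (c * (1 + MK * M / K%:R)).
Proof.
have [c c0 hc] := weighted_trace_sum; have [d d0 hd] := l2le_sp zs1.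
pose n0 : R := (size zs)%:R.
have n00 : 0 <= n0 by rewrite ler0n.
exists (1 + (2 * (n0 * (n0 * KD)) + 2 * (d * KD + c * KD) + 2 * (c * KD))).
  by rewrite lerDl !(addr_ge0, mulr_ge0).
move=> rho N K M MK hrho K0 M0 MK0 hN hK f B hf n nN.
have /andP[rho1 _] := hrho; have rho0 : 0 < rho by rewrite (lt_trans ltr01).
have B0 := l2le_ge0 hf.
have Kr0 : (0 : R) < K%:R by rewrite ltr0n.
have [phi [g [-> hphi hg]]] := decomposition hf.
rewrite iterTD iterT_sum -sp_iter.
pose B1 := MK * (M * (KD * B)).
have B10 : 0 <= B1 by rewrite !mulr_ge0.
(* A time in (N, N + K] is reached by N steps followed by at most K more, so the two growth
   constants multiply. *)
have hg1 m : (N < m <= N + K)%N -> l2le (iter m T g) (rho ^+ (2 * m) * B1).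
  move=> /andP[Nm mNK].
  have -> : m = ((m - N) + N)%N by rewrite subnK // ltnW.
  rewrite iterD mulnDr exprD -mulrA [rho ^+ (2 * N) * B1]mulrCA.
  by apply: (hK _ _ (hN _ _ hg _ (leqnn N))); rewrite leq_subLR.
have hsum := hc _ _ _ _ _ _ hrho K0 hg hg1.
(* q(T) commutes with T, so the traces met along the orbit of q(T) g are those summed in [hsum]. *)
have h1 := weighted_energy n (ltW rho1) (hd _ _ hg).
have h2 : l2le (qT (iter n T g)) (rho ^+ (2 * n) * (d * (KD * B) + c * (KD * B + B1 / K%:R))).
  rewrite sp_iter; apply: l2leW h1 _.
  rewrite ler_wpM2l ?exprn_ge0 ?(ltW rho0) // lerD2l; apply: le_trans hsum.
  under eq_bigr do rewrite -sp_iter.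
  rewrite -(subnKC nN) -addnS big_split_ord /= lerDl.
  apply: sumr_ge0 => i _; rewrite mulr_ge0 ?E_ge0 //.
  by rewrite invr_ge0 exprn_ge0 // ltW.
have h3 : l2le (\sum_(k < size zs) iter n T (phi k)) (n0 * \sum_(k < size zs) (KD * B)).
  apply: (@l2le_sum _ _ (fun k => iter n T (phi k)) (fun=> KD * B)) => k kz.
  have [e hk] := hphi k kz.
  rewrite (iter_eigen _ e); have := l2leZ (zs`_k ^+ n) hk.
  by rewrite modcX zs1 ?mem_nth // !expr1n mul1r.
apply: l2leW (l2leD h3 h2) _.
rewrite sumr_const card_ord -[_ *+ size zs]mulr_natl -/n0.
have rn1 : 1 <= rho ^+ (2 * n) by rewrite exprn_ege1 // ltW.
set X := rho ^+ (2 * n) in rn1 *; have X0 : 0 <= X by rewrite (le_trans ler01).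
set t := MK * M / K%:R; have t0 : 0 <= t by rewrite !mulr_ge0 // invr_ge0 ltW.
have -> : B1 / K%:R = KD * t * B by rewrite /B1 /t; field; rewrite gt_eqF.
apply: (@le_trans _ _ (X * ((2 * (n0 * (n0 * KD)) + 2 * (d * KD + c * KD) + 2 * (c * KD) * t) * B))).
  have -> : X * ((2 * (n0 * (n0 * KD)) + 2 * (d * KD + c * KD) + 2 * (c * KD) * t) * B) =
     X * (2 * (n0 * (n0 * (KD * B)))) + 2 * (X * (d * (KD * B) + c * (KD * B + KD * t * B))) by ring.
  by rewrite lerD2r ler_peMl // !mulr_ge0.
rewrite ler_wpM2l // ler_wpM2r //.
set a1 := 2 * (n0 * _) + _; set a2 := 2 * (c * KD).
have a10 : 0 <= a1 by rewrite /a1 !(addr_ge0, mulr_ge0).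
have a20 : 0 <= a2 by rewrite /a2 !mulr_ge0.
nra.
Qed.

(** Iterating M' -> c + M'/2 from M gives 2c + (M - 2c)/2^k after k rounds. In the limit the
    starting constant, which may depend on N, is forgotten. *)
Lemma growth_closed rho N c M : 0 <= M ->
  (forall M', 0 <= M' -> growth rho N M' -> growth rho N (c + M' / 2)) -> 0 <= c ->
  growth rho N M -> growth rho N (2 * c).
Proof.
move=> M0 step c0 h0 f B hf n nN m.
have B0 := l2le_ge0 hf.
have hk k : growth rho N (2 * c + M / 2 ^+ k).
  have : growth rho N (2 * c + (M - 2 * c) / 2 ^+ k).
    have H (M1 M2 : R) : M1 = M2 -> growth rho N M1 -> growth rho N M2 by move=> ->.
    have pos : forall k, 0 <= 2 * c + (M - 2 * c) / 2 ^+ k.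
      move=> j; have -> : 2 * c + (M - 2 * c) / 2 ^+ j = 2 * c * (1 - 2 ^- j) + M / 2 ^+ j by ring.
      rewrite addr_ge0 ?divr_ge0 ?exprn_ge0 // mulr_ge0 ?mulr_ge0 // subr_ge0.
      by rewrite invf_le1 ?exprn_gt0 // exprn_ege1 // ler1n.
    elim: k => [|k IH]; first by apply: H h0; rewrite expr0; field.
    by apply: H (step _ (pos k) IH); rewrite exprS; field; rewrite expf_neq0.
  move=> h f' B' hf' n' n'N; apply: l2leW (h f' B' hf' n' n'N) _.
  have B'0 := l2le_ge0 hf'.
  have rho0 : 0 <= rho ^+ (2 * n') by rewrite exprM exprn_ge0 ?sqr_ge0.
  rewrite ler_wpM2l // ler_wpM2r // lerD2l ler_wpM2r ?invr_ge0 ?exprn_ge0 //.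
  by rewrite gerBl mulr_ge0.
set S := \sum_(i < m) _.
have rho0 : 0 <= rho ^+ (2 * n) by rewrite exprM exprn_ge0 ?sqr_ge0.
apply/ler_addgt0Pr => e e0.
have [k hkk] : exists k : nat, rho ^+ (2 * n) * (M * B) / e <= 2 ^+ k.
  exists (Num.bound (rho ^+ (2 * n) * (M * B) / e)).
  have X0 : 0 <= rho ^+ (2 * n) * (M * B) / e by rewrite !mulr_ge0 // invr_ge0 ltW.
  rewrite (le_trans (ltW (archi_boundP X0))) // -natrX ler_nat ltnW // ltn_expl //.
apply: (le_trans (hk k f B hf n nN m)).
rewrite mulrDl mulrDr lerD2l.
by rewrite [M / _ * B]mulrAC mulrA ler_pdivrMr ?exprn_gt0 // -ler_pdivrMl // mulrC.
Qed.

(** Bernoulli's inequality for the inverse, used to bound (1 + x)^n from above when n x < 1. *)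
Lemma bernoulli_inv (x : R) n : 0 <= x -> (1 + x) ^+ n * (1 - n%:R * x) <= 1.
Proof.
move=> x0; elim: n => [|n IH]; first by rewrite expr0 mul0r subr0 mulr1.
apply: le_trans IH; rewrite exprSr -mulrA ler_wpM2l ?exprn_ge0 ?addr_ge0 //.
rewrite -natr1; have : 0 <= n%:R * x ^+ 2 by rewrite mulr_ge0 ?sqr_ge0.
have := sqr_ge0 x; rewrite expr2 => h1 h2; nra.
Qed.

Theorem power_bounded : exists2 c, 0 < c & forall f B n, l2le f B ->
  l2le (iter n T f) (c * B).
Proof.
have [c c1 step] := growth_step.
have c0 : 0 < c by rewrite (lt_le_trans ltr01).
(* With [MK <= 4 * c], the choice K >= 8 c^2 gives c MK <= K / 2, the contraction factor 1/2 that
   [growth_closed] asks for. *)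
pose K := (Num.bound (8 * c ^+ 2)).+1.
have K0 : (0 < K)%N by [].
have Kr0 : (0 : R) < K%:R by rewrite ltr0n.
have hK : 8 * c ^+ 2 <= K%:R.
  have X0 : 0 <= 8 * c ^+ 2 by rewrite mulr_ge0 // sqr_ge0.
  by rewrite (le_trans (ltW (archi_boundP X0))) // ler_nat.
have close rho MK : 1 < rho <= R0 -> 0 <= MK <= 4 * c -> growth rho K MK ->
    forall N, growth rho N (2 * c).
  move=> hrho /andP[MK0 MKc] gK N.
  have /andP[rho1 _] := hrho.
  (* Any finite starting constant will do, so the crude bound of N steps by powers of 1 + Ktr
     suffices. *)
  apply: (@growth_closed _ _ _ ((1 + Ktr) ^+ N)); rewrite ?exprn_ge0 ?addr_ge0 ?(ltW c0) //.
    move=> M' M'0 hM' f B hf n nN.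
    have B0 := l2le_ge0 hf.
    apply: l2leW (step _ _ _ _ _ hrho K0 M'0 MK0 hM' gK f B hf n nN) _.
    rewrite ler_wpM2l ?exprn_ge0 ?(le_trans ler01 (ltW rho1)) // ler_wpM2r //.
    rewrite mulrDr mulr1 lerD2l.
    have -> : c * (MK * M' / K%:R) = c * MK * 2 / K%:R * (M' / 2).
      by field; rewrite gt_eqF.
    rewrite ler_piMl ?divr_ge0 // ler_pdivrMr // mul1r.
    by rewrite expr2 in hK; nra.
  move=> f B hf n nN; have B0 := l2le_ge0 hf.
  apply: l2leW (l2le_iterT n hf) _.
  apply: (@le_trans _ _ ((1 + Ktr) ^+ N * B)).
    rewrite ler_wpM2r // ler_weXn2l // lerDl //.
  by rewrite ler_peMl ?mulr_ge0 ?exprn_ge0 ?addr_ge0 // exprn_ege1 // ltW.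
(* Then 2K e = 1/2, and [bernoulli_inv] gives (1 + e)^(2K) <= 2. *)
pose e : R := (4 * K%:R)^-1.
have e0 : 0 < e by rewrite invr_gt0 mulr_gt0.
pose t := 1 + e.
have t1 : 1 < t by rewrite /t ltrDl.
have t0 : 0 < t by rewrite (lt_trans ltr01).
have tK : t ^+ (2 * K) <= 2.
  have := bernoulli_inv (2 * K) (ltW e0); rewrite -/t natrM.
  have -> : 2%:R * K%:R * e = 2^-1 :> R by rewrite /e; field; rewrite gt_eqF.
  by lra.
(* Descent of rho from R0 by factors [t]. Passing from rho t to rho over K steps turns the constant
   2c into at most 4c, and [close] brings it back to 2c. *)
have all_rho i : forall rho, 1 < rho <= R0 -> R0 <= rho * t ^+ i ->
    forall N, growth rho N (2 * c).
  elim: i => [|i IH] rho hrho hi.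
    have er : rho = R0.
      by apply/eqP; rewrite eq_le (andP hrho).2 /=; rewrite expr0 mulr1 in hi.
    (* At R0 one step multiplies the squared norm by at most 1 + Ktr <= R0^2, so MK = 1. *)
    apply: (close _ 1) => //; first by rewrite ler01; lra.
    move=> f B hf n nK; rewrite mul1r er.
    apply: l2leW (l2le_iterT n hf) _.
    rewrite ler_wpM2r ?(l2le_ge0 hf) // exprM lerXn2r ?nnegrE ?addr_ge0 ?sqr_ge0 //.
  have /andP[rho1 rhoR] := hrho; have rho0 : 0 < rho by rewrite (lt_trans ltr01).
  pose rho' := Num.min R0 (rho * t).
  have rho'1 : 1 < rho' <= R0.
    rewrite /rho' lt_min R0_gt1 ge_min lexx /= andbT.
    by rewrite (lt_le_trans rho1) // ler_peMr // ltW.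
  have g' : forall N, growth rho' N (2 * c).
    apply: IH => //; rewrite /rho' minr_pMl ?exprn_ge0 ?(ltW t0) //.
    rewrite le_min ler_peMr ?exprn_ege1 ?(ltW t1) ?(le_trans ler01 (ltW R0_gt1)) //=.
    by rewrite -mulrA -exprS.
  apply: (close _ (4 * c)) => //; first by rewrite lexx mulr_ge0 // ltW.
  move=> f B hf n nK; have B0 := l2le_ge0 hf.
  apply: l2leW (g' K f B hf n nK) _.
  have h : rho' ^+ (2 * n) <= rho ^+ (2 * n) * 2.
    apply: (@le_trans _ _ ((rho * t) ^+ (2 * n))).
      rewrite lerXn2r ?nnegrE ?mulr_ge0 ?(ltW rho0) ?(ltW t0) //.
        by rewrite ltW // (lt_trans ltr01) //; case/andP: rho'1.
      by rewrite ge_min lexx orbT.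
    rewrite exprMn ler_wpM2l ?exprn_ge0 ?(ltW rho0) // (le_trans _ tK) //.
    by rewrite ler_weXn2l ?(ltW t1) // leq_mul2l.
  have -> : rho ^+ (2 * n) * (4 * c * B) = rho ^+ (2 * n) * 2 * (2 * c * B) by ring.
  by rewrite ler_wpM2r // !mulr_ge0 // ltW.
have large rho : 1 < rho <= R0 -> forall N, growth rho N (2 * c).
  move=> hrho; have /andP[rho1 _] := hrho.
  have X0 : 0 <= R0 / e by rewrite divr_ge0 ?(ltW e0) // (le_trans ler01 (ltW R0_gt1)).
  apply: (all_rho (Num.bound (R0 / e))) => //.
  have h := ltW (archi_boundP X0); set i := Num.bound _ in h *.
  apply: (@le_trans _ _ (t ^+ i)); last by rewrite ler_peMl ?exprn_ge0 ?(ltW t0) // ltW.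
  apply: (@le_trans _ _ (1 + i%:R * e)).
    by rewrite ler_pdivrMr // in h; rewrite (le_trans h) // lerDr.
  elim: (i) => [|j IH]; first by rewrite mul0r addr0 expr0.
  rewrite exprS -natr1; apply: (@le_trans _ _ (t * (1 + j%:R * e))); last by rewrite ler_pM2l.
  have : 0 <= j%:R * e * e by rewrite !mulr_ge0 // ltW.
  by rewrite /t; nra.
exists (2 * c) => [|f B n hf m]; first by rewrite mulr_gt0.
have B0 := l2le_ge0 hf.
set S := \sum_(i < m) _; have S0 : 0 <= S by apply: sumr_ge0 => i _; exact: sqr_ge0.
have Y0 : 0 <= 2 * c * B by rewrite !mulr_ge0 // ltW.
apply/ler_addgt0Pr => d d0.
(* Here n and the partial sum are fixed while rho = 1 + x tends to 1: x makes 2 n x S <= d, so by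
   [bernoulli_inv] the factor rho^(2n) costs at most d. *)
pose x := Num.min (R0 - 1) (d / ((2 * n)%:R * S + 1)).
have D0 : 0 < (2 * n)%:R * S + 1 by rewrite ltr_wpDl // mulr_ge0.
have x0 : 0 < x by rewrite lt_min subr_gt0 R0_gt1 divr_gt0.
have hx : 1 < 1 + x <= R0 by rewrite ltrDl x0 -lerBrDl ge_min lexx.
have := large _ hx n f B hf n (leqnn n) m; rewrite -/S => h.
have hb := bernoulli_inv (2 * n) (ltW x0).
have hxd : x * ((2 * n)%:R * S + 1) <= d by rewrite -ler_pdivlMr // ge_min lexx orbT.
have [neg|pos] := leP (1 - (2 * n)%:R * x) 0.
  have : S * (1 - (2 * n)%:R * x) <= 0 by rewrite mulr_ge0_le0.
  by nra.
have : S * (1 - (2 * n)%:R * x) <= 2 * c * B.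
  apply: (@le_trans _ _ ((1 + x) ^+ (2 * n) * (2 * c * B) * (1 - (2 * n)%:R * x))).
    by rewrite ler_wpM2r // ltW.
  by rewrite mulrAC ler_piMl.
by nra.
Qed.

End PowerBound.

(** * Companion matrices and the characteristic polynomial *)

Section CompanionAlgebra.
Variables (K : fieldType) (n : nat) (A : 'M[K]_n.+1).
Hypothesis subdiagonal : forall i j : 'I_n.+1, i != ord0 -> A i j = (i == j.+1 :> nat)%:R.

Local Notation last_row := (delta_mx ord0 ord_max : 'rV[K]_n.+1).

(** The last basis vector is cyclic: multiplication by A moves it one coordinate to the left.
    Polynomials in A of degree at most n are thus read off from their action on it. *)
Lemma last_row_exp k : (k <= n)%N ->
  last_row *m A ^+ k = \row_j (j == n - k :> nat)%N%:R.
Proof.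
elim: k => [|k IH] kn.
  by rewrite expr0 mulmx1; apply/rowP => j; rewrite !mxE eqxx subn0 -val_eqE.
rewrite exprSr mulmxA IH ?(ltnW kn) //; apply/rowP => j; rewrite !mxE.
have kn' : (n - k < n.+1)%N by rewrite ltnS leq_subr.
rewrite (bigD1 (Ordinal kn')) //= big1 ?addr0 => [|i /eqP hi]; last first.
  rewrite !mxE; case: eqP => [e|]; last by rewrite mul0r.
  by case: hi; apply: val_inj.
rewrite !mxE eqxx mul1r subdiagonal; last by rewrite -val_eqE /= subn_eq0 -ltnNge.
by rewrite /= -(subnSK kn) eqSS eq_sym.
Qed.

Lemma last_row_horner (D : {poly K}) : (size D <= n.+1)%N ->
  last_row *m horner_mx A D = \row_j D`_(n - j).
Proof.
move=> sD.
have -> : D = \sum_(k < n.+1) D`_k *: 'X^k.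
  by rewrite -poly_def -[LHS]coefK; apply/polyP => k; rewrite !coef_poly;
    case: ltnP => h1; case: ltnP => h2 //; [rewrite leqNgt (leq_trans h1) in h2 |
    rewrite nth_default].
rewrite rmorph_sum /= mulmx_sumr; apply/rowP => j; rewrite summxE mxE.
rewrite coef_sum; apply: eq_bigr => k _.
rewrite linearZ /= rmorphXn /= horner_mx_X -scalemxAr last_row_exp -1?ltnS //.
rewrite !mxE coefZ coefXn; congr (_ * _%:R); congr (nat_of_bool _).
have := ltn_ord k; have := ltn_ord j; rewrite !ltnS => jn kn.
by apply/eqP/eqP => [->|<-]; rewrite subKn.
Qed.

(** Both Q and the characteristic polynomial annihilate the cyclic vector. Their difference has
    degree at most n, so its coefficients are the entries of a zero vector. *)
Lemma char_poly_companion (Q : {poly K}) : Q \is monic -> size Q = n.+2 ->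
  (forall j, A ord0 j = - Q`_(n - j)) -> char_poly A = Q.
Proof.
move=> mQ sQ h0.
have last_Q : last_row *m horner_mx A Q = 0.
  have -> : Q = 'X^(n.+1) + (Q - 'X^(n.+1)) by rewrite addrC subrK.
  have sD : (size (Q - 'X^(n.+1))%R <= n.+1)%N.
    apply/leq_sizeP => k; rewrite leq_eqVlt coefB coefXn => /predU1P[<-|nk].
      by rewrite eqxx; move/monicP: mQ; rewrite lead_coefE sQ /= => ->; rewrite subrr.
    by rewrite nth_default ?sQ // gtn_eqF // subr0.
  rewrite rmorphD /= mulmxDr (last_row_horner sD) rmorphXn /= horner_mx_X.
  rewrite exprSr mulmxA last_row_exp // subnn; apply/rowP => j; rewrite !mxE.
  rewrite (bigD1 ord0) //= big1 ?addr0 => [|i i0]; last first.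
    by rewrite !mxE -val_eqE in i0 *; rewrite (negPf i0) mul0r.
  rewrite !mxE eqxx mul1r h0 coefB coefXn ltn_eqF ?subr0 ?addNr //.
  by rewrite ltnS leq_subr.
have sD : (size (Q - char_poly A)%R <= n.+1)%N.
  apply/leq_sizeP => k; rewrite leq_eqVlt coefB => /predU1P[<-|nk].
    have /monicP := char_poly_monic A; move/monicP: mQ.
    by rewrite !lead_coefE size_char_poly sQ /= => -> ->; rewrite subrr.
  by rewrite !nth_default ?sQ ?size_char_poly ?subrr.
have := last_row_horner sD; rewrite rmorphB /= mulmxBr last_Q.
have := Cayley_Hamilton A => ->; rewrite mulmx0 subrr => /rowP hD.
apply/eqP; rewrite eq_sym -subr_eq0; apply/eqP/polyP => k; rewrite coef0.
have [kn|nk] := ltnP k n.+1; last by apply: (leq_sizeP _ _ sD).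
have kn' : (n - k < n.+1)%N by rewrite ltnS leq_subr.
by have := hD (Ordinal kn'); rewrite !mxE /= subKn // => <-.
Qed.

(* The rows X^i S, i < n + 1 - deg S, in the basis 1, X, ..., X^n. *)
Definition band_mx q (S : {poly K}) : 'M[K]_(q, n.+1) :=
  \matrix_(i, j) (S * 'X^i)`_(n - j).

(** The band matrix factors through S(A). Its rank bounds that of S(A) from below, and the kernel of
    the transpose of S(A) lies in that of the band matrix. *)
Lemma band_mxE q (S : {poly K}) : (size S + q <= n.+2)%N ->
  band_mx q S = \matrix_i (last_row *m A ^+ i) *m horner_mx A S.
Proof.
move=> sq; apply/row_matrixP => i; rewrite row_mul rowK -mulmxA.
have -> : A ^+ i *m horner_mx A S = horner_mx A (S * 'X^i).
  by rewrite mulrC rmorphM rmorphXn /= horner_mx_X.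
rewrite last_row_horner; first by apply/rowP => j; rewrite !mxE.
rewrite (leq_trans (size_polyMleq _ _)) // size_polyXn addnS /= -ltnS.
by rewrite (leq_trans _ sq) // -addnS leq_add2l.
Qed.

Lemma band_mx_free q (S : {poly K}) : S \is monic -> (size S + q <= n.+2)%N ->
  row_free (band_mx q S).
Proof.
move=> mS sq; rewrite -kermx_eq0; apply/rowV0P => v /sub_kermxP hv.
have S0 := monic_neq0 mS.
have : rVpoly v * S = 0.
  apply/polyP => k; rewrite coef0.
  have [kn|nk] := ltnP k n.+1; last first.
    rewrite nth_default // (leq_trans _ nk) // (leq_trans (size_polyMleq _ _)) //.
    rewrite -ltnS; have := size_poly q (fun k => if insub k is Some i then v 0 i else 0).
    rewrite -/(rVpoly v); move: (size (rVpoly v)) sq => d; case: (size S) (size_poly_gt0 S) => [|s _] /=.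
      by rewrite S0.
    lia.
  have kn' : (n - k < n.+1)%N by rewrite ltnS leq_subr.
  move/rowP: hv => /(_ (Ordinal kn')); rewrite !mxE /= => hv.
  rewrite -[RHS]hv [rVpoly v](_ : _ = \sum_(i < q) v 0 i *: 'X^i); last first.
    rewrite /rVpoly poly_def; apply: eq_bigr => i _; rewrite insubT //= => ?.
    by congr (v 0 _ *: _); apply: val_inj.
  rewrite mulr_suml coef_sum; apply: eq_bigr => i _.
  by rewrite !mxE /= subKn // mulrC -scalerAr coefZ.
move=> /eqP; rewrite mulf_eq0 (negPf S0) orbF => /eqP hv0.
by rewrite -[v]rVpolyK hv0 linear0.
Qed.

Lemma rank_horner_ge (S : {poly K}) : S \is monic -> (size S <= n.+2)%N ->
  (n.+2 - size S <= \rank (horner_mx A S))%N.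
Proof.
move=> mS sS; have hq : (size S + (n.+2 - size S) <= n.+2)%N by rewrite subnKC.
have /eqP <- := band_mx_free mS hq; rewrite (band_mxE hq); exact: mxrankM_maxr.
Qed.

(** By Cayley-Hamilton S(A) U(A) = 0, so the two ranks add up to at most n + 1, which is also the
    sum of the lower bounds of [rank_horner_ge]. *)
Lemma rank_horner (S U : {poly K}) : S \is monic -> U \is monic ->
  S * U = char_poly A -> \rank (horner_mx A S) = (n.+2 - size S)%N.
Proof.
move=> mS mU SU; have S0 := monic_neq0 mS; have U0 := monic_neq0 mU.
have sSU : (size S + size U = n.+3)%N.
  have := size_mul S0 U0; rewrite SU size_char_poly.
  have : (0 < size S)%N by rewrite size_poly_gt0.
  by case: (size S) => // k _; rewrite addSn /= => <-.
have sS : (size S <= n.+2)%N.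
  by rewrite -ltnS -sSU -addn1 leq_add2l size_poly_gt0.
have sU : (size U <= n.+2)%N.
  by rewrite -ltnS -sSU -add1n leq_add2r size_poly_gt0.
have hS := rank_horner_ge mS sS; have hU := rank_horner_ge mU sU.
have : horner_mx A S *m horner_mx A U = 0.
  by rewrite mulmxE -rmorphM SU /= Cayley_Hamilton.
move=> /mulmx0_rank_max; move: hS hU sSU sS sU.
by move: (size S) (size U) (\rank _) (\rank _) => a b c d; lia.
Qed.

End CompanionAlgebra.

(** * Sums of generalized eigenspaces as kernels of matrix polynomials *)

Section GeneralizedEigenspaces.
Variables (K : fieldType) (n : nat) (B : 'M[K]_n.+1).
Implicit Types (s : seq K) (P : pred K).

Lemma coprime_prod_XsubC s (x : K) : x \notin s ->
  coprimep ('X - x%:P) (\prod_(y <- s) ('X - y%:P)).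
Proof.
elim: s => [|y s IH]; first by rewrite big_nil coprimep1.
rewrite inE negb_or big_cons coprimepMr => /andP[xy xs].
by rewrite IH // coprimep_XsubC root_XsubC eq_sym xy.
Qed.

(** A selected root x is not a root of the complementary product U, so Bezout writes S as a multiple
    of (X - x)^(n+1) modulo the characteristic polynomial. *)
Lemma sum_geigenspace_sub s P : char_poly B = \prod_(y <- s) ('X - y%:P) ->
  (\sum_(x <- s | P x) geigenspace B x <=
     kermx (horner_mx B (\prod_(y <- s | P y) ('X - y%:P))))%MS.
Proof.
move=> hs; rewrite big_seq_cond; elim/big_ind: _ => [|C D|x /andP[xs Px]]; first exact: sub0mx.
  by move=> hC hD; rewrite addsmx_sub hC.
set S := \prod_(y <- s | P y) _; pose U := \prod_(y <- s | ~~ P y) ('X - y%:P).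
have SU : S * U = char_poly B by rewrite hs (bigID P).
have /Bezout_eq1_coprimepP[[u v] /= uv] : coprimep (('X - x%:P) ^+ n.+1) U.
  rewrite coprimep_expl // /U -big_filter coprime_prod_XsubC //.
  by rewrite mem_filter Px.
apply/sub_kermxP; apply/row_matrixP => i; rewrite row_mul row0.
set y := row i _; have hy : y *m horner_mx B (('X - x%:P) ^+ n.+1) = 0.
  apply/sub_kermxP; rewrite /y; exact: row_sub.
have -> : horner_mx B S = horner_mx B (('X - x%:P) ^+ n.+1) *m horner_mx B (u * S)
    + horner_mx B v *m horner_mx B (char_poly B).
  rewrite !mulmxE -[in RHS]rmorphM -[in RHS]rmorphM -rmorphD -SU.
  by congr (horner_mx B _); rewrite -[LHS]mul1r -uv; ring.
by rewrite mulmxDr !mulmxA hy mul0mx add0r -mulmxA Cayley_Hamilton !mulmx0.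
Qed.

Lemma kermxpolyX_geigen x e : (e <= n.+1)%N ->
  (kermxpoly B (('X - x%:P) ^+ e) <= geigenspace B x)%MS.
Proof.
move=> en; rewrite /geigenspace.
have -> : ('X - x%:P) ^+ n.+1 = ('X - x%:P) ^+ e * ('X - x%:P) ^+ (n.+1 - e).
  by rewrite -exprD subnKC.
rewrite /kermxpoly rmorphM /=.
by apply/sub_kermxP; rewrite -mulmxE mulmxA mulmx_ker mul0mx.
Qed.

Lemma ker_prod_sub_geigen s (V : 'M[K]_n.+1) (e : K -> nat) : uniq s ->
  (forall x, x \in s -> (e x <= n.+1)%N /\ (geigenspace B x <= V)%MS) ->
  (kermxpoly B (\prod_(x <- s) ('X - x%:P) ^+ e x) <= V)%MS.
Proof.
elim: s => [|x s IH]; first by rewrite big_nil kermxpoly1 sub0mx.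
move=> /= /andP[xs us] h; rewrite big_cons kermxpolyM.
  rewrite addsmx_sub IH ?andbT // => [|y ys]; last by apply: h; rewrite inE ys orbT.
  have [ex hx] := h x (mem_head _ _).
  exact: submx_trans (kermxpolyX_geigen x ex) hx.
apply: coprimep_expl; elim: s xs {us IH h} => [|y s IH]; first by rewrite big_nil coprimep1.
rewrite inE negb_or big_cons coprimepMr => /andP[xy xs].
by rewrite IH // andbT coprimep_expr // coprimep_XsubC root_XsubC eq_sym xy.
Qed.

(** This makes the stable space of the hypotheses the kernel of one polynomial in the companion
    matrix, whose rank [rank_horner] computes. For the converse inclusion repeated roots are
    gathered into powers, with multiplicities at most n + 1. *)
Lemma sum_geigenspace_eq s P : char_poly B = \prod_(y <- s) ('X - y%:P) ->
  (\sum_(x <- s | P x) geigenspace B x :=: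
     kermx (horner_mx B (\prod_(y <- s | P y) ('X - y%:P))))%MS.
Proof.
move=> hs; apply/eqmxP; rewrite sum_geigenspace_sub //=.
change (kermxpoly B (\prod_(y <- s | P y) ('X - y%:P)) <= \sum_(x <- s | P x) geigenspace B x)%MS.
have ss : size s = n.+1.
  by apply: succn_inj; rewrite -(size_prod_XsubC s id) -hs size_char_poly.
rewrite -big_filter -prodr_undup_exp_count; apply: ker_prod_sub_geigen.
  exact: undup_uniq.
move=> x; rewrite mem_undup => xs; split.
  rewrite -ss (leq_trans (count_size _ _)) // size_filter count_size //.
rewrite -big_filter; elim: [seq x <- s | P x] xs => // y t IH.
rewrite inE big_cons => /predU1P[->|/IH h]; first exact: addsmxSl.
exact: submx_trans h (addsmxSr _ _).
Qed.

End GeneralizedEigenspaces.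

(** * The symbol on the unit circle and the characteristic polynomial *)

Section Symbol.
Context {R : realType}.
Local Notation C := R[i].

Definition expi (t : R) : C := cos t +i* sin t.

Lemma expiD s t : expi (s + t) = expi s * expi t.
Proof.
rewrite /expi cosD sinD; apply/eqP; rewrite eq_complex /=; apply/andP.
by split; apply/eqP; ring.
Qed.

Lemma expi0 : expi 0 = 1.
Proof. by rewrite /expi cos0 sin0. Qed.

Lemma expiMn n t : expi (n%:R * t) = expi t ^+ n.
Proof.
elim: n => [|n IH]; first by rewrite mul0r expi0 expr0.
by rewrite -natr1 mulrDl mul1r expiD IH exprSr.
Qed.

Lemma modc_expi t : modc (expi t) = 1.
Proof. by rewrite /expi /modc /= cos2Dsin2 sqrtr1. Qed.

Lemma polar (k : C) : modc k = 1 -> exists2 t, - pi <= t <= pi & k = expi t.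
Proof.
case: k => x y; rewrite /modc /= => h.
have {h}xy : x ^+ 2 + y ^+ 2 = 1.
  have h0 : 0 <= x ^+ 2 + y ^+ 2 by rewrite addr_ge0 ?sqr_ge0.
  by rewrite -(sqr_sqrtr h0) h expr1n.
have x1 : -1 <= x <= 1.
  have : x ^+ 2 <= 1 by rewrite -xy lerDl sqr_ge0.
  by rewrite -[X in _ <= X](expr1n _ 2) -ler_sqrt // !sqrtr_sqr normr1 ler_norml.
have [h0 hpi] := (acos_ge0 x1, acos_lepi x1).
have hpi0 := pi_ge0 R.
have sc : sin (acos x) ^+ 2 = y ^+ 2.
  by rewrite sin2cos2 acosK // -xy; ring.
have /eqP := sc; rewrite eqf_sqr => /orP[/eqP e|/eqP e].
  exists (acos x); first by rewrite hpi andbT (le_trans _ h0) // oppr_le0.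
  by rewrite /expi acosK // e.
exists (- acos x); first by rewrite lerN2 hpi (le_trans _ hpi0) // oppr_le0.
by rewrite /expi cosN sinN acosK // e opprK.
Qed.

Variables (lambda vel : R) (r p : nat) (a : int -> R).
Hypothesis Hs : scheme_hypothesis lambda vel r p a.

Definition coef_a (k : nat) : C := (a (k%:Z - r%:Z))%:C.

Lemma symbol_expi t :
  symbol r p a t * expi t ^+ r = \sum_(k < (p + r).+1) coef_a k * expi t ^+ k.
Proof.
rewrite /symbol /stencil_sum mulr_suml; apply: eq_bigr => k _.
rewrite /coef_a -mulrA; congr (_ * _).
rewrite /cexp /= expR0 mul1r -/(expi _) -!expiMn -expiD; congr expi.
by rewrite -mulrDl rmorphB /= subrK.
Qed.

Lemma symbol0 : symbol r p a 0 = 1.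
Proof.
transitivity ((stencil_sum r p a)%:C); last by rewrite (consistency0 Hs).
rewrite /symbol /stencil_sum rmorph_sum; apply: eq_bigr => k _ /=.
by rewrite mulr0 /cexp /= expR0 cos0 sin0 !mulr1.
Qed.

Lemma symbol_circle (k : C) : modc k = 1 ->
  k = 1 /\ \sum_(l < (p + r).+1) coef_a l * k ^+ l = 1 \/
  modc (\sum_(l < (p + r).+1) coef_a l * k ^+ l) < 1.
Proof.
move=> /polar[t ht ->]; rewrite -symbol_expi modcM modcX modc_expi expr1n mulr1.
have [->|t0] := eqVneq t 0.
  by left; rewrite expi0 expr1n mulr1 symbol0.
by right; rewrite -modc_lt1; apply: (dissipativity Hs).
Qed.

Lemma symbol_le1 (k : C) : modc k = 1 ->
  modc (\sum_(l < (p + r).+1) coef_a l * k ^+ l) <= 1.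
Proof. by move=> /symbol_circle[[_ ->]|/ltW //]; rewrite modc1. Qed.

End Symbol.

Section Characteristic.
Context {R : realType}.
Local Notation C := R[i].
Variables (lambda vel : R) (r p : nat) (a : int -> R).
Hypothesis p0 : (0 < p)%N.
Hypothesis Hs : scheme_hypothesis lambda vel r p a.

Local Notation N := (p + r)%N.
Local Notation al := (coef_a r a).
Local Notation ap := (al N).

Lemma ap_neq0 : ap != 0.
Proof.
have := noncharacteristic Hs; rewrite mulf_eq0 negb_or => /andP[_ h].
rewrite /coef_a PoszD addrK; apply: contra h => /eqP h.
by apply/eqP/(@complexI R).
Qed.

(* The characteristic polynomial of the companion matrix: (z - sum_l a_l X^l) = 0
   multiplied by X^r and normalized. *)
Definition charQ (z : C) : {poly C} :=
  ap^-1 *: ((\poly_(k < N.+1) al k) - z *: 'X^r).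

Lemma charQ_coef z k : (k <= N)%N -> (charQ z)`_k = (al k - (k == r)%:R * z) / ap.
Proof.
move=> kN; rewrite /charQ coefZ coefB coef_poly ltnS kN coefZ coefXn mulrC.
by congr ((_ - _) / _); rewrite mulrC.
Qed.

Lemma size_charQ z : size (charQ z) = N.+1.
Proof.
apply/eqP; rewrite eqn_leq; apply/andP; split.
  rewrite (leq_trans (size_scale_leq _ _)) // (leq_trans (size_polyD _ _)) //.
  rewrite geq_max size_poly size_polyN (leq_trans (size_scale_leq _ _)) //.
  by rewrite size_polyXn ltnS leq_addl.
rewrite ltnNge; apply/negP => h.
have := charQ_coef z (leqnn N); rewrite nth_default // gtn_eqF //.
  by rewrite mul0r subr0 divff ?ap_neq0 // => /eqP; rewrite eq_sym oner_eq0.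
by rewrite -[X in (X < _)%N]add0n ltn_add2r.
Qed.

Lemma charQ_monic z : charQ z \is monic.
Proof.
rewrite monicE lead_coefE size_charQ /= charQ_coef // gtn_eqF; last first.
  by rewrite -[X in (X < _)%N]add0n ltn_add2r.
by rewrite mul0r subr0 divff ?ap_neq0.
Qed.

(** The parameter enters through one coefficient only, which gives an explicit right-hand side in
    [stableQ_derivable]. *)
Lemma charQ_sub z z' : charQ z' - charQ z = ((z - z') / ap) *: 'X^r.
Proof.
rewrite /charQ -scalerBr mulrC -scalerA scalerBl; congr (_ *: _).
by ring.
Qed.

Lemma charQ_horner z k : ap * (charQ z).[k] =
  \sum_(l < N.+1) al l * k ^+ l - z * k ^+ r.
Proof.
rewrite /charQ hornerZ hornerD hornerN hornerZ hornerXn horner_poly mulrA.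
by rewrite divff ?ap_neq0 // mul1r.
Qed.

(** A root k on the circle makes z the value of the symbol at k, which has modulus less than 1
    unless k = 1. *)
Lemma root_charQ_circle z k : 1 <= modc z -> modc k = 1 -> root (charQ z) k ->
  z = 1 /\ k = 1.
Proof.
move=> z1 k1 /rootP hk; have := charQ_horner z k; rewrite hk mulr0 => /esym/eqP.
rewrite subr_eq0 => /eqP e.
have := symbol_circle Hs k1; rewrite e modcM modcX k1 expr1n mulr1.
case=> [[-> ]|]; first by rewrite expr1n mulr1.
by rewrite ltNge z1.
Qed.

Lemma root_charQ1 : root (charQ 1) 1.
Proof.
apply/rootP/(mulfI ap_neq0); rewrite mulr0 charQ_horner.
have : \sum_(l < N.+1) al l * (1 : C) ^+ l = 1.
  have := symbol_expi r p a 0; rewrite expi0 => <-.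
  by rewrite (symbol0 Hs) expr1n mulr1.
by move=> ->; rewrite expr1n mulr1 subrr.
Qed.

(** Up to the factor 1/a_p, the derivative at 1 is the sum of l a_l, that is - lambda a, nonzero by
    consistency. *)
Lemma charQ1_simple : (charQ 1)^`().[1] != 0.
Proof.
have [h1 h2] := consistency1 Hs.
rewrite /charQ derivZ derivB derivZ derivXn.
rewrite hornerZ mulf_neq0 ?invr_eq0 ?ap_neq0 //.
rewrite !hornerE hornerMn hornerXn expr1n.
have -> : (\poly_(k < N.+1) al k)^`().[1] = \sum_(k < N.+1) al k *+ k.
  rewrite poly_def raddf_sum /= horner_sum; apply: eq_bigr => k _.
  by rewrite derivZ derivXn hornerZ hornerMn hornerXn expr1n mulrnAr mulr1.
have h0 : \sum_(k < N.+1) al k = 1.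
  have := symbol_expi r p a 0; rewrite expi0 (symbol0 Hs) expr1n mulr1 => ->.
  by apply: eq_bigr => k _; rewrite expr1n mulr1.
have : \sum_(k < N.+1) al k *+ k - r%:R = (- (lambda * vel))%:C.
  rewrite -h1 /stencil_sum rmorph_sum /=.
  have -> : r%:R = \sum_(k < N.+1) r%:R * al k by rewrite -mulr_sumr h0 mulr1.
  rewrite -sumrB; apply: eq_bigr => k _.
  rewrite /coef_a rmorphM /= rmorph_int rmorphB /= mulrBl; congr (_ - _).
  by rewrite !pmulrn mulrzl.
move=> e; rewrite ?mul1r ?mulr1 ?scale1r.
have : (- (lambda * vel))%:C != 0 :> C.
  by apply: contraTneq h2 => /(@complexI R) ->; rewrite ltxx.
by rewrite -e.
Qed.

(* Vectors of C^(p + r) are stored from w_p down to w_(1-r). *)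
Definition window (w : nat -> C) : 'cV[C]_N := \col_j w (N.-1 - j)%N.

Definition Top (S : {poly C}) : 'M[C]_(p, N) :=
  \matrix_(i, j) (S * 'X^i)`_(N.-1 - j).

Lemma Top_window (S : {poly C}) w (i : 'I_p) : size S = r.+1 -> (Top S *m window w) i ord0 = act S w i.
Proof.
move=> sS; rewrite mxE.
transitivity (\sum_(j < N) (S * 'X^i)`_j * w j).
  rewrite (reindex_inj rev_ord_inj) /=; apply: eq_bigr => j _; rewrite !mxE /=.
  have jN : (j < N)%N := ltn_ord j.
  by congr (_`__ * w _); lia.
have iN := ltn_ord i.
rewrite -(big_mkord xpredT (fun j => (S * 'X^i)`_j * w j)).
rewrite (@big_cat_nat _ _ _ i) /=; [|lia|lia].
rewrite big1_seq ?add0r => [|j]; last first.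
  by rewrite mem_index_iota => /andP[_ /andP[_ h]]; rewrite coefMXn h mul0r.
rewrite (@big_cat_nat _ _ _ (i + r.+1)) /=; [|lia|lia].
rewrite [X in _ + X]big1_seq ?addr0 => [|j]; last first.
  rewrite mem_index_iota => /andP[_ /andP[h _]]; rewrite coefMXn ifF; last by lia.
  by rewrite nth_default ?mul0r // sS; lia.
rewrite sum_nat_shift /act sS; apply: eq_bigr => k _; rewrite coefMXn ifF; last by lia.
by rewrite addnK addnC.
Qed.

End Characteristic.

(** * The stable and unstable factors, and the stable subspace as a kernel *)

Section CompanionSpaces.
Context {R : realType}.
Local Notation C := R[i].
Variables (lambda vel : R) (r p' : nat) (a : int -> R).
Local Notation p := p'.+1.
Hypothesis Hs : scheme_hypothesis lambda vel r p a.
Local Notation N := (p + r)%N.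
Local Notation al := (coef_a r a).
Local Notation n := (p' + r)%N.
Local Notation Q := (charQ r p a).

Definition cpn (z : C) : 'M[C]_n.+1 := companion r p a z.

Lemma cpn_subdiagonal z (i j : 'I_n.+1) : i != ord0 ->
  cpn z i j = (i == j.+1 :> nat)%:R.
Proof. by rewrite mxE -val_eqE /= => /negPf ->. Qed.

Lemma char_poly_cpn z : char_poly (cpn z) = Q z.
Proof.
apply: char_poly_companion; first exact: cpn_subdiagonal.
- exact: (charQ_monic (ltn0Sn _) Hs).
- exact: (size_charQ (ltn0Sn _) Hs).
move=> j; have jn : (j <= n)%N by rewrite -ltnS.
rewrite charQ_coef ?(leq_trans (leq_subr _ _)) // mxE /=.
rewrite -mulNr opprB; congr ((_ * z - _) / _).
- by congr (_%:R); congr nat_of_bool; move: (nat_of_ord j) jn => k kn; apply/eqP/eqP; lia.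
- by rewrite /coef_a; congr (a _)%:C; move: (nat_of_ord j) jn => k kn; lia.
by rewrite /coef_a; congr (a _)%:C; lia.
Qed.

Definition eigs (z : C) : seq C := eigenvalues (companion r p a z).

Lemma eigsE z : Q z = \prod_(k <- eigs z) ('X - k%:P).
Proof.
rewrite -char_poly_cpn /eigs /eigenvalues /cpn; case: closed_field_poly_normal => s /= e.
by rewrite [LHS]e (monicP (char_poly_monic (cpn z))) scale1r.
Qed.

Lemma size_eigs z : size (eigs z) = N.
Proof.
apply: succn_inj; rewrite -(size_prod_XsubC (eigs z) id) -eigsE.
exact: (size_charQ (ltn0Sn _) Hs).
Qed.

(** Roots on the circle go to [unstableQ]. For |z| >= 1 this concerns only z = 1, where [stable_at1]
    moves the root 1 back to the stable factor. *)
Definition stableQ (z : C) : {poly C} :=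
  \prod_(k <- eigs z | modc k < 1) ('X - k%:P).
Definition unstableQ (z : C) : {poly C} :=
  \prod_(k <- eigs z | ~~ (modc k < 1)) ('X - k%:P).

Lemma stableM z : stableQ z * unstableQ z = Q z.
Proof. by rewrite eigsE [RHS](bigID (fun k => modc k < 1)). Qed.

Lemma stableQ_monic z : stableQ z \is monic.
Proof. exact: monic_prod_XsubC. Qed.

Lemma unstableQ_monic z : unstableQ z \is monic.
Proof. exact: monic_prod_XsubC. Qed.

Lemma horner_mx_tr (K : fieldType) m (B : 'M[K]_m.+1) (D : {poly K}) :
  horner_mx B^T D = (horner_mx B D)^T.
Proof.
elim/poly_ind: D => [|D c IH]; first by rewrite !rmorph0 trmx0.
rewrite !rmorphD !rmorphM /= !horner_mx_X !horner_mx_C linearD /= tr_scalar_mx.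
rewrite -[in RHS]mulmxE trmx_mul -IH; congr (_ + _).
exact: (comm_horner_mx D (erefl : comm_mx B^T B^T)).
Qed.

Lemma char_poly_tr (K : fieldType) m (B : 'M[K]_m) : char_poly B^T = char_poly B.
Proof.
rewrite /char_poly -[in RHS]det_tr; congr (\det _).
by rewrite /char_poly_mx linearB /= tr_scalar_mx map_trmx.
Qed.

Lemma stable_space_eq z :
  (stable_space (companion r p a z) :=: kermx (horner_mx (cpn z) (stableQ z))^T)%MS.
Proof.
rewrite /stable_space -horner_mx_tr.
rewrite (eq_bigl (fun k => modc k < 1)); last by move=> k; rewrite modc_lt1.
apply: sum_geigenspace_eq.
by rewrite char_poly_tr char_poly_cpn eigsE.
Qed.

Lemma rank_ker_factor z (S U : {poly C}) : S \is monic -> U \is monic -> S * U = Q z ->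
  \rank (kermx (horner_mx (cpn z) S)^T) = (size S).-1.
Proof.
move=> mS mU SU; rewrite mxrank_ker mxrank_tr.
rewrite (rank_horner (@cpn_subdiagonal z) mS mU) ?char_poly_cpn //.
have := size_mul (monic_neq0 mS) (monic_neq0 mU).
rewrite SU (size_charQ (ltn0Sn _) Hs).
have : (0 < size S)%N by rewrite size_poly_gt0 monic_neq0.
have : (0 < size U)%N by rewrite size_poly_gt0 monic_neq0.
by move: (size S) (size U) => c d; lia.
Qed.

Lemma Top_free (S : {poly C}) : S \is monic -> size S = r.+1 -> row_free (Top r p S).
Proof. by move=> mS sS; apply: (@band_mx_free _ n) => //; rewrite sS; lia. Qed.

(** [band_mxE] gives one inclusion, and both kernels have dimension r. The stable subspace thus
    consists of the windows of solutions of the recurrence S, in a form that is explicit in the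
    coefficients of S. *)
Lemma ker_Top z (S U : {poly C}) : S \is monic -> U \is monic -> S * U = Q z ->
  size S = r.+1 ->
  (kermx (horner_mx (cpn z) S)^T :=: kermx (Top r p S)^T)%MS.
Proof.
move=> mS mU SU sS.
have sub : (kermx (horner_mx (cpn z) S)^T <= kermx (Top r p S)^T)%MS.
  have sq : (size S + p <= n.+2)%N by rewrite sS; lia.
  have e : Top r p S = band_mx n p S by [].
  rewrite e (band_mxE (@cpn_subdiagonal z) sq) trmx_mul.
  by apply/sub_kermxP; rewrite mulmxA mulmx_ker mul0mx.
apply/eqmxP; rewrite sub /= -(geq_leqif (mxrank_leqif_sup sub)).
rewrite (rank_ker_factor mS mU SU) sS mxrank_ker mxrank_tr.
by rewrite (eqP (Top_free mS sS)) addKn.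
Qed.

End CompanionSpaces.

(** * Continuity of the roots *)

Section ComplexLimits.
Context {R : realType}.
Local Notation C := (R[i]^o).
Context {T : Type} {F : set_system T} {FF : Filter F}.

Lemma modc_pos (e : R[i]) : 0 < e -> exists2 d : R, 0 < d & e = d%:C.
Proof.
case: e => x y; rewrite ltcE /= => /andP[/eqP -> x0].
by exists x.
Qed.

Lemma cvgCP (f : T -> C) (l : C) :
  f @ F --> l <-> forall e : R, 0 < e -> \forall t \near F, modc (l - f t) < e.
Proof.
split=> [h e e0|h].
  have e0' : 0 < e%:C :> R[i] by rewrite ltcR.
  move/cvgrPdist_lt/(_ _ e0'): h; apply: filterS => t.
  by rewrite normE ltcR.
apply/cvgrPdist_lt => e /modc_pos[d d0 ->]; apply: filterS (h d d0) => t.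
by rewrite normE ltcR.
Qed.

Lemma cvgC_sum (n : nat) (f : nat -> T -> C) (l : nat -> C) :
  (forall i, (i < n)%N -> f i @ F --> l i) ->
  (fun t => \sum_(i < n) f i t) @ F --> (\sum_(i < n) l i : C).
Proof.
elim: n => [|n IH] h.
  by under eq_fun do rewrite big_ord0; rewrite big_ord0; exact: cvg_cst.
under eq_fun do rewrite big_ord_recr; rewrite big_ord_recr /=.
by apply: cvgD; [apply: IH => i ni; apply: h; rewrite ltnW|exact: h].
Qed.

Lemma cvgC_sumT (I : finType) (f : I -> T -> C) (l : I -> C) :
  (forall i, f i @ F --> l i) ->
  (fun t => \sum_i f i t) @ F --> (\sum_i l i : C).
Proof.
move=> h; rewrite /index_enum; elim: (Finite.enum _) => [|i s IH].
  by under eq_fun do rewrite big_nil; rewrite big_nil; exact: cvg_cst.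
by under eq_fun do rewrite big_cons; rewrite big_cons; apply: cvgD; [exact: h|exact: IH].
Qed.

Lemma cvgC_prodT (I : finType) (f : I -> T -> C) (l : I -> C) :
  (forall i, f i @ F --> l i) ->
  (fun t => \prod_i f i t) @ F --> (\prod_i l i : C).
Proof.
move=> h; rewrite /index_enum; elim: (Finite.enum _) => [|i s IH].
  by under eq_fun do rewrite big_nil; rewrite big_nil; exact: cvg_cst.
by under eq_fun do rewrite big_cons; rewrite big_cons; apply: cvgM; [exact: h|exact: IH].
Qed.

Lemma cvgC_det n (A : T -> 'M[R[i]]_n) (A0 : 'M[R[i]]_n) :
  (forall i j, (fun t => A t i j : C) @ F --> (A0 i j : C)) ->
  (fun t => \det (A t) : C) @ F --> (\det A0 : C).
Proof.
move=> h; apply: cvgC_sumT => s; apply: cvgM; first exact: cvg_cst.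
by apply: cvgC_prodT => i; exact: h.
Qed.

Lemma cvgC_cofactor n (A : T -> 'M[R[i]]_n) (A0 : 'M[R[i]]_n) i j :
  (forall i j, (fun t => A t i j : C) @ F --> (A0 i j : C)) ->
  (fun t => cofactor (A t) i j : C) @ F --> (cofactor A0 i j : C).
Proof.
move=> h; apply: cvgM; first exact: cvg_cst.
by apply: cvgC_det => k l; under eq_fun do rewrite !mxE; rewrite !mxE; exact: h.
Qed.

Definition poly_cvg (P : T -> {poly R[i]}) (P0 : {poly R[i]}) :=
  forall k, (fun t => (P t)`_k : C) @ F --> (P0`_k : C).

Lemma poly_cvgM P Q P0 Q0 : poly_cvg P P0 -> poly_cvg Q Q0 ->
  poly_cvg (fun t => P t * Q t) (P0 * Q0).
Proof.
move=> hP hQ k; under eq_fun do rewrite coefM; rewrite coefM.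
apply: (@cvgC_sum _ (fun i t => (P t)`_i * (Q t)`_(k - i)) (fun i => P0`_i * Q0`_(k - i))) => i _.
by apply: cvgM.
Qed.

Lemma poly_cvg_cst P0 : poly_cvg (fun=> P0) P0.
Proof. by move=> k; exact: cvg_cst. Qed.

Lemma poly_cvg_XsubC (f : T -> C) (l : C) : f @ F --> l ->
  poly_cvg (fun t => 'X - (f t)%:P) ('X - l%:P).
Proof.
move=> h k; under eq_fun do rewrite coefB coefC; rewrite coefB coefC.
apply: cvgB; first exact: cvg_cst.
by case: ifP => _; [exact: h|exact: cvg_cst].
Qed.

Lemma poly_cvg_prod n (f : nat -> T -> C) (l : nat -> C) :
  (forall i, (i < n)%N -> f i @ F --> l i) ->
  poly_cvg (fun t => \prod_(i < n) ('X - (f i t)%:P)) (\prod_(i < n) ('X - (l i)%:P)).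
Proof.
elim: n => [|n IH] h k.
  by under eq_fun do rewrite big_ord0; rewrite big_ord0; exact: cvg_cst.
under eq_fun do rewrite big_ord_recr; rewrite big_ord_recr /=.
apply: poly_cvgM; first by apply: IH => i ni; apply: h; rewrite ltnW.
by apply: poly_cvg_XsubC; exact: h.
Qed.

Lemma poly_cvg_horner (P : T -> {poly R[i]}) (P0 : {poly R[i]}) m (x : R[i]) :
  (forall t, (size (P t) <= m)%N) -> (size P0 <= m)%N ->
  poly_cvg P P0 -> (fun t => (P t).[x] : C) @ F --> (P0.[x] : C).
Proof.
move=> sP sP0 h; under eq_fun do rewrite (horner_coef_wide _ (sP _)).
rewrite (horner_coef_wide _ sP0).
apply: (@cvgC_sum _ (fun i t => (P t)`_i * x ^+ i) (fun i => P0`_i * x ^+ i)) => i _.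
by apply: cvgM; [exact: h|exact: cvg_cst].
Qed.

End ComplexLimits.

Section RootBranches.
Context {R : realType}.
Local Notation C := (R[i]^o).
Context {T : Type} {F : set_system T} {FF : Filter F}.

(** |P(x)| is the product of the distances from x to the roots, hence at least the smallest distance
    to the power deg P. *)
Lemma closest_root m (P : {poly R[i]}) (x : R[i]) : P \is monic -> size P = m.+2 ->
  exists y, root P y /\ modc (x - y) ^+ m.+1 <= modc P.[x].
Proof.
move=> mP sP; have [s hs] := closed_field_poly_normal P.
rewrite (monicP mP) scale1r in hs.
have ss : size s = m.+1.
  by apply: succn_inj; rewrite -(size_prod_XsubC s id) -hs.
pose g (i : 'I_m.+1) := modc (x - s`_i).
have [i _ hi] := @arg_minP _ _ _ ord0 xpredT g isT.
exists s`_i; split; first by rewrite hs root_prod_XsubC mem_nth // ss.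
rewrite hs horner_prod modc_prod (big_nth 0) ss big_mkord.
rewrite -[X in _ ^+ X]card_ord -prodr_const; apply: ler_prod => j _.
by rewrite modc_ge0 hornerXsubC; exact: (hi j isT).
Qed.

(** Deflation: the root closest to a limit root converges to it, and the quotient by X minus this
    root converges coefficientwise, so the induction goes on. The branches need only have limits
    along the filter. *)
Lemma root_branches m (P : T -> {poly R[i]}) (x : nat -> R[i]) :
  (forall t, P t \is monic) -> (forall t, size (P t) = m.+1) ->
  poly_cvg (F := F) P (\prod_(i < m) ('X - (x i)%:P)) ->
  exists y : nat -> T -> R[i],
    (forall t, P t = \prod_(i < m) ('X - (y i t)%:P)) /\
    forall i, (i < m)%N -> (y i : T -> C) @ F --> (x i : C).
Proof.
elim: m P x => [|m IH] P x mP sP h.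
  exists (fun i t => 0); split=> // t; rewrite big_ord0.
  have /size_poly1P[c c0 e] : size (P t) == 1%N by rewrite sP.
  by have := mP t; rewrite e monicE lead_coefC => /eqP ->.
have /choice[y0 hy0] := fun t => closest_root (x 0%N) (mP t) (sP t).
have y0x : (y0 : T -> C) @ F --> (x 0%N : C).
  apply/cvgCP => e e0.
  have s0 : size (\prod_(i < m.+1) ('X - (x i)%:P)) = m.+2.
    rewrite -(big_mkord xpredT (fun i => 'X - (x i)%:P)) size_prod_XsubC.
    by rewrite size_iota subn0.
  have h0 : (\prod_(i < m.+1) ('X - (x i)%:P)).[x 0%N] = 0.
    by rewrite big_ord_recl hornerM hornerXsubC subrr mul0r.
  have := poly_cvg_horner (FF := FF) (x := x 0%N) (fun t => eq_leq (sP t)) (eq_leq s0) h.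
  rewrite h0 => /cvgCP.
  move=> /(_ (e ^+ m.+1) (exprn_gt0 _ e0)); apply: filterS => t.
  rewrite sub0r modcN => ht; have [_ hle] := hy0 t.
  rewrite ltNge; apply/negP => he; have := le_lt_trans hle ht.
  by rewrite ltNge lerXn2r ?nnegrE ?modc_ge0 ?(ltW e0).
have /choice[P' hP'] : forall t, exists P', P t = P' * ('X - (y0 t)%:P).
  by move=> t; have [/factor_theorem[P' e] _] := hy0 t; exists P'.
have P0 t : P' t != 0.
  by apply: contraTneq (monic_neq0 (mP t)) => e; rewrite hP' e mul0r eqxx.
have mP' t : P' t \is monic by have := mP t; rewrite hP' monicMr ?monicXsubC.
have sP' t : size (P' t) = m.+1.
  by have := sP t; rewrite hP' size_Mmonic ?monicXsubC // size_XsubC addn2 => -[].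
have [] := IH P' (fun i => x i.+1) mP' sP'; last first.
  move=> y [hy1 hy2]; exists (fun i t => if i is i'.+1 then y i' t else y0 t); split.
    by move=> t; rewrite big_ord_recl /= hP' mulrC hy1.
  by case=> [_|i im]; [exact: y0x|exact: (hy2 i im)].
set Q0 := \prod_(i < m) _.
have hQ0 : \prod_(i < m.+1) ('X - (x i)%:P) = Q0 * ('X - (x 0%N)%:P).
  by rewrite big_ord_recl mulrC.
have sQ0 : size Q0 = m.+1.
  by rewrite /Q0 -(big_mkord xpredT (fun i => 'X - (x i.+1)%:P)) size_prod_XsubC size_iota subn0.
(* Synthetic division from the top coefficient down: this yields convergence of the quotient. *)
have rec (S : {poly R[i]}) c k : S`_k = (S * ('X - c%:P))`_k.+1 + c * S`_k.+1.
  by rewrite mulrBr coefB coefMX /= coefMC mulrC subrK.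
suff H j k : (m.+1 <= k + j)%N -> (fun t => (P' t)`_k : C) @ F --> (Q0`_k : C).
  by move=> k; apply: (H m.+1); rewrite leq_addl.
elim: j k => [|j IHj] k hk.
  rewrite addn0 in hk; rewrite nth_default; last by rewrite sQ0.
  have -> : (fun t => (P' t)`_k) = fun=> 0.
    by apply/funext => t; rewrite nth_default // sP'.
  exact: cvg_cst.
rewrite (rec Q0 (x 0%N)) -hQ0;
have -> : (fun t => (P' t)`_k) = fun t => (P t)`_k.+1 + y0 t * (P' t)`_k.+1.
  by apply/funext => t; rewrite (rec (P' t) (y0 t)) -hP'.
apply: cvgD; first exact: h.
apply: cvgM; first exact: y0x.
by apply: IHj; rewrite addSnnS.
Qed.

End RootBranches.

(** * The Lopatinskii determinant *)

Section Lopatinskii.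
Context {R : realType}.
Local Notation C := R[i].
Variables (lambda vel : R) (r p' pb : nat) (a : int -> R) (b : nat -> int -> R).
Local Notation p := p'.+1.
Local Notation N := (p + r)%N.
Hypothesis Hs : scheme_hypothesis lambda vel r p a.
Hypothesis Hl : Lopatinskii_hypothesis r p pb a b.
Hypothesis pbp : (pb <= p)%N.

Local Notation Q := (charQ r p a).
Local Notation Bm := (boundary_mxC r p pb b).
Local Notation stQ := (stableQ r p' a).
Local Notation unQ := (unstableQ r p' a).
Local Notation eig := (eigs r p' a).

(* By Top_window, Lmx S maps the window of w to (act S w, B w). *)
Definition Lmx (S : {poly C}) : 'M[C]_(p + r) := col_mx (Top r p S) Bm.

Lemma boundary_right : rsubmx Bm = 1%:M.
Proof.
apply/matrixP => i j; rewrite !mxE /=.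
rewrite big_nat big1 ?subr0 => [|l /andP[l1 _]]; last first.
  rewrite [X in _ * X](_ : _ = 0) ?mulr0 //.
  by case: eqP => // h; exfalso; move: h; move: (nat_of_ord j) => k; lia.
rewrite rmorph_nat; congr (_%:R); congr nat_of_bool; rewrite -val_eqE /=.
by apply/eqP/eqP; move: (nat_of_ord j) (nat_of_ord i) => k l; lia.
Qed.

Lemma rank_boundary : \rank Bm = r.
Proof.
apply/eqP; rewrite eqn_leq rank_leq_row /= -[X in (X <= _)%N](mxrank1 C) -boundary_right.
by rewrite -[X in rsubmx X]mulmx1 -mulmx_rsub mxrankM_maxl.
Qed.

(** The dimension is read off from the direct sum: B contains an identity block, so it has rank r
    and Ker B has dimension p. The number of stable roots follows, with no separate root
    counting. *)
Lemma Es_rank z : 1 < modc z \/ z = 1 -> \rank (Es r p a z) = r.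
Proof.
move=> hz; have [|hE hd] := Lopatinskii_direct Hl (z := z).
  by rewrite modc_gt1.
have /mxdirect_addsP/mxrank_disjoint_sum := hd.
rewrite (eqmxP hE) mxrank1 mxrank_ker mxrank_tr rank_boundary addnK.
by move/eqP; rewrite eqn_add2l => /eqP.
Qed.

(** A vector killed by both blocks lies in the intersection of the stable subspace with Ker B. *)
Lemma Lmx_det (S : {poly C}) z : 1 < modc z \/ z = 1 ->
  (Es r p a z :=: kermx (Top r p S)^T)%MS -> \det (Lmx S) != 0.
Proof.
move=> hz hE; have [|_ hd] := Lopatinskii_direct Hl (z := z).
  by rewrite modc_gt1.
suff : Lmx S \in unitmx by rewrite unitmxE unitfE.
rewrite -unitmx_tr -row_free_unit -kermx_eq0.
apply/rowV0P => x /sub_kermxP; rewrite tr_col_mx mul_mx_row => hx.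
have [h1 h2] := eq_row_mx (etrans hx (esym (row_mx0 _ _ _ _))).
have /mxdirect_addsP hI := hd; apply/eqP; rewrite -submx0 -hI sub_capmx hE.
by rewrite !sub_kermx h1 h2 !eqxx.
Qed.

Lemma Es_stable z : z != 1 -> (Es r p a z :=: kermx (horner_mx (cpn r p' a z) (stQ z))^T)%MS.
Proof. by move=> /negPf z1; rewrite /Es z1; exact: (stable_space_eq Hs). Qed.

Lemma stable_ker_rank z : \rank (kermx (horner_mx (cpn r p' a z) (stQ z))^T) = (size (stQ z)).-1.
Proof.
apply: (rank_ker_factor Hs (stableQ_monic _ _ _ _) (unstableQ_monic _ _ _ _)).
exact: (stableM Hs).
Qed.

Lemma size_stable_gt1 z : 1 < modc z -> size (stQ z) = r.+1.
Proof.
move=> z1; have zn1 : z != 1 by apply: contraTneq z1 => ->; rewrite modc1 ltxx.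
have := Es_rank (or_introl z1); rewrite (Es_stable zn1) stable_ker_rank => h.
by rewrite -[LHS]prednK ?h // size_poly_gt0 monic_neq0 // stableQ_monic.
Qed.

Lemma Es_Top z : z != 1 -> size (stQ z) = r.+1 ->
  (Es r p a z :=: kermx (Top r p (stQ z))^T)%MS.
Proof.
move=> z1 sS; apply: (eqmx_trans (Es_stable z1)).
exact: (ker_Top Hs (stableQ_monic _ _ _ _) (unstableQ_monic _ _ _ _) (stableM Hs z) sS).
Qed.

Lemma Lmx_det_gt1 z : 1 < modc z -> \det (Lmx (stQ z)) != 0.
Proof.
move=> z1; have zn1 : z != 1 by apply: contraTneq z1 => ->; rewrite modc1 ltxx.
by apply: (Lmx_det (or_introl z1)); apply: Es_Top => //; exact: size_stable_gt1.
Qed.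

Lemma const_Top (S : {poly C}) : size S = r.+1 -> S.[1] = 0 ->
  ((const_mx 1 : 'rV[C]_N) <= kermx (Top r p S)^T)%MS.
Proof.
move=> sS S1; rewrite sub_kermx -[X in X *m _]trmxK -trmx_mul.
have -> : (const_mx 1 : 'rV[C]_N)^T = window r p (fun=> 1).
  by apply/colP => j; rewrite !mxE.
rewrite [X in X^T](_ : _ = 0) ?trmx0 //; apply/colP => i; rewrite Top_window // mxE.
by rewrite -S1 horner_coef; apply: eq_bigr => k _; rewrite expr1n.
Qed.

(** At z = 1 the root 1, simple by [charQ1_simple], is the only one on the circle and joins the
    stable factor. Counting dimensions leaves r - 1 or r strictly stable roots. With r of them the
    stable space would already contain the constant vector, so 1 would be a root of the stable
    polynomial. *)
Lemma stable_at1 : exists us : seq C,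
  [/\ size us = p, all (fun u => 1 < modc u) us, size (stQ 1) = r,
      Q 1 = stQ 1 * ('X - 1%:P) * \prod_(u <- us) ('X - u%:P) &
      \det (Lmx (stQ 1 * ('X - 1%:P))) != 0].
Proof.
have hE := eigsE Hs 1; have sE := size_eigs Hs 1.
have p0 : (0 < p)%N by [].
have root1 : 1 \in eig 1.
  by have := root_charQ1 Hs; rewrite hE root_prod_XsubC.
pose t := [seq k <- eig 1 | ~~ (modc k < 1)].
have t1 : 1 \in t by rewrite mem_filter root1 modc1 ltxx.
have [us hus] : exists us, perm_eq t (1 :: us).
  by exists (rem 1 t); exact: perm_to_rem.
have unE : unQ 1 = ('X - 1%:P) * \prod_(u <- us) ('X - u%:P).
  by rewrite /unstableQ -big_filter (perm_big _ hus) big_cons.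
have us1 : 1 \notin us.
  apply/negP => h; have := charQ1_simple Hs.
  rewrite -(stableM Hs) unE mulrCA derivM !hornerE derivXsubC !hornerE /=.
  have /rootP -> : root (\prod_(u <- us) ('X - u%:P)) 1 by rewrite root_prod_XsubC.
  by rewrite subrr mul0r mulr0 addr0 eqxx.
have us_gt1 : all (fun u => 1 < modc u) us.
  apply/allP => u uu; have : u \in t by rewrite (perm_mem hus) inE uu orbT.
  rewrite mem_filter -leNgt => /andP[u1 ueig].
  rewrite lt_neqAle u1 andbT eq_sym; apply: contra us1 => /eqP eu.
  have : root (Q 1) u by rewrite hE root_prod_XsubC.
  have m1 : 1 <= modc (1 : C) by rewrite modc1.
  by move=> /(root_charQ_circle Hs m1 eu)[_ <-].
set m := size (stQ 1).
have m0 : (0 < m)%N by rewrite size_poly_gt0 monic_neq0 // stableQ_monic.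
have hr : \rank (Es r p a 1) = r by apply: Es_rank; right.
have EsE : Es r p a 1 = (stable_space (companion r p a 1) + (const_mx 1 : 'rV[C]_N))%MS.
  by rewrite /Es eqxx.
have rs : \rank (stable_space (companion r p a 1)) = m.-1.
  by rewrite (stable_space_eq Hs) stable_ker_rank.
have stable_lt k : root (stQ 1) k -> modc k < 1.
  by rewrite /stableQ -big_filter root_prod_XsubC mem_filter => /andP[].
have mr : m = r.
  pose c1 := (const_mx 1 : 'rV[C]_N).
  have h1 : (m.-1 <= r)%N.
    have := mxrankS (addsmxSl (stable_space (companion r p a 1)) c1).
    by rewrite -EsE hr rs.
  have h2 : (r <= m)%N.
    have := (mxrank_adds_leqif (stable_space (companion r p a 1)) c1).1.
    rewrite -EsE hr rs => /leq_trans; apply.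
    by have := rank_leq_row c1; move: (\rank c1) => c; lia.
  have [//|mr] : m = r \/ m = r.+1 by lia.
  have : (Es r p a 1 <= stable_space (companion r p a 1))%MS.
    rewrite -(geq_leqif (mxrank_leqif_sup _)) ?EsE ?addsmxSl //.
    by rewrite -EsE hr rs mr.
  rewrite EsE addsmx_sub => /andP[_]; rewrite (stable_space_eq Hs).
  have hk := ker_Top Hs (stableQ_monic _ _ _ _) (unstableQ_monic _ _ _ _) (stableM Hs 1) mr.
  rewrite hk sub_kermx -[X in X *m _]trmxK -trmx_mul.
  have -> : (const_mx 1 : 'rV[C]_N)^T = window r p (fun=> 1).
    by apply/colP => j; rewrite !mxE.
  rewrite trmx_eq0 => /eqP/colP/(_ ord0); rewrite Top_window // mxE.
  have -> : act (stQ 1) (fun=> 1) (ord0 : 'I_p) = (stQ 1).[1].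
    by rewrite horner_coef; apply: eq_bigr => k _; rewrite expr1n.
  by move=> /rootP/stable_lt; rewrite modc1 ltxx.
set S := stQ 1 * ('X - 1%:P).
have mS : S \is monic by rewrite monicMl ?monicXsubC ?stableQ_monic.
have sS : size S = r.+1.
  by rewrite size_Mmonic ?monic_neq0 ?stableQ_monic ?monicXsubC // size_XsubC addn2 -/m mr.
have QE : Q 1 = S * \prod_(u <- us) ('X - u%:P).
  by rewrite -(stableM Hs) unE mulrA.
exists us; split=> //.
  have : (size S + size us = N.+1)%N.
    rewrite -(size_charQ p0 Hs 1) QE.
    rewrite [RHS](size_Mmonic (monic_neq0 mS) (monic_prod_XsubC us xpredT id)).
    by rewrite size_prod_XsubC addnS.
  by rewrite sS addSn addnC => -[] /addIn.
apply: (Lmx_det (z := 1)); first by right.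
have sub : (Es r p a 1 <= kermx (Top r p S)^T)%MS.
  rewrite EsE addsmx_sub const_Top ?andbT //; last first.
    by rewrite /S hornerM hornerXsubC subrr mulr0.
  have hk := ker_Top Hs mS (monic_prod_XsubC us xpredT id) (esym QE) sS.
  rewrite -hk (stable_space_eq Hs) /S mulrC rmorphM /= trmx_mul.
  by apply/sub_kermxP; rewrite mulmxA mulmx_ker mul0mx.
apply/eqmxP; rewrite sub /= -(geq_leqif (mxrank_leqif_sup sub)) hr mxrank_ker mxrank_tr.
by rewrite (eqP (Top_free p' mS sS)) addKn.
Qed.

End Lopatinskii.

Section Branches.
Context {R : realType}.
Local Notation C := (R[i]^o).
Variables (lambda vel : R) (r p' pb : nat) (a : int -> R) (b : nat -> int -> R).
Local Notation p := p'.+1.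
Local Notation N := (p + r)%N.
Hypothesis Hs : scheme_hypothesis lambda vel r p a.

Local Notation Q := (charQ r p a).
Local Notation stQ := (stableQ r p' a).
Local Notation unQ := (unstableQ r p' a).
Local Notation eig := (eigs r p' a).

Lemma charQ_cvg (z0 : C) : poly_cvg (F := nbhs z0) Q (Q z0).
Proof.
move=> k.
have -> : (fun z => (Q z)`_k : C) = fun z => (Q 0)`_k - z * ((coef_a r a N)^-1 * ('X^r)`_k).
  apply/funext => z; rewrite -[in LHS](subrK (Q 0) (Q z)) (charQ_sub r p a 0 z).
  by rewrite coefD coefZ sub0r; ring.
have -> : (Q z0)`_k = (Q 0)`_k - z0 * ((coef_a r a N)^-1 * ('X^r)`_k).
  rewrite -[in LHS](subrK (Q 0) (Q z0)) (charQ_sub r p a 0 z0).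
  by rewrite coefD coefZ sub0r; ring.
by apply: cvgB; [exact: cvg_cst|apply: cvgM; [exact: cvg_id|exact: cvg_cst]].
Qed.

(** Two separate thresholds are allowed because at z0 = 1 the first factor contains the root 1,
    which forces t > 1. *)
Lemma local_factor (z0 : C) (ss us : seq R[i]) (t t' : R) :
  Q z0 = \prod_(k <- ss) ('X - k%:P) * \prod_(k <- us) ('X - k%:P) ->
  all (fun k => modc k < t) ss -> all (fun k => t' < modc k) us ->
  exists s u : C -> seq R[i],
    [/\ forall z, [/\ size (s z) = size ss, size (u z) = size us &
          Q z = \prod_(k <- s z) ('X - k%:P) * \prod_(k <- u z) ('X - k%:P)],
       \forall z \near z0, all (fun k => modc k < t) (s z) /\ all (fun k => t' < modc k) (u z),
       poly_cvg (F := nbhs z0) (fun z => \prod_(k <- s z) ('X - k%:P)) (\prod_(k <- ss) ('X - k%:P)) &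
       poly_cvg (F := nbhs z0) (fun z => \prod_(k <- u z) ('X - k%:P)) (\prod_(k <- us) ('X - k%:P))].
Proof.
move=> hQ hss hus.
have prodE (s : seq R[i]) : \prod_(k <- s) ('X - k%:P) = \prod_(i < size s) ('X - (s`_i)%:P).
  by rewrite (big_nth 0) big_mkord.
have sz : (size ss + size us)%N = N.
  apply: succn_inj; rewrite -(size_charQ (ltn0Sn p') Hs z0) hQ -big_cat size_prod_XsubC.
  by rewrite size_cat.
have hx : Q z0 = \prod_(i < N) ('X - ((ss ++ us)`_i)%:P).
  by rewrite -sz -size_cat -prodE big_cat.
have [|z|z|y [hy1 hy2]] := @root_branches R _ (nbhs z0) _ N Q (fun i => (ss ++ us)`_i).
- exact: (charQ_monic (ltn0Sn _) Hs).
- exact: (size_charQ (ltn0Sn _) Hs).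
- by rewrite -hx; exact: charQ_cvg.
pose s z := mkseq (fun i => y i z) (size ss).
pose u z := mkseq (fun i => y (size ss + i)%N z) (size us).
have prods z : \prod_(k <- s z) ('X - k%:P) = \prod_(i < size ss) ('X - (y i z)%:P).
  by rewrite /s /mkseq big_map -[X in iota _ X]subn0 -/(index_iota _ _) big_mkord.
have produ z : \prod_(k <- u z) ('X - k%:P) = \prod_(i < size us) ('X - (y (size ss + i)%N z)%:P).
  by rewrite /u /mkseq big_map -[X in iota _ X]subn0 -/(index_iota _ _) big_mkord.
have hs i : (i < size ss)%N -> (y i : C -> C) @ z0 --> (ss`_i : C).
  move=> im; have := hy2 i; rewrite nth_cat im; apply.
  by rewrite -sz ltn_addr.
have hu i : (i < size us)%N -> (y (size ss + i)%N : C -> C) @ z0 --> (us`_i : C).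
  move=> im; have := hy2 (size ss + i)%N; rewrite nth_cat [(_ < size ss)%N]ltnNge leq_addr /= addKn; apply.
  by rewrite -sz ltn_add2l.
have near_lt (f : C -> C) (l : C) : f @ z0 --> l -> modc l < t -> \forall z \near z0, modc (f z) < t.
  move=> /cvgCP h lt; have d0 : 0 < t - modc l by rewrite subr_gt0.
  apply: filterS (h _ d0) => z hz; rewrite (_ : f z = l - (l - f z)); last by ring.
  by rewrite (le_lt_trans (modcB _ _)) // addrC -ltrBrDr.
have near_gt (f : C -> C) (l : C) : f @ z0 --> l -> t' < modc l -> \forall z \near z0, t' < modc (f z).
  move=> /cvgCP h lt; have d0 : 0 < modc l - t' by rewrite subr_gt0.
  apply: filterS (h _ d0) => z hz.
  have := modcD (l - f z) (f z); rewrite subrK => h1.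
  by rewrite -(ltrD2l (modc l - t')) subrK (le_lt_trans h1) // ltrD2r.
have near_all n (P : nat -> C -> bool) : (forall i, (i < n)%N -> \forall z \near z0, P i z) ->
    \forall z \near z0, all (P^~ z) (iota 0 n).
  elim: n => [|n IH] h; first by near=> z.
  have h1 := IH (fun i ni => h i (leqW ni)); have h2 := h n (ltnSn n).
  near=> z; rewrite -addn1 iotaD all_cat /= add0n andbT; apply/andP.
  by split; near: z.
exists s, u; split.
- move=> z; rewrite !size_mkseq; split=> //.
  by rewrite hy1 -sz big_split_ord prods produ.
- have h1 : \forall z \near z0, all (fun i => modc (y i z) < t) (iota 0 (size ss)).
    apply: (near_all _ (fun i z => modc (y i z) < t)) => i im.
    by apply: near_lt (hs i im) _; apply: (allP hss); exact: mem_nth.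
  have h2 : \forall z \near z0, all (fun i => t' < modc (y (size ss + i)%N z)) (iota 0 (size us)).
    apply: (near_all _ (fun i z => t' < modc (y (size ss + i)%N z))) => i im.
    by apply: near_gt (hu i im) _; apply: (allP hus); exact: mem_nth.
  near=> z; rewrite /s /u /mkseq !all_map; split; near: z; [exact: h1|exact: h2].
- rewrite (funext prods) prodE; exact: (@poly_cvg_prod R _ (nbhs z0) _ (size ss) y (fun i => ss`_i) hs).
- rewrite (funext produ) prodE.
  exact: (@poly_cvg_prod R _ (nbhs z0) _ (size us) (fun i => y (size ss + i)%N) (fun i => us`_i) hu).
Unshelve. all: by end_near.
Qed.

Lemma factor_stable (z : R[i]) (s u : seq R[i]) :
  Q z = \prod_(k <- s) ('X - k%:P) * \prod_(k <- u) ('X - k%:P) ->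
  all (fun k => modc k < 1) s -> all (fun k => 1 < modc k) u ->
  [/\ stQ z = \prod_(k <- s) ('X - k%:P), unQ z = \prod_(k <- u) ('X - k%:P) &
      forall k, k \in eig z -> modc k != 1].
Proof.
rewrite (eigsE Hs) -big_cat => /prod_XsubC_eq hp hs hu.
have hu' : all (fun k => ~~ (modc k < 1)) u.
  by apply: sub_all hu => k; rewrite -leNgt; exact: ltW.
split.
- rewrite /stableQ (perm_big _ hp) /= big_cat /= big_seq_cond [X in _ * X]big_seq_cond.
  rewrite [X in _ * X]big_pred0 ?mulr1 => [|k]; last first.
    by apply/negP => /andP[/(allP hu') /negP].
  by rewrite [RHS]big_seq; apply: eq_bigl => k; case: (boolP (k \in s)) => // /(allP hs) ->.
- rewrite /unstableQ (perm_big _ hp) /= big_cat /= big_seq_cond [X in _ * X]big_seq_cond.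
  rewrite [X in X * _]big_pred0 ?mul1r => [|k]; last first.
    by apply/negP => /andP[/(allP hs) ->].
  by rewrite [RHS]big_seq; apply: eq_bigl => k; case: (boolP (k \in u)) => // /(allP hu') ->.
move=> k; rewrite (perm_mem hp) mem_cat => /orP[/(allP hs)|/(allP hu)] h.
  by rewrite lt_eqF.
by rewrite gt_eqF.
Qed.

Lemma stable_near (z0 : C) : (forall k, k \in eig z0 -> modc k != 1) ->
  [/\ \forall z \near z0, size (stQ z) = size (stQ z0) /\ forall k, k \in eig z -> modc k != 1,
      poly_cvg (F := nbhs z0) stQ (stQ z0) & poly_cvg (F := nbhs z0) unQ (unQ z0)].
Proof.
move=> h0.
pose ss := [seq k <- eig z0 | modc k < 1].
pose us := [seq k <- eig z0 | ~~ (modc k < 1)].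
have sE : stQ z0 = \prod_(k <- ss) ('X - k%:P) by rewrite big_filter.
have uE : unQ z0 = \prod_(k <- us) ('X - k%:P) by rewrite big_filter.
have hss : all (fun k => modc k < 1) ss by exact: filter_all.
have hus : all (fun k => 1 < modc k) us.
  apply/allP => k; rewrite mem_filter -leNgt => /andP[k1 ke].
  by rewrite lt_neqAle k1 eq_sym h0.
have hQ : Q z0 = \prod_(k <- ss) ('X - k%:P) * \prod_(k <- us) ('X - k%:P).
  by rewrite -sE -uE (stableM Hs).
have [s [u [h1 h2 h3 h4]]] := local_factor hQ hss hus.
have h5 : \forall z \near z0, [/\ stQ z = \prod_(k <- s z) ('X - k%:P),
    unQ z = \prod_(k <- u z) ('X - k%:P) & forall k, k \in eig z -> modc k != 1].
  by apply: filterS h2 => z [hs hu]; have [_ _ hz] := h1 z; exact: factor_stable.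
split.
- apply: filterS h5 => z [-> _ hz]; split=> //.
  by rewrite sE !size_prod_XsubC; have [-> _ _] := h1 z.
- move=> k; rewrite sE; apply: cvg_trans (h3 k); apply: near_eq_cvg.
  by apply: filterS h5 => z [-> _ _].
- move=> k; rewrite uE; apply: cvg_trans (h4 k); apply: near_eq_cvg.
  by apply: filterS h5 => z [_ -> _].
Qed.

Lemma eig_circle (z : R[i]) : 1 <= modc z -> z != 1 -> forall k, k \in eig z -> modc k != 1.
Proof.
move=> z1 zn1 k ke; apply: contraNneq zn1 => k1.
have : root (Q z) k by rewrite (eigsE Hs) root_prod_XsubC.
by move=> /(root_charQ_circle Hs z1 k1)[->].
Qed.

Hypothesis Hl : Lopatinskii_hypothesis r p pb a b.
Hypothesis pbp : (pb <= p)%N.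

(** The number of stable roots is locally constant where no root meets the circle, and points (1 +
    e) z outside the disc approach z, where the number is known. *)
Lemma size_stable z : 1 <= modc z -> z != 1 -> size (stQ z) = r.+1.
Proof.
move=> z1 zn1; have [h _ _] := @stable_near z (eig_circle z1 zn1).
have z0 : 0 < modc z by rewrite (lt_le_trans ltr01).
have hc : (fun e : R => (1 + e%:C) * z) @ 0^'+ --> (z : C).
  apply/cvgCP => e e0; near=> t.
  rewrite (_ : z - _ = - (t%:C * z)); last by ring.
  rewrite modcN modcM modc_real ger0_norm; last by near: t; exact: nbhs_right_ge.
  rewrite -ltr_pdivlMr //; near: t; apply: nbhs_right_lt.
  by rewrite divr_gt0.
have := hc _ h; rewrite /= => hn.
have : \forall e \near (0 : R)^'+, size (stQ ((1 + e%:C) * z)) = size (stQ z) /\ 0 < e.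
  near=> e; split; last by near: e; exact: nbhs_right_gt.
  by have [] : size (stQ ((1 + e%:C) * z)) = size (stQ z) /\
     forall k, k \in eig ((1 + e%:C) * z) -> modc k != 1 by near: e; exact: hn.
move=> /filter_ex[e [<- e0]]; apply: (size_stable_gt1 Hs Hl pbp).
have -> : 1 + e%:C = (1 + e)%:C :> R[i] by rewrite rmorphD rmorph1.
rewrite modcM modc_real ger0_norm ?addr_ge0 ?(ltW e0) //.
by rewrite (@lt_le_trans _ _ (1 + e)) ?ltrDl // ler_peMr // addr_ge0 // ltW.
Unshelve. all: by end_near.
Qed.

End Branches.

(** * Holomorphy of the stable factor and of the Lopatinskii determinant *)

Section ComplexDerivatives.
Context {R : realType}.
Local Notation C := (R[i]^o).
Implicit Types (f g : C -> C) (z : C).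

Lemma nbhsCP (z : C) (P : C -> Prop) :
  nbhs z P <-> exists2 d : R, 0 < d & forall w : R[i], modc (w - z) < d -> P w.
Proof.
split=> [|[d d0 h]].
  move=> /nbhs_ballP[e /= /modc_pos[d d0 ->] h]; exists d => // w wd.
  by apply: h; rewrite /ball /= distrC normE ltcR.
apply/nbhs_ballP; exists d%:C; first by rewrite /= ltcR.
by move=> w; rewrite /ball /= distrC normE ltcR; exact: h.
Qed.

Lemma derivable_diff f g z (l : C) (d : R) : 0 < d ->
  (forall w : R[i], modc (w - z) < d -> f w - f z = (w - z) * g w) -> g @ z --> l ->
  derivable f z 1.
Proof.
move=> d0 hd hg.
have hn : nbhs z (fun w : C => f w - f z = (w - z) * g w).
  by apply/nbhsCP; exists d.
 apply/cvg_ex; exists l.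
have hs : (fun h : C => h *: (1 : C) + z) @ (0 : C)^' --> z.
  apply: (@cvg_trans _ ((fun h : C => h *: (1 : C) + z) @ nbhs (0 : C))).
    by apply: cvg_app; exact: cvg_within.
  have : (fun h : C => h * 1 + z) @ nbhs (0 : C) --> (0 * 1 + z : C).
    apply: cvgD; last exact: cvg_cst.
    by apply: cvgM; [exact: cvg_id|exact: cvg_cst].
  by rewrite mul0r add0r.
have hgs : (fun h : C => g (h *: (1 : C) + z)) @ (0 : C)^' --> l.
  exact: (cvg_comp _ _ hs hg).
apply: cvg_trans hgs; apply: near_eq_cvg.
have h1 : \forall h \near (0 : C)^', f (h *: (1 : C) + z) - f z =
    (h *: (1 : C) + z - z) * g (h *: (1 : C) + z) by exact: (hs _ hn).
have h2 : \forall h \near (0 : C)^', h != 0 by exact: nbhs_dnbhs_neq.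
apply: filterS2 h1 h2 => h /= e h0.
rewrite e addrK /GRing.scale /= mulr1 mulrA mulVf ?mul1r //.
Qed.

(** Quantitative form of a simple zero: the difference quotient stays at least half of the nonzero
    derivative in modulus. *)
Lemma derivable_lower_bound f z : derivable f z 1 -> 'D_1 f z != 0 ->
  exists c d : R, [/\ 0 < c, 0 < d &
    forall w : R[i], modc (w - z) < d -> c * modc (w - z) <= modc (f w - f z)].
Proof.
move=> hf D0; pose D : R[i] := 'D_1 f z.
have D1 : 0 < modc D / 2 by rewrite divr_gt0 // modc_gt0.
suff : nbhs z (fun w : C => modc D / 2 * modc (w - z) <= modc (f w - f z)).
  by move=> /nbhsCP[d d0 hd]; exists (modc D / 2), d.
have /cvgCP/(_ _ D1) : h^-1 *: (f (h *: (1 : C) + z) - f z) @[h --> (0 : C)^'] --> (D : C).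
  exact: hf.
rewrite near_withinE => hn.
have hs : (fun w : C => (w - z : C)) @ nbhs (z : C) --> (0 : C).
  have hid : (fun w : C => w) @ nbhs (z : C) --> (z : C) by exact: cvg_id.
  apply/cvgCP => e e0; move/cvgCP/(_ _ e0): hid; apply: filterS => w.
  by rewrite sub0r opprB.
have hn' : nbhs z (fun w : C => w - z != 0 ->
    modc (D - (w - z)^-1 *: (f ((w - z) *: (1 : C) + z) - f z)) < modc D / 2).
  exact: (hs _ hn).
apply: filterS hn' => w h.
have [->|wz] := eqVneq w z; first by rewrite !subrr modc0 mulr0.
have {h} := h _; rewrite subr_eq0 => /(_ wz).
rewrite /GRing.scale /= mulr1 subrK => h.
have wz0 : w - z != 0 by rewrite subr_eq0.
rewrite (_ : f w - f z = (w - z) * ((w - z)^-1 * (f w - f z))); last first.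
  by rewrite mulrA divff // mul1r.
set q := (w - z)^-1 * _ in h *.
rewrite modcM mulrC ler_wpM2l ?modc_ge0 //.
have := modcD (D - q) q; rewrite subrK => h1; lra.
Qed.

Lemma derivable_sumC (I : Type) (s : seq I) (f : I -> C -> C) z :
  (forall i, derivable (f i) z 1) -> derivable (fun w => \sum_(i <- s) f i w : C) z 1.
Proof.
move=> h; elim: s => [|i s IH].
  rewrite (_ : (fun w => _) = cst 0); first exact: derivable_cst.
  by apply/funext => w; rewrite big_nil.
have -> : (fun w => \sum_(j <- i :: s) f j w : C) =
    ((f i : C -> C) + (fun w => \sum_(j <- s) f j w : C)).
  by apply/funext => w; rewrite big_cons.
by apply: derivableD; [exact: h|exact: IH].
Qed.

Lemma derivable_prodC (I : Type) (s : seq I) (f : I -> C -> C) z :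
  (forall i, derivable (f i) z 1) -> derivable (fun w => \prod_(i <- s) f i w : C) z 1.
Proof.
move=> h; elim: s => [|i s IH].
  rewrite (_ : (fun w => _) = cst 1); first exact: derivable_cst.
  by apply/funext => w; rewrite big_nil.
have -> : (fun w => \prod_(j <- i :: s) f j w : C) =
    ((f i : C -> C) * (fun w => \prod_(j <- s) f j w : C)).
  by apply/funext => w; rewrite big_cons.
by apply: derivableM; [exact: h|exact: IH].
Qed.

Lemma derivableMC f g z : derivable f z 1 -> derivable g z 1 ->
  derivable (fun w => f w * g w : C) z 1.
Proof. exact: derivableM. Qed.

Lemma derivable_detC n (A : C -> 'M[R[i]]_n) z :
  (forall i j, derivable (fun w => A w i j : C) z 1) ->
  derivable (fun w => \det (A w) : C) z 1.
Proof.
move=> h; apply: derivable_sumC => s; apply: derivableMC; first exact: derivable_cst.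
by apply: derivable_prodC => i; exact: h.
Qed.

Lemma derivable_cofactorC n (A : C -> 'M[R[i]]_n) z i j :
  (forall i j, derivable (fun w => A w i j : C) z 1) ->
  derivable (fun w => cofactor (A w) i j : C) z 1.
Proof.
move=> h; apply: derivableMC; first exact: derivable_cst.
apply: derivable_detC => k l.
by rewrite (_ : (fun w => _) = (fun w => A w (lift i k) (lift j l))) //;
  apply/funext => w; rewrite !mxE.
Qed.

End ComplexDerivatives.

Section Sylvester.
Variable (K : fieldType).
Implicit Types (S U : {poly K}).

Lemma band_rVpoly q m (x : 'rV[K]_q) U (j : 'I_m) :
  (x *m (\matrix_(i < q, k < m) (U * 'X^i)`_k)) ord0 j = (rVpoly x * U)`_j.
Proof.
rewrite mxE [rVpoly x](_ : _ = \sum_(i < q) x 0 i *: 'X^i); last first.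
  rewrite /rVpoly poly_def; apply: eq_bigr => i _; rewrite insubT //= => ?.
  by congr (x 0 _ *: _); apply: val_inj.
rewrite mulr_suml coef_sum; apply: eq_bigr => i _.
by rewrite !mxE -scalerAl coefZ [U * _]mulrC.
Qed.

(* Inverting this matrix recovers the derivative of S from that of S * U. *)
Definition sylv r p S U : 'M[K]_(r + p) :=
  col_mx (\matrix_(i < r, k < r + p) (U * 'X^i)`_k)
         (\matrix_(i < p, k < r + p) (S * 'X^i)`_k).

Lemma sylvP r p S U (x : 'rV[K]_r) (y : 'rV[K]_p) :
  row_mx x y *m sylv r p S U = \row_j (rVpoly x * U + rVpoly y * S)`_j.
Proof.
rewrite /sylv mul_row_col; apply/rowP => j; rewrite mxE !band_rVpoly !mxE.
by rewrite coefD.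
Qed.

(** A vector in the kernel gives x U + y S = 0 with deg x < deg S. Coprimality makes S divide x, so
    x = 0, and then y = 0. *)
Lemma sylv_unit r p S U : size S = r.+1 -> size U = p.+1 -> coprimep S U ->
  \det (sylv r p S U) != 0.
Proof.
move=> sS sU cSU; suff : sylv r p S U \in unitmx by rewrite unitmxE unitfE.
rewrite -row_free_unit -kermx_eq0; apply/rowV0P => v /sub_kermxP.
rewrite -[v]hsubmxK sylvP; set x := lsubmx v; set y := rsubmx v => /rowP h.
have S0 : S != 0 by rewrite -size_poly_gt0 sS.
have U0 : U != 0 by rewrite -size_poly_gt0 sU.
have sx : (size (rVpoly x) <= r)%N by exact: size_poly.
have sy : (size (rVpoly y) <= p)%N by exact: size_poly.
have e : rVpoly x * U + rVpoly y * S = 0.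
  apply/polyP => k; rewrite coef0; have [kn|nk] := ltnP k (r + p).
    by have := h (Ordinal kn); rewrite !mxE.
  rewrite nth_default // (leq_trans _ nk) // (leq_trans (size_polyD _ _)) //.
  rewrite geq_max !(leq_trans (size_polyMleq _ _)) ?sS ?sU ?addnS //=.
    by rewrite addnC leq_add2l.
  by rewrite leq_add2r.
have x0 : rVpoly x = 0.
  have : S %| rVpoly x * U.
    by rewrite -(dvdp_addl _ (dvdp_mull (rVpoly y) (dvdpp S))) e dvdp0.
  rewrite Gauss_dvdpl // => /dvdp_leq hle; apply/eqP; apply: contraT => xn0.
  by have := hle xn0; rewrite sS ltnNge sx.
have y0 : rVpoly y = 0.
  move/eqP: e; rewrite x0 mul0r add0r mulf_eq0 (negPf S0) orbF => /eqP //.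
by rewrite -[x]rVpolyK -[y]rVpolyK x0 y0 !linear0 row_mx0.
Qed.

End Sylvester.

Section HolomorphicBasis.
Context {R : realType}.
Local Notation C := (R[i]^o).
Variables (lambda vel : R) (r p' pb : nat) (a : int -> R) (b : nat -> int -> R).
Local Notation p := p'.+1.
Local Notation N := (p + r)%N.
Hypothesis Hs : scheme_hypothesis lambda vel r p a.
Hypothesis Hl : Lopatinskii_hypothesis r p pb a b.
Hypothesis pbp : (pb <= p)%N.

Local Notation Q := (charQ r p a).
Local Notation stQ := (stableQ r p' a).
Local Notation unQ := (unstableQ r p' a).
Local Notation eig := (eigs r p' a).
Local Notation Bm := (boundary_mxC r p pb b).

Lemma near_neq0 (z : C) (f : C -> C) (l : C) :
  f @ nbhs z --> l -> l != 0 -> nbhs z (fun w : C => modc l / 2 <= modc (f w)).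
Proof.
move=> /cvgCP h l0; have d0 : 0 < modc l / 2 by rewrite divr_gt0 // modc_gt0.
apply: filterS (h _ d0) => t ht; have := modcD (l - f t) (f t); rewrite subrK; lra.
Qed.

Lemma coprime_prods (s t : seq R[i]) : (forall k, k \in s -> k \notin t) ->
  coprimep (\prod_(k <- s) ('X - k%:P)) (\prod_(k <- t) ('X - k%:P)).
Proof.
elim: s => [|k s IH] h; first by rewrite big_nil coprime1p.
rewrite big_cons coprimepMl coprime_prod_XsubC ?h ?mem_head //=.
by apply: IH => j js; apply: h; rewrite inE js orbT.
Qed.

Lemma coprime_stable z : coprimep (stQ z) (unQ z).
Proof.
rewrite /stableQ /unstableQ -big_filter -[X in coprimep _ X]big_filter.
apply: coprime_prods => k; rewrite !mem_filter => /andP[-> _].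
by [].
Qed.

Lemma size_unstable z : size (stQ z) = r.+1 -> size (unQ z) = p.+1.
Proof.
move=> sS; have := size_charQ (ltn0Sn p') Hs z.
rewrite -(stableM Hs) size_Mmonic ?unstableQ_monic ?monic_neq0 ?stableQ_monic //.
by rewrite sS addSn /= addnC => /eqP; rewrite -addSn eqn_add2r => /eqP.
Qed.

Lemma size_monic_sub (P P' : {poly R[i]}) m : P \is monic -> P' \is monic ->
  size P = m.+1 -> size P' = m.+1 -> (size (P - P')%R <= m)%N.
Proof.
move=> mP mP' sP sP'; apply/leq_sizeP => j; rewrite leq_eqVlt coefB => /predU1P[<-|mj].
  by move/monicP: mP; move/monicP: mP'; rewrite !lead_coefE sP sP' /= => -> ->; rewrite subrr.
by rewrite !nth_default ?sP ?sP' // subrr.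
Qed.

Lemma monic_coef_ge (P : {poly R[i]}) m k : P \is monic -> size P = m.+1 ->
  (m <= k)%N -> P`_k = (k == m)%:R.
Proof.
move=> mP sP mk; have [->|km] := eqVneq k m.
  by move/monicP: mP; rewrite lead_coefE sP.
by rewrite nth_default // sP ltn_neqAle eq_sym km.
Qed.

(** Subtracting S U = Q at z and z1 gives (S_z - S_z1) U_z + (U_z - U_z1) S_z1 = ((z1 - z) / a_p)
    X^r. This is a linear system whose matrix is the Sylvester matrix of S_z1 and U_z, invertible
    near z1 by coprimality. Cramer's rule yields the difference quotient [g], which has a limit by
    continuity of U. *)
Lemma stableQ_derivable (z1 : C) k : (forall k, k \in eig z1 -> modc k != 1) ->
  size (stQ z1) = r.+1 -> derivable (fun z : C => (stQ z)`_k : C) z1 1.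
Proof.
move=> h1 sS1; have [hn hst hun] := stable_near Hs h1.
have [kr|rk] := ltnP k r; last first.
  have c0 : (fun _ : C => (0 : C)) @ nbhs (z1 : C) --> (0 : C) by exact: cvg_cst.
  move/nbhsCP: hn => [d d0 hn].
  apply: (@derivable_diff _ _ (fun=> 0) z1 0 d d0 _ c0) => z /hn[sz _]; rewrite mulr0.
  have e1 := monic_coef_ge (stableQ_monic r p' a z) (etrans sz sS1) rk.
  have e2 := monic_coef_ge (stableQ_monic r p' a z1) sS1 rk.
  apply/eqP; rewrite subr_eq0; apply/eqP; exact: (etrans e1 (esym e2)).
pose G z := sylv r p (stQ z1) (unQ z).
pose er : 'rV[R[i]]_(r + p) := \row_j ('X^r : {poly R[i]})`_j.
pose i0 : 'I_(r + p) := lshift p (Ordinal kr).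
pose ap := coef_a r a N.
pose g z : C := - ap^-1 * (\det (G z))^-1 * (er *m \adj (G z)) ord0 i0.
have hG i j : (fun z : C => G z i j : C) @ nbhs (z1 : C) --> (G z1 i j : C).
  rewrite /G /sylv; case: (split_ordP i) => i' ->.
    have e z : col_mx (\matrix_(i1 < r, k0 < r + p) (unQ z * 'X^i1)`_k0)
       (\matrix_(i1 < p, k0 < r + p) (stQ z1 * 'X^i1)`_k0) (lshift p i') j = (unQ z * 'X^i')`_j.
      by rewrite col_mxEu mxE.
    rewrite (funext e) e.
    exact: (poly_cvgM hun (@poly_cvg_cst R _ (nbhs (z1 : C)) _ 'X^i')).
  have e z : col_mx (\matrix_(i1 < r, k0 < r + p) (unQ z * 'X^i1)`_k0)
       (\matrix_(i1 < p, k0 < r + p) (stQ z1 * 'X^i1)`_k0) (rshift r i') j = (stQ z1 * 'X^i')`_j.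
    by rewrite col_mxEd mxE.
  rewrite (funext e) e; exact: cvg_cst.
have dG0 : \det (G z1) != 0.
  by apply: sylv_unit => //; [exact: size_unstable|exact: coprime_stable].
have hdet : (fun z : C => \det (G z) : C) @ nbhs (z1 : C) --> (\det (G z1) : C) by exact: cvgC_det.
have hg : g @ nbhs (z1 : C) --> g z1.
  apply: cvgM.
    apply: cvgM; first exact: cvg_cst.
    by apply: cvgV.
  under eq_fun do rewrite mxE; rewrite mxE.
  apply: (@cvgC_sumT R _ (nbhs z1) _ _ (fun j z => er ord0 j * (\adj (G z)) j i0)
     (fun j => er ord0 j * (\adj (G z1)) j i0)) => j.
  apply: cvgM; first exact: cvg_cst.
  under eq_fun do rewrite mxE; rewrite mxE.
  exact: cvgC_cofactor.
have dz : 0 < modc (\det (G z1)) / 2.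
  by apply: divr_gt0; [rewrite modc_gt0|exact: ltr0n].
have /nbhsCP[d2 d20 hne] := near_neq0 hdet dG0; move/nbhsCP: hn => [d1 d10 hn].
have d12 : 0 < Num.min d1 d2 by rewrite lt_min d10.
apply: (@derivable_diff _ _ g z1 (g z1) _ d12 _ hg) => z.
rewrite lt_min => /andP[/hn[sz _] /hne hd] {hst hun hG hdet hg hn hne}.
have d0 : \det (G z) != 0.
  rewrite -modc_gt0; exact: lt_le_trans dz hd.
clear dz d10 d20 d12 hd.
pose ds := stQ z - stQ z1; pose du := unQ z - unQ z1.
have szr := etrans sz sS1.
have sds : (size ds <= r)%N.
  by apply: size_monic_sub; [exact: stableQ_monic|exact: stableQ_monic|exact: szr|exact: sS1].
have sdu : (size du <= p)%N.
  apply: size_monic_sub; [exact: unstableQ_monic|exact: unstableQ_monic| |];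
    by apply: size_unstable.
have e1 : ds * unQ z + du * stQ z1 = ((z1 - z) / ap) *: 'X^r.
  transitivity (Q z - Q z1); last exact: charQ_sub.
  rewrite -(stableM Hs z) -(stableM Hs z1) /ds /du.
  move: (stQ z) (stQ z1) (unQ z) (unQ z1) => A1 A2 A3 A4; ring.
have e2 : row_mx (poly_rV ds) (poly_rV du) *m G z = ((z1 - z) / ap) *: er.
  rewrite sylvP (poly_rV_K sds) (poly_rV_K sdu) e1; apply/rowP => j.
  by rewrite !mxE coefZ.
have : \det (G z) * ds`_k = ((z1 - z) / ap) * (er *m \adj (G z)) ord0 i0.
  have := congr1 (fun M => (M *m \adj (G z)) ord0 i0) e2.
  rewrite /= -mulmxA mul_mx_adj mul_mx_scalar mxE row_mxEl mxE => ->.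
  by rewrite -scalemxAl mxE.
rewrite coefB => e3; apply: (mulfI d0); rewrite e3 /g.
by field; rewrite d0 /= (ap_neq0 Hs).
Qed.

(** [Lmx] with the boundary rows replaced by the last r coordinates. It is always invertible for
    monic S of degree r, because r initial values determine a solution of the recurrence. *)
Definition Mmx (S : {poly R[i]}) : 'M[R[i]]_(p + r) := col_mx (Top r p S) (row_mx 0 1%:M).

Lemma Mmx_unit (S : {poly R[i]}) : S \is monic -> size S = r.+1 -> \det (Mmx S) != 0.
Proof.
clear pbp => mS sS; suff : Mmx S \in unitmx by rewrite unitmxE unitfE.
rewrite -unitmx_tr -row_free_unit -kermx_eq0; apply/rowV0P => x /sub_kermxP hx.
pose w k : R[i] := if insub (N.-1 - k)%N is Some i then x ord0 i else 0.
have xw : x^T = window r p w.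
  apply/colP => j; rewrite !mxE /w.
  have e : (N.-1 - (N.-1 - j))%N = j by have := ltn_ord j; lia.
  by rewrite e valK.
have : Mmx S *m window r p w = 0.
  by rewrite -xw -[Mmx S]trmxK -trmx_mul hx trmx0.
rewrite /Mmx mul_col_mx => h.
have [h1 h2] := eq_col_mx (etrans h (esym (col_mx0 _ _ _ _))).
have wlow k : (k < r)%N -> w k = 0.
  move=> kr; have kr' : (r.-1 - k < r)%N by lia.
  move/colP: h2 => /(_ (Ordinal kr')); rewrite -[window r p w]vsubmxK mul_row_col mul0mx add0r mul1mx.
  by rewrite !mxE /=; congr (w _ = _); lia.
have wtop i : (i < p)%N -> act S w i = 0.
  by move=> ip; move/colP: h1 => /(_ (Ordinal ip)); rewrite Top_window // mxE.
have w0 k : (k < N)%N -> w k = 0.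
  elim/ltn_ind: k => k IH kN; have [/wlow //|rk] := ltnP k r.
  have := wtop (k - r)%N; rewrite ltn_subLR // addnC => /(_ kN).
  rewrite /act sS big_ord_recr /= big1 ?add0r => [|l _]; last first.
    by rewrite IH ?mulr0 //; have := ltn_ord l; lia.
  move/monicP: mS; rewrite lead_coefE sS /= => ->; rewrite mul1r subnK //.
apply: trmx_inj; rewrite xw trmx0; apply/colP => j; rewrite !mxE w0 //.
by have := ltn_ord j; lia.
Qed.

(* The basis of Ker (Top S) whose last r coordinates form the identity matrix. *)
Definition Emx (S : {poly R[i]}) : 'M[R[i]]_(p + r, r) :=
  (\det (Mmx S))^-1 *: (\adj (Mmx S) *m col_mx 0 1%:M).

Lemma Mmx_Emx S : \det (Mmx S) != 0 -> Mmx S *m Emx S = col_mx 0 1%:M.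
Proof.
by move=> d0; rewrite /Emx -scalemxAr mulmxA mul_mx_adj mul_scalar_mx scalerA mulVf // scale1r.
Qed.

(** Multiplied by the inverse of [Mmx S], [Lmx S] becomes block triangular, with an identity block
    and the image under B of the basis [Emx S] on its diagonal. *)
Lemma det_Lmx (S : {poly R[i]}) : \det (Mmx S) != 0 ->
  \det (Lmx r p' pb b S) = \det (Bm *m Emx S) * \det (Mmx S).
Proof.
move=> d0; pose V := (\det (Mmx S))^-1 *: \adj (Mmx S).
have MV : Mmx S *m V = 1%:M.
  by rewrite /V -scalemxAr mul_mx_adj scale_scalar_mx mulVf.
have VM : V *m Mmx S = 1%:M by exact: mulmx1C.
have TV : Top r p S *m V = row_mx 1%:M 0.
  have := congr1 usubmx MV; rewrite /Mmx mul_col_mx col_mxKu => ->.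
  by rewrite scalar_mx_block block_mxEv col_mxKu.
have EV : Emx S = V *m col_mx 0 1%:M by rewrite /V /Emx scalemxAl.
have -> : Lmx r p' pb b S = block_mx 1%:M 0 (lsubmx (Bm *m V)) (Bm *m Emx S) *m Mmx S.
  have -> : block_mx 1%:M 0 (lsubmx (Bm *m V)) (Bm *m Emx S) = Lmx r p' pb b S *m V.
    rewrite /Lmx mul_col_mx TV block_mxEv; congr col_mx.
    rewrite -[RHS]hsubmxK; congr row_mx.
    rewrite EV mulmxA -[X in X *m _]hsubmxK mul_row_col mulmx0 add0r mulmx1.
    by [].
  by rewrite -mulmxA VM mulmx1.
by rewrite det_mulmx det_lblock det1 mul1r.
Qed.

Lemma Top_derivable (z1 : C) i j : (forall k, k \in eig z1 -> modc k != 1) ->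
  size (stQ z1) = r.+1 -> derivable (fun z : C => Mmx (stQ z) i j : C) z1 1.
Proof.
move=> h1 sS1; case: (split_ordP i) => i' ->.
  rewrite (_ : (fun z : C => _) = fun z : C =>
     if (N.-1 - j < i')%N then 0 else (stQ z)`_(N.-1 - j - i')); last first.
    by apply/funext => z; rewrite /Mmx col_mxEu mxE coefMXn.
  case: (N.-1 - j < i')%N; first exact: derivable_cst.
  exact: (stableQ_derivable h1 sS1).
rewrite (_ : (fun z : C => _) = cst ((row_mx 0 1%:M : 'M[R[i]]_(r, p + r)) i' j)).
  exact: derivable_cst.
by apply/funext => z; rewrite /Mmx col_mxEd.
Qed.

Lemma Emx_derivable (z1 : C) i j : (forall k, k \in eig z1 -> modc k != 1) ->
  size (stQ z1) = r.+1 -> derivable (fun z : C => Emx (stQ z) i j : C) z1 1.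
Proof.
move=> h1 sS1.
rewrite (_ : (fun z : C => _) = fun z : C => (\det (Mmx (stQ z)))^-1 *
   \sum_k cofactor (Mmx (stQ z)) k i * (col_mx 0 1%:M : 'M[R[i]]_(p + r, r)) k j); last first.
  apply/funext => z; rewrite !mxE; congr (_ * _); apply: eq_bigr => k _.
  by rewrite !mxE.
apply: derivableMC.
  apply: derivableV; first by apply: Mmx_unit => //; exact: stableQ_monic.
  by apply: derivable_detC => k l; exact: Top_derivable.
apply: derivable_sumC => k; apply: derivableMC; last exact: derivable_cst.
by apply: derivable_cofactorC => l m; exact: Top_derivable.
Qed.

Lemma near_regular (z0 : C) : modc z0 = 1 -> z0 != 1 -> exists2 d : R, 0 < d &
  forall z : R[i], modc (z - z0) < d ->
  [/\ z != 1, size (stQ z) = r.+1 & forall k, k \in eig z -> modc k != 1].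
Proof.
move=> z01 z0n1; have m1 : 1 <= modc z0 by rewrite z01.
have [hn _ _] := stable_near Hs (eig_circle Hs m1 z0n1).
have sS := size_stable Hs Hl pbp m1 z0n1.
have hid : (fun z : C => (z - 1 : C)) @ nbhs (z0 : C) --> (z0 - 1 : C).
  have hid : (fun w : C => w) @ nbhs (z0 : C) --> (z0 : C) by exact: cvg_id.
  apply/cvgCP => e e0; move/cvgCP/(_ _ e0): hid; apply: filterS => w.
  by rewrite (_ : z0 - 1 - (w - 1) = z0 - w) //; ring.
have z00 : z0 - 1 != 0 by rewrite subr_eq0.
have dz : 0 < modc (z0 - 1) / 2 by apply: divr_gt0; [rewrite modc_gt0|exact: ltr0n].
have /nbhsCP[d1 d10 h1] := near_neq0 hid z00; have /nbhsCP[d2 d20 h2] := hn.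
exists (Num.min d1 d2) => [|z]; first by rewrite lt_min d10.
rewrite lt_min => /andP[/h1 zn /h2[sz hz]]; split; last exact: hz.
  rewrite -subr_eq0 -modc_gt0; exact: (lt_le_trans dz zn).
by rewrite sz.
Qed.

Lemma Emx_basis (z0 : C) : modc z0 = 1 -> z0 != 1 ->
  holomorphic_basis a z0 (fun z => Emx (stQ z)).
Proof.
move=> z01 z0n1; have [d dd hd] := near_regular z01 z0n1.
apply/nbhsCP; exists d => // z /hd[zn1 sz hz] {d dd hd}.
have mS := stableQ_monic r p' a z.
have d0 := Mmx_unit mS sz.
have hME := Mmx_Emx d0; rewrite /Mmx mul_col_mx in hME.
have [hT hJ] := eq_col_mx hME.
have rE : \rank (Emx (stQ z))^T = r.
  rewrite mxrank_tr; apply/eqP; rewrite eqn_leq rank_leq_col /=.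
  rewrite -[X in (X <= _)%N](mxrank1 R[i]) -hJ; exact: mxrankM_maxr.
split.
- by rewrite /row_free rE.
- apply/eqmxP; have hE := Es_Top Hs zn1 sz.
  have sub : ((Emx (stQ z))^T <= Es r p a z)%MS.
    by rewrite hE sub_kermx -trmx_mul hT trmx0 eqxx.
  apply/eqmxP; rewrite sub /= -(geq_leqif (mxrank_leqif_sup sub)) rE hE mxrank_ker mxrank_tr.
  by rewrite (eqP (Top_free p' mS sz)) addKn.
- by move=> i k; exact: Emx_derivable.
Qed.

Definition circle_zeros : set R[i] := [set z : R[i] | [/\ `|z| = 1, z != 1
    & exists e : R[i] -> 'M[R[i]]_(p + r, r),
        holomorphic_basis a z e /\ Lopatinskii_det pb b e z = 0]].

(** The basis [Emx] is an admissible choice in the Lopatinskii hypothesis, so its determinant has a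
    simple zero. This passes to [Lmx] because det [Mmx] stays away from 0 near z0. *)
Lemma Lmx_circle (z0 : C) : modc z0 = 1 -> z0 != 1 ->
  \det (Lmx r p' pb b (stQ z0)) = 0 ->
  circle_zeros z0 /\ exists c d : R, [/\ 0 < c, 0 < d &
  forall z : R[i], modc (z - z0) < d ->
    c * modc (z - z0) <= modc (\det (Lmx r p' pb b (stQ z)))].
Proof.
move=> z01 z0n1 dL; have m1 : 1 <= modc z0 by rewrite z01.
have sS := size_stable Hs Hl pbp m1 z0n1.
have mS := stableQ_monic r p' a z0.
have d0 := Mmx_unit mS sS.
have hb := Emx_basis z01 z0n1.
have D0 : Lopatinskii_det pb b (fun z => Emx (stQ z)) z0 = 0.
  by apply/eqP; move/eqP: dL; rewrite det_Lmx // mulf_eq0 (negPf d0) orbF.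
have n1 : `|z0| = 1 by apply/modc_eq1.
split; first by split=> //; exists (fun z => Emx (stQ z)).
have hD := Lopatinskii_simple Hl n1 z0n1 hb D0.
have heig := eig_circle Hs m1 z0n1.
have dD : derivable (Lopatinskii_det pb b (fun z => Emx (stQ z)) : C -> C) z0 1.
  apply: derivable_detC => i j.
  rewrite (_ : (fun z : C => _) = fun z : C => \sum_k Bm i k * Emx (stQ z) k j); last first.
    by apply/funext => z; rewrite mxE.
  apply: derivable_sumC => k; apply: derivableMC; first exact: derivable_cst.
  exact: Emx_derivable.
have [c [d1 [c0 d10 hc]]] := derivable_lower_bound dD hD.
have hM : (fun z : C => \det (Mmx (stQ z)) : C) @ nbhs z0 --> (\det (Mmx (stQ z0)) : C).
  have [_ hst _] := stable_near Hs heig.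
  apply: cvgC_det => i j; case: (split_ordP i) => i' ->.
    have e z : Mmx (stQ z) (lshift r i') j = (stQ z * 'X^i')`_(N.-1 - j).
      by rewrite /Mmx col_mxEu mxE.
    rewrite (funext e) e.
    exact: (poly_cvgM hst (@poly_cvg_cst R _ (nbhs (z0 : C)) _ 'X^i')).
  have e z : Mmx (stQ z) (rshift p i') j = (row_mx 0 1%:M : 'M[R[i]]_(r, p + r)) i' j.
    by rewrite /Mmx col_mxEd.
  rewrite (funext e) e; exact: cvg_cst.
have /nbhsCP[d2 d20 h2] := near_neq0 hM d0.
have [d3 d30 h3] := near_regular z01 z0n1.
pose d := modc (\det (Mmx (stQ z0))) / 2.
have dp : 0 < d by rewrite divr_gt0 // modc_gt0.
exists (c * d), (Num.min d1 (Num.min d2 d3)); split.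
- exact: mulr_gt0.
- by rewrite !lt_min d10 d20.
move=> z; rewrite !lt_min => /and3P[/hc hz1 /h2 hz2 /h3[_ sz _]].
rewrite det_Lmx ?(Mmx_unit (stableQ_monic r p' a z) sz) // modcM mulrAC.
rewrite D0 subr0 in hz1.
by rewrite ler_pM // ?(ltW dp) // mulr_ge0 ?(ltW c0) ?modc_ge0.
Qed.

End HolomorphicBasis.

(** * Resolvent estimates *)

Section BoundaryOperator.
Context {R : realType}.
Local Notation C := (R[i]).
Variables (lambda vel : R) (r p' pb : nat) (a : int -> R) (b : nat -> int -> R).
Local Notation p := p'.+1.
Local Notation N := (p + r)%N.
Local Notation al := (coef_a r a).
Local Notation Q := (charQ r p a).
Local Notation Bm := (boundary_mxC r p pb b).

Definition bcoef (i l : nat) : C := (b l.+1 (i%:Z + 1 - r%:Z))%:C.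

(* The sequence x stands for (w_1, w_2, ...), and ext x for (w_(1-r), w_(2-r), ...). *)
Definition ext (x : nat -> C) (i : nat) : C :=
  if (i < r)%N then \sum_(l < pb) bcoef i l * x l else x (i - r)%N.

Definition schemeT (x : nat -> C) (i : nat) : C :=
  \sum_(k < N.+1) al k * ext x (i + k).

Definition bnorm : R := \sum_(i < r) (pb%:R * \sum_(l < pb) modc (bcoef i l) ^+ 2).

Lemma ext_shift x i : ext x (i + r) = x i.
Proof. by rewrite /ext ltnNge leq_addl /= addnK. Qed.

Lemma extD x y : ext (x + y) = ext x + ext y.
Proof.
apply/funext => i; change (ext (x + y) i = ext x i + ext y i).
rewrite /ext; case: ifP => // _; rewrite -big_split; apply: eq_bigr => l _.
exact: mulrDr.
Qed.

Lemma extZ c x : ext (c *: x) = c *: ext x.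
Proof.
apply/funext => i; change (ext (c *: x) i = c * ext x i).
rewrite /ext; case: ifP => // _; rewrite mulr_sumr; apply: eq_bigr => l _.
exact: mulrCA.
Qed.

Lemma schemeTD x y : schemeT (x + y) = schemeT x + schemeT y.
Proof.
apply/funext => i; change (schemeT (x + y) i = schemeT x i + schemeT y i).
rewrite /schemeT -big_split; apply: eq_bigr => k _; rewrite extD; exact: mulrDr.
Qed.

Lemma schemeTZ c x : schemeT (c *: x) = c *: schemeT x.
Proof.
apply/funext => i; change (schemeT (c *: x) i = c * schemeT x i).
rewrite /schemeT mulr_sumr; apply: eq_bigr => k _; rewrite extZ; exact: mulrCA.
Qed.

Lemma schemeTN x : schemeT (- x) = - schemeT x.
Proof. by rewrite -scaleN1r schemeTZ scaleN1r. Qed.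

Lemma bnorm_ge0 : 0 <= bnorm.
Proof.
apply: sumr_ge0 => i _; apply: mulr_ge0; first exact: ler0n.
by apply: sumr_ge0 => l _; exact: sqr_ge0.
Qed.

Lemma ext_trace_bound x A : l2le x A -> \sum_(i < r) modc (ext x i) ^+ 2 <= bnorm * A.
Proof.
move=> hx; rewrite /bnorm mulr_suml; apply: ler_sum => i _.
rewrite /ext ltn_ord (le_trans (modc_sum_sqr pb (fun l => bcoef i l * x l))) //.
rewrite -mulrA ler_wpM2l // mulr_suml; apply: ler_sum => l _; rewrite modcM exprMn ler_wpM2l ?sqr_ge0 //.
exact: l2le_coord.
Qed.

Lemma l2le_ext x A : l2le x A -> l2le (ext x) (A + \sum_(i < r) modc (ext x i) ^+ 2).
Proof.
move=> hx n; have h0 k : 0 <= modc (ext x k) ^+ 2 by exact: sqr_ge0.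
apply: (@le_trans _ _ (\sum_(i < r + n) modc (ext x i) ^+ 2)).
  rewrite addnC big_split_ord /= lerDl; apply: sumr_ge0 => i _; exact: h0.
rewrite big_split_ord /= addrC lerD2r.
under eq_bigr do rewrite addnC ext_shift.
exact: hx.
Qed.

Lemma ell2_ext x : ell2 x -> ell2 (ext x).
Proof. by case=> A /l2le_ext; exists (A + \sum_(i < r) modc (ext x i) ^+ 2). Qed.

Hypothesis Hs : scheme_hypothesis lambda vel r p a.

Lemma schemeT_energy x A : l2le x A ->
  l2le (schemeT x) (A + \sum_(i < r) modc (ext x i) ^+ 2).
Proof.
move=> hx; apply: (@convolution_contraction _ N al (ext x)); last exact: l2le_ext.
by move=> k k1; exact: (symbol_le1 Hs).
Qed.

(** The coefficient of X^r picks [ext x (i + r)], that is x_i: the resolvent equation is this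
    recurrence for the extended sequence. *)
Lemma act_charQ z x : act (Q z) (ext x) = - ((al N)^-1 *: (z *: x - schemeT x)).
Proof.
apply/funext => i.
change (act (Q z) (ext x) i = - ((al N)^-1 * (z * x i - schemeT x i))).
rewrite (@act_widen _ N.+1); last by rewrite (size_charQ (ltn0Sn p') Hs).
have rN : (r < N.+1)%N by rewrite ltnS leq_addl.
have -> : z * x i = \sum_(k < N.+1) (k == r :> nat)%:R * z * ext x (i + k)%N.
  rewrite (bigD1 (Ordinal rN)) //= eqxx mul1r ext_shift big1 ?addr0 // => k kr.
  have -> : (k == r :> nat) = false by apply: contraNF kr => /eqP h; apply/eqP/val_inj.
  by rewrite !mul0r.
rewrite -mulrN opprB -sumrB mulr_sumr; apply: eq_bigr => k _.
rewrite charQ_coef -1?ltnS //.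
by rewrite -mulrBl mulrA; congr (_ * _); rewrite mulrC.
Qed.

Hypothesis pbp : (pb <= p)%N.

(** Row i of B is the condition at nu = -i, which sits at index r - 1 - i, while index r + l holds
    the interior value w_(l+1). *)
Lemma boundary_window w (i : 'I_r) : (Bm *m window r p w) i ord0 =
  w (r.-1 - i)%N - \sum_(l < pb) bcoef (r.-1 - i) l * w (r + l)%N.
Proof.
have ir := ltn_ord i.
rewrite mxE.
transitivity (\sum_(k < N) ((k == r.-1 - i :> nat)%N%:R -
    \sum_(l < pb) bcoef (r.-1 - i) l * (k == r + l :> nat)%:R) * w k).
  rewrite (reindex_inj rev_ord_inj) /=; apply: eq_bigr => k _; rewrite !mxE /=.
  have kN := ltn_ord k.
  have -> : (N.-1 - (N - k.+1))%N = k by move: (nat_of_ord k) kN => k'; lia.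
  congr (_ * _); rewrite rmorphB /= rmorph_nat; congr (_ - _).
    congr (_%:R); congr nat_of_bool; move: (nat_of_ord k) (nat_of_ord i) kN ir => k' i' *.
    by apply/eqP/eqP; lia.
  rewrite big_add1 /= big_mkord rmorph_sum; apply: eq_bigr => l _ /=.
  have lpb := ltn_ord l.
  rewrite rmorphM /= rmorph_nat /bcoef; congr (_%:C * _).
    by congr (b _ _); move: (nat_of_ord i) ir => i'; lia.
  congr (_%:R); congr nat_of_bool.
  move: (nat_of_ord k) (nat_of_ord l) kN lpb => k' l' *.
  by apply/eqP/eqP; lia.
have sel (j : nat) : (j < N)%N -> \sum_(k < N) (k == j :> nat)%:R * w k = w j.
  move=> jN; rewrite (bigD1 (Ordinal jN)) //= eqxx mul1r big1 ?addr0 // => k kj.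
  have -> : (k == j :> nat) = false by apply: contraNF kj => /eqP h; apply/eqP/val_inj.
  by rewrite mul0r.
under eq_bigr do rewrite mulrBl mulr_suml.
rewrite sumrB sel; last by move: (nat_of_ord i) ir => i'; lia.
congr (_ - _); rewrite exchange_big; apply: eq_bigr => l _ /=.
under eq_bigr do rewrite -mulrA.
rewrite -mulr_sumr sel //; have lpb := ltn_ord l.
by move: (nat_of_ord l) lpb => l'; lia.
Qed.

Lemma boundary_window_ext x : Bm *m window r p (ext x) = 0.
Proof.
apply/colP => i; rewrite boundary_window mxE.
have ir := ltn_ord i.
rewrite {1}/ext ifT; last by move: (nat_of_ord i) ir => i'; lia.
apply/eqP; rewrite subr_eq0; apply/eqP; apply: eq_bigr => l _.
by rewrite addnC ext_shift.
Qed.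

Lemma window_boundary w : Bm *m window r p w = 0 -> ext (fun i => w (i + r)%N) = w.
Proof.
move=> h; apply/funext => i; rewrite /ext; case: ltnP => ir; last by rewrite subnK.
have ir' : (r.-1 - i < r)%N by lia.
have := boundary_window w (Ordinal ir'); rewrite h mxE /= => /esym/eqP.
rewrite subr_eq0; have -> : (r.-1 - (r.-1 - i))%N = i by lia.
by move=> /eqP ->; apply: eq_bigr => l _; rewrite addnC.
Qed.

Lemma Lmx_window (S : {poly C}) w : size S = r.+1 -> Lmx r p' pb b S *m window r p w =
  col_mx (\col_i act S w i) (Bm *m window r p w).
Proof.
move=> sS; rewrite mul_col_mx; congr col_mx; apply/colP => i.
by rewrite Top_window // mxE.
Qed.

End BoundaryOperator.

Section Apriori.
Context {R : realType}.
Local Notation C := (R[i]^o).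
Variables (lambda vel : R) (r p' pb : nat) (a : int -> R) (b : nat -> int -> R).
Local Notation p := p'.+1.
Local Notation N := (p + r)%N.
Hypothesis Hs : scheme_hypothesis lambda vel r p a.
Hypothesis Hl : Lopatinskii_hypothesis r p pb a b.
Hypothesis pbp : (pb <= p)%N.

Local Notation al := (coef_a r a).
Local Notation Q := (charQ r p a).
Local Notation stQ := (stableQ r p' a).
Local Notation unQ := (unstableQ r p' a).
Local Notation eig := (eigs r p' a).
Local Notation Bm := (boundary_mxC r p pb b).
Local Notation L := (Lmx r p' pb b).
Local Notation ext := (ext r pb b).
Local Notation T := (schemeT r p' pb a b).

Definition apriori_const (t M : R) : R :=
  N%:R * (N%:R * (M ^+ 2 * (modc (al N)^-1 ^+ 2 / ((t - 1) ^+ 2) ^+ p))).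

(** Inverting the unstable factor bounds [act S (ext x)], hence the right-hand side of the window
    system. Cramer's rule then bounds det times each coordinate without dividing by a determinant
    that may vanish. *)
Lemma apriori_factor (z : R[i]) (s us : seq R[i]) (t M B : R) x j :
  1 < t -> all (fun u => t <= modc u) us -> size s = r -> size us = p ->
  Q z = \prod_(k <- s) ('X - k%:P) * \prod_(k <- us) ('X - k%:P) ->
  (forall i k, modc (cofactor (L (\prod_(k <- s) ('X - k%:P))) i k) <= M) ->
  ell2 x -> l2le (z *: x - T x) B -> (j < N)%N ->
  modc (\det (L (\prod_(k <- s) ('X - k%:P)))) ^+ 2 * modc (ext x j) ^+ 2 <=
  apriori_const t M * B.
Proof.
move=> t1 hus ss su hQ hM hx hB jN; set S := \prod_(k <- s) _ in hQ hM *.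
have sS : size S = r.+1 by rewrite size_prod_XsubC ss.
have B0 := l2le_ge0 hB.
pose B1 := modc (al N)^-1 ^+ 2 * B / ((t - 1) ^+ 2) ^+ p.
have hv : l2le (act S (ext x)) B1.
  have h : l2le (act (\prod_(u <- us) ('X - u%:P)) (act S (ext x))) (modc (al N)^-1 ^+ 2 * B).
    rewrite -actM mulrC -hQ (act_charQ _ _ Hs); apply: l2leN; exact: l2leZ.
  by have := unstable_act t1 hus (ell2_act S (ell2_ext r pb b hx)) h; rewrite su.
pose V := L S *m window r p (ext x).
have hV k : modc (V k ord0) ^+ 2 <= B1.
  have B10 := l2le_ge0 hv.
  rewrite /V Lmx_window // (boundary_window_ext _ _ pbp).
  case: (split_ordP k) => k' ->.
    by rewrite col_mxEu mxE; exact: l2le_coord.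
  by rewrite col_mxEd mxE modc0 expr0n.
have jN' : (N.-1 - j < N)%N by lia.
pose j' := Ordinal jN'.
have e : \det (L S) * ext x j = \sum_(k < N) cofactor (L S) k j' * V k ord0.
  have -> : ext x j = window r p (ext x) j' ord0.
    by rewrite mxE; congr (ext x _); rewrite /j' /=; lia.
  have -> : \det (L S) * window r p (ext x) j' ord0 =
      (\adj (L S) *m V) j' ord0.
    by rewrite /V mulmxA mul_adj_mx mul_scalar_mx [RHS]mxE.
  by rewrite mxE; apply: eq_bigr => k _; rewrite mxE.
rewrite -exprMn -modcM e.
(* [modc_sum_sqr] takes families indexed by nat, so the summand is extended by 0. *)
pose F k : R[i] := if insub k is Some k' then cofactor (L S) k' j' * V k' ord0 else 0.
have -> : \sum_(k < N) cofactor (L S) k j' * V k ord0 = \sum_(k < N) F k.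
  by apply: eq_bigr => k _; rewrite /F valK.
have -> : apriori_const t M * B = N%:R * (N%:R * (M ^+ 2 * B1)).
  rewrite /apriori_const /B1; move: (modc _ ^+ 2) (_ ^+ p)^-1 (N%:R) => c1 c2 n; ring.
rewrite (le_trans (modc_sum_sqr N F)) // ler_wpM2l //.
apply: (@le_trans _ _ (\sum_(k < N) M ^+ 2 * B1)); last first.
  by rewrite sumr_const card_ord mulr_natl.
apply: ler_sum => k _; rewrite /F valK modcM exprMn ler_pM ?sqr_ge0 //.
by rewrite lerXn2r ?nnegrE ?modc_ge0 ?hM // (le_trans (modc_ge0 _) (hM k j')).
Qed.

Lemma Lmx_cvg (P : C -> {poly R[i]}) (P0 : {poly R[i]}) z0 i j :
  poly_cvg (F := nbhs (z0 : C)) P P0 ->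
  (fun z => L (P z) i j : C) @ nbhs (z0 : C) --> (L P0 i j : C).
Proof.
move=> hP; case: (split_ordP i) => i' ->.
  have e (S : {poly R[i]}) : L S (lshift r i') j = (S * 'X^i')`_(N.-1 - j).
    by rewrite /Lmx col_mxEu mxE.
  rewrite (funext (fun z => e (P z))) e.
  exact: (poly_cvgM hP (@poly_cvg_cst R _ (nbhs (z0 : C)) _ 'X^i')).
have e (S : {poly R[i]}) : L S (rshift p i') j = Bm i' j.
  by rewrite /Lmx col_mxEd.
rewrite (funext (fun z => e (P z))) e; exact: cvg_cst.
Qed.

(** The constant is uniform near z0: cofactors are continuous in z, hence bounded, and the gap t'
    persists. *)
Lemma local_estimate (z0 : R[i]) (ss us : seq R[i]) (t t' : R) :
  Q z0 = \prod_(k <- ss) ('X - k%:P) * \prod_(k <- us) ('X - k%:P) ->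
  size ss = r -> size us = p -> 1 < t' ->
  all (fun k => modc k < t) ss -> all (fun k => t' < modc k) us ->
  exists s u : C -> seq R[i], exists K d : R,
    [/\ poly_cvg (F := nbhs (z0 : C)) (fun z => \prod_(k <- s z) ('X - k%:P))
          (\prod_(k <- ss) ('X - k%:P)), 0 <= K, 0 < d &
     forall z : R[i], modc (z - z0) < d ->
      [/\ Q z = \prod_(k <- s z) ('X - k%:P) * \prod_(k <- u z) ('X - k%:P),
       all (fun k => modc k < t) (s z), all (fun k => t' < modc k) (u z) &
       forall x B j, ell2 x -> l2le (z *: x - T x) B -> (j < N)%N ->
       modc (\det (L (\prod_(k <- s z) ('X - k%:P)))) ^+ 2 * modc (ext x j) ^+ 2 <= K * B]].
Proof.
move=> hQ hs hu t1 hss hus.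
have [s [u [h1 h2 h3 _]]] := local_factor Hs hQ hss hus.
pose c0 i j := cofactor (L (\prod_(k <- ss) ('X - k%:P))) i j.
pose M := \sum_i \sum_j modc (c0 i j) + 1.
have hM i j : modc (c0 i j) + 1 <= M.
  rewrite lerD2r (bigD1 i) //= (bigD1 j) //= -addrA lerDl addr_ge0 //.
    by apply: sumr_ge0 => k _; exact: modc_ge0.
  by apply: sumr_ge0 => k _; apply: sumr_ge0 => l _; exact: modc_ge0.
have h4 : nbhs (z0 : C) (fun z => forall ij : 'I_N * 'I_N,
   modc (cofactor (L (\prod_(k <- s z) ('X - k%:P))) ij.1 ij.2) <= M).
  apply: (@filter_forall C _ (fun ij z =>
    modc (cofactor (L (\prod_(k <- s z) ('X - k%:P))) ij.1 ij.2) <= M) (nbhs (z0 : C))) => -[i j] /=.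
  have : (fun z => cofactor (L (\prod_(k <- s z) ('X - k%:P))) i j : C) @ nbhs (z0 : C) -->
      (c0 i j : C).
    apply: cvgC_cofactor => i' j'.
    exact: (@Lmx_cvg (fun z => \prod_(k <- s z) ('X - k%:P))).
  move=> /cvgCP h; have := h _ ltr01; apply: filterS => z hz.
  apply: le_trans (hM i j); rewrite -[X in modc X](subKr (c0 i j)).
  by rewrite (le_trans (modcB _ _)) // lerD2l ltW.
move/nbhsCP: h2 => [d1 d10 h2]; move/nbhsCP: h4 => [d2 d20 h4].
exists s, u, (apriori_const t' M), (Num.min d1 d2); split=> //.
- have M0 : 0 <= M by rewrite addr_ge0 // sumr_ge0 // => i _; apply: sumr_ge0 => j _; exact: modc_ge0.
  apply: mulr_ge0; first exact: ler0n.
  apply: mulr_ge0; first exact: ler0n.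
  by rewrite mulr_ge0 ?sqr_ge0 // divr_ge0 ?sqr_ge0 // exprn_ge0 // sqr_ge0.
- by rewrite lt_min d10.
move=> z; rewrite lt_min => /andP[/h2[hsz huz] /h4 hM'].
have [ssz suz hQz] := h1 z; split=> // x B j hx hB jN.
apply: (apriori_factor t1 _ _ _ hQz) => //.
- by apply: sub_all huz => k; exact: ltW.
- by rewrite ssz.
- by rewrite suz.
- by move=> i k; exact: (hM' (i, k)).
Qed.

Lemma gap_above (us : seq R[i]) : all (fun k => 1 < modc k) us ->
  exists2 t : R, 1 < t & all (fun k => t < modc k) us.
Proof.
elim: us => [|u us IH] /=; first by exists 2 => //; rewrite ltr1n.
move=> /andP[u1 /IH[t t1 ht]].
have h : 1 < (1 + modc u) / 2 < modc u.
  by rewrite ltr_pdivlMr // ltr_pdivrMr //; apply/andP; split; lra.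
have /andP[h1 h2] := h.
exists (Num.min ((1 + modc u) / 2) t); first by rewrite lt_min h1.
rewrite gt_min h2 /=; apply: sub_all ht => k hk.
by rewrite gt_min hk orbT.
Qed.

Lemma bound_above (ss : seq R[i]) : exists t : R, all (fun k => modc k < t) ss.
Proof.
elim: ss => [|u us [t ht]]; first by exists 0.
exists (Num.max (modc u + 1) t); rewrite /= lt_max ltrDl ltr01 /=.
by apply: sub_all ht => k hk; rewrite lt_max hk orbT.
Qed.

Lemma det_Lmx_cvg (P : C -> {poly R[i]}) (P0 : {poly R[i]}) (z0 : R[i]) :
  poly_cvg (F := nbhs (z0 : C)) P P0 ->
  (fun z => \det (L (P z)) : C) @ nbhs (z0 : C) --> (\det (L P0) : C).
Proof. by move=> hP; apply: cvgC_det => i j; exact: Lmx_cvg. Qed.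

Definition trace_estimate (K : R) (q : R[i] -> R[i]) (z : R[i]) := forall x B j,
  ell2 x -> l2le (z *: x - T x) B -> (j < N)%N ->
  modc (q z) ^+ 2 * modc (ext x j) ^+ 2 <= K * B.

Lemma trace_estimateW K q q' c z : 0 < c -> c * modc (q' z) <= modc (q z) ->
  trace_estimate K q z -> trace_estimate (K / c ^+ 2) q' z.
Proof.
move=> c0 hq h x B j hx hB jN.
have c20 : 0 < c ^+ 2 by rewrite exprn_gt0.
rewrite [leRHS]mulrAC ler_pdivlMr // [leLHS]mulrC mulrA; apply: le_trans (h x B j hx hB jN).
rewrite -exprMn ler_wpM2r ?sqr_ge0 // lerXn2r ?nnegrE ?mulr_ge0 ?modc_ge0 //.
exact: ltW.
Qed.

Lemma nonzero_estimate (z0 : R[i]) (P : C -> {poly R[i]}) (P0 : {poly R[i]}) K d :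
  poly_cvg (F := nbhs (z0 : C)) P P0 -> \det (L P0) != 0 -> 0 <= K -> 0 < d ->
  (forall z, modc (z - z0) < d -> trace_estimate K (fun z => \det (L (P z))) z) ->
  exists K' d' : R, [/\ 0 <= K', 0 < d' &
    forall z, modc (z - z0) < d' -> trace_estimate K' (fun=> 1) z].
Proof.
move=> hP D0 K0 d0 h.
have /nbhsCP[d1 d10 h1] := near_neq0 (det_Lmx_cvg hP) D0.
pose c := modc (\det (L P0)) / 2.
have c0 : 0 < c by rewrite divr_gt0 // modc_gt0.
exists (K / c ^+ 2), (Num.min d d1); split.
- by rewrite divr_ge0 ?sqr_ge0.
- by rewrite lt_min d0.
move=> z; rewrite lt_min => /andP[/h hz /h1 hz1].
apply: trace_estimateW c0 _ hz; rewrite modc1 mulr1; exact: hz1.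
Qed.

(** At z0 = 1 the factor containing the root 1 is used, and its determinant does not vanish.
    Elsewhere the factor is the stable polynomial, whose determinant can vanish only on the circle,
    to first order. *)
Lemma local_dichotomy (z0 : R[i]) : 1 <= modc z0 ->
  exists K d : R, [/\ 0 <= K, 0 < d &
    (forall z, modc (z - z0) < d -> trace_estimate K (fun=> 1) z) \/
    [/\ circle_zeros r p' pb a b z0, modc z0 = 1 & z0 != 1] /\
    forall z, modc (z - z0) < d -> trace_estimate K (fun z => z - z0) z].
Proof.
move=> z01; have [->|zn1] := eqVneq z0 1.
  have [us [su hus sS hQ D0]] := stable_at1 Hs Hl pbp.
  pose ss := 1 :: [seq k <- eig 1 | modc k < 1].
  have sE : stQ 1 * ('X - 1%:P) = \prod_(k <- ss) ('X - k%:P).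
    by rewrite big_cons big_filter mulrC.
  have sss : size ss = r.
    apply: succn_inj; rewrite -(size_prod_XsubC ss (fun k => k)) -sE size_mul ?polyXsubC_eq0 //.
      by rewrite sS size_XsubC addn2.
    by rewrite monic_neq0 // stableQ_monic.
  rewrite sE in hQ D0; have [t' t1 hus'] := gap_above hus.
  have [t hss] := bound_above ss.
  have [s [u [K [d [h1 K0 d0 h2]]]]] := local_estimate hQ sss su t1 hss hus'.
  have [//|K' [d' [K'0 d'0 h]]] := nonzero_estimate h1 D0 K0 d0.
    by move=> z /h2[].
  by exists K', d'; split=> //; left.
pose ss := [seq k <- eig z0 | modc k < 1].
pose us := [seq k <- eig z0 | ~~ (modc k < 1)].
have sE : stQ z0 = \prod_(k <- ss) ('X - k%:P) by rewrite big_filter.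
have uE : unQ z0 = \prod_(k <- us) ('X - k%:P) by rewrite big_filter.
have hss : all (fun k => modc k < 1) ss by exact: filter_all.
have heig := eig_circle Hs z01 zn1.
have hus : all (fun k => 1 < modc k) us.
  apply/allP => k; rewrite mem_filter -leNgt => /andP[k1 ke].
  by rewrite lt_neqAle k1 eq_sym heig.
have hQ : Q z0 = \prod_(k <- ss) ('X - k%:P) * \prod_(k <- us) ('X - k%:P).
  by rewrite -sE -uE (stableM Hs).
have sz := size_stable Hs Hl pbp z01 zn1.
have sss : size ss = r by apply: succn_inj; rewrite -(size_prod_XsubC ss (fun k => k)) -sE.
have su : size us = p.
  by apply: succn_inj; rewrite -(size_prod_XsubC us (fun k => k)) -uE (size_unstable Hs).
have [t' t1 hus'] := gap_above hus.
have [s [u [K [d [h1 K0 d0 h2]]]]] := local_estimate hQ sss su t1 hss hus'.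
have h3 z : modc (z - z0) < d -> trace_estimate K (fun z => \det (L (stQ z))) z.
  move=> /h2[hQz hs hu he]; have [|e _ _] := factor_stable Hs hQz hs.
    by apply: sub_all hu => k; exact: lt_trans.
  by rewrite /trace_estimate e.
have [D0|D0] := eqVneq (\det (L (stQ z0))) 0; last first.
  have [_ hst _] := stable_near Hs heig.
  have [//|K' [d' [K'0 d'0 h]]] := nonzero_estimate hst D0 K0 d0.
  by exists K', d'; split=> //; left.
have m1 : modc z0 = 1.
  apply/eqP; rewrite eq_le z01 andbT leNgt; apply/negP => h.
  by have := Lmx_det_gt1 Hs Hl pbp h; rewrite D0 eqxx.
have [hz [c [d1 [c0 d10 hc]]]] := Lmx_circle Hs Hl pbp m1 zn1 D0.
exists (K / c ^+ 2), (Num.min d d1); split.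
- by rewrite divr_ge0 ?sqr_ge0.
- by rewrite lt_min d0.
right; split=> // z; rewrite lt_min => /andP[/h3 hz3 /hc hz1].
apply: trace_estimateW c0 _ hz3; exact: hz1.
Qed.

End Apriori.

(** * Uniform estimates on an annulus *)

Section Compactness.
Context {R : realType}.
Local Notation C := (R[i]).

(** The local bounds are also given around points of the circle |z0| = 1, so compactness yields a
    constant that does not degenerate as |z| decreases to 1. *)
Lemma annulus_uniform (P : R -> C -> Prop) (R0 : R) :
  (forall K K' z, K <= K' -> P K z -> P K' z) ->
  (forall z0, 1 <= modc z0 -> exists K d : R, 0 < d /\
     forall z, modc (z - z0) < d -> 1 < modc z -> P K z) ->
  exists2 K, 0 <= K & forall z, 1 < modc z <= R0 -> P K z.
Proof.
move=> PW hloc; pose S : set (R * R) := `[- R0, R0] `*` `[- R0, R0].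
have cS : compact S by apply: compact_setX; exact: segment_compact.
pose toC (v : R * R) : C := v.1 +i* v.2.
have toCB v w : modc (toC v - toC w) <= `|v.1 - w.1| + `|v.2 - w.2|.
  exact: (modc_le_ReIm (toC v - toC w)).
pose G (n : nat) v := 1 < modc (toC v) -> P n%:R (toC v).
have ball_near (v : R * R) (d : R) : 0 < d ->
    \forall w \near v, modc (toC w - toC v) < d.
  move=> d0; have d20 : 0 < d / 2 by rewrite divr_gt0.
  exists (ball v.1 (d / 2), ball v.2 (d / 2)); first by split; exact: nbhsx_ballx.
  move=> w [h1 h2]; apply: le_lt_trans (toCB w v) _.
  rewrite /ball /= in h1 h2; rewrite (distrC w.1) (distrC w.2).
  by rewrite [ltRHS](splitr d) ltrD.
have [|n _ hn] := (compact_near_coveringP S).1 cS nat \oo G _.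
  move=> v Sv.
  have [v1|v1] := leP 1 (modc (toC v)).
    have [K [d [d0 h]]] := hloc _ v1.
    exists ([set w | modc (toC w - toC v) < d], [set n | K <= n%:R]).
      split => /=; first exact: ball_near.
      exact: nbhs_infty_ger.
    by move=> [w n] /= [/= wd Kn] w1; apply: (PW _ _ _ Kn); exact: h.
  (* This neighbourhood stays inside the open disc, where the claim is void. *)
  exists ([set w | modc (toC w - toC v) < 1 - modc (toC v)], setT).
    by split; [apply: ball_near; rewrite subr_gt0|exact: filterT].
  move=> [w n] [hw _]; have {}hw : modc (toC w - toC v) < 1 - modc (toC v) by exact: hw.
  change (1 < modc (toC w) -> P n%:R (toC w)); rewrite ltNge => /negP[]; apply: ltW.
  by have := modcD (toC w - toC v) (toC v); rewrite subrK; lra.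
exists n%:R => // z /andP[z1 zR].
have Sz : S (complex.Re z, complex.Im z).
  by split=> /=; rewrite in_itv /= -ler_norml; apply: le_trans zR; [exact: Re_le_modc|exact: Im_le_modc].
have := hn n (leqnn n) _ Sz; rewrite /G /toC /=; case: z z1 {zR Sz} => x y z1 /=; exact.
Qed.

End Compactness.

Section GlobalApriori.
Context {R : realType}.
Variables (lambda vel : R) (r p' pb : nat) (a : int -> R) (b : nat -> int -> R).
Local Notation p := p'.+1.
Local Notation N := (p + r)%N.
Hypothesis Hs : scheme_hypothesis lambda vel r p a.
Hypothesis Hl : Lopatinskii_hypothesis r p pb a b.
Hypothesis pbp : (pb <= p)%N.
Local Notation ext := (ext r pb b).
Local Notation estimate := (trace_estimate r p' pb a b).

Lemma estimate_le K K' q z : K <= K' -> estimate K q z -> estimate K' q z.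
Proof.
move=> KK' h x B j hx hB jN; apply: le_trans (h x B j hx hB jN) _.
rewrite ler_wpM2r //; exact: l2le_ge0 hB.
Qed.

Lemma circle_estimate (z0 : R[i]) : modc z0 = 1 -> z0 != 1 ->
  exists K d : R, [/\ 0 <= K, 0 < d &
    forall z, modc (z - z0) < d -> estimate K (fun z => z - z0) z].
Proof.
move=> m1 zn1; have m1' : 1 <= modc z0 by rewrite m1.
have [K [d [K0 d0 [h|[_ h]]]]] := local_dichotomy Hs Hl pbp m1'; last by exists K, d.
exists K, (Num.min 1 d); split=> //; first by rewrite lt_min ltr01.
move=> z; rewrite lt_min => /andP[z1 /h hz] x B j hx hB jN.
apply: le_trans (hz x B j hx hB jN); rewrite ler_wpM2r ?sqr_ge0 //.
by rewrite modc1 lerXn2r ?nnegrE ?modc_ge0 // ltW.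
Qed.

(** The product over [zs] can replace either local weight: it is bounded on the annulus, and near a
    zero z0 it is at most a constant times |z - z0|. *)
Lemma zeros_estimate (zs : seq R[i]) (R0 : R) : 1 < R0 ->
  (forall z, circle_zeros r p' pb a b z -> z \in zs) ->
  (forall z, z \in zs -> modc z = 1) ->
  exists2 K, 0 <= K & forall z, 1 < modc z <= R0 ->
    estimate K (fun z => \prod_(k <- zs) (z - k)) z.
Proof.
move=> R01 hzs zs1.
have R1 : 0 < R0 + 1 by rewrite addr_gt0 // (lt_trans ltr01).
have prod_le (s : seq R[i]) z : {subset s <= zs} -> modc z <= R0 ->
    modc (\prod_(k <- s) (z - k)) <= (R0 + 1) ^+ size s.
  move=> hs zR; elim: s hs => [|k s IH] hs; first by rewrite big_nil modc1.
  rewrite big_cons modcM exprS ler_pM ?modc_ge0 //.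
    rewrite (le_trans (modcB _ _)) // (zs1 k) ?lerD2r //.
    by apply: hs; rewrite mem_head.
  by apply: IH => x xs; apply: hs; rewrite in_cons xs orbT.
have [||K K0 h] := @annulus_uniform R (fun K z => modc z <= R0 ->
  estimate K (fun z => \prod_(k <- zs) (z - k)) z) R0.
- by move=> K K' z KK' h /h; exact: estimate_le.
- move=> z0 z01; have [K [d [K0 d0 [h|[[hc m1 zn1] h]]]]] := local_dichotomy Hs Hl pbp z01.
    exists (K / ((R0 + 1) ^- size zs) ^+ 2), d; split=> // z /h hz _ zR.
    apply: trace_estimateW hz; first by rewrite invr_gt0 exprn_gt0.
    by rewrite modc1 mulrC ler_pdivrMr ?exprn_gt0 // mul1r prod_le.
  have hm := hzs _ hc.
  exists (K / ((R0 + 1) ^- size (rem z0 zs)) ^+ 2), d; split=> // z /h hz _ zR.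
  apply: trace_estimateW hz; first by rewrite invr_gt0 exprn_gt0.
  rewrite (perm_big _ (perm_to_rem hm)) big_cons modcM mulrCA ler_piMr ?modc_ge0 //.
  rewrite mulrC ler_pdivrMr ?exprn_gt0 // mul1r prod_le //.
  by move=> k /mem_rem.
by exists K => // z /andP[z1 zR]; apply: h; rewrite ?z1.
Qed.

End GlobalApriori.

(** * Decomposition at the zeros of the Lopatinskii determinant *)

Section SimpleEigenvalues.
Context {R : realType}.
Local Notation C := (R[i]).
Variables (lambda vel : R) (r p' pb : nat) (a : int -> R) (b : nat -> int -> R).
Local Notation p := p'.+1.
Local Notation N := (p + r)%N.
Hypothesis Hs : scheme_hypothesis lambda vel r p a.
Hypothesis Hl : Lopatinskii_hypothesis r p pb a b.
Hypothesis pbp : (pb <= p)%N.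

Local Notation stQ := (stableQ r p' a).
Local Notation unQ := (unstableQ r p' a).
Local Notation eig := (eigs r p' a).
Local Notation ext := (ext r pb b).
Local Notation T := (schemeT r p' pb a b).

Lemma l2le_zero (w : nat -> C) : l2le w 0 -> w = 0.
Proof.
move=> h; apply/funext => i; change (w i = 0); apply/eqP; rewrite -modc_eq0.
by rewrite -sqrf_eq0 eq_le sqr_ge0 andbT; exact: l2le_coord.
Qed.

Lemma l2le_unext x A : l2le (ext x) A -> l2le x A.
Proof.
move=> /(@l2le_shift _ _ _ r) h n; apply: le_trans (h n).
by apply: ler_sum => i _; rewrite ext_shift.
Qed.

Lemma le0_eps (x c d : R) : 0 < d -> 0 <= c ->
  (forall e, 0 < e < d -> x <= c * e) -> x <= 0.
Proof.
move=> d0 c0 h; rewrite leNgt; apply/negP => x0.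
have c1 : 0 < c + 1 by rewrite ltr_wpDl.
pose e := Num.min (d / 2) (x / (c + 1) / 2).
have e0 : 0 < e by rewrite lt_min !divr_gt0.
have ed : e < d by rewrite gt_min ltr_pdivrMr // ltr_pMr // ltr1n.
have := h e; rewrite e0 ed => /(_ isT); apply/negP; rewrite -ltNge.
apply: (@le_lt_trans _ _ (c * (x / (c + 1) / 2))).
  by rewrite ler_wpM2l // ge_min lexx orbT.
rewrite mulrA ltr_pdivrMr // mulrA ltr_pdivrMr // mulrC -subr_gt0.
nra.
Qed.

Variable z0 : C.
Hypothesis z01 : modc z0 = 1.
Hypothesis z0n1 : z0 != 1.

Lemma stable_gap : exists t ss, [/\ 0 < t < 1, size ss = r,
  stQ z0 = \prod_(k <- ss) ('X - k%:P) & all (fun k => modc k <= t) ss].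
Proof.
pose ss := [seq k <- eig z0 | modc k < 1].
have sE : stQ z0 = \prod_(k <- ss) ('X - k%:P) by rewrite big_filter.
have sz : size (stQ z0) = r.+1 by apply: (size_stable Hs Hl pbp) => //; rewrite z01.
have sss : size ss = r.
  by apply: succn_inj; rewrite -(size_prod_XsubC ss (fun k => k)) -sE.
have hss : all (fun k => modc k < 1) ss by exact: filter_all.
suff [t t1 ht] : exists2 t : R, 0 < t < 1 & all (fun k => modc k <= t) ss by exists t, ss.
elim: (ss) hss => [|k s IH] /=.
  by exists 2^-1 => //; rewrite invr_gt0 ltr0n /= invf_lt1 ?ltr1n.
move=> /andP[k1 /IH[t /andP[t0 t1] ht]]; exists (Num.max (modc k) t).
  by rewrite lt_max t0 orbT gt_max k1.
by rewrite le_max lexx /=; apply: sub_all ht => y yt; rewrite le_max yt orbT.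
Qed.

Lemma unstable_gap : exists t us, [/\ 1 < t, size us = p,
  unQ z0 = \prod_(k <- us) ('X - k%:P) & all (fun k => t <= modc k) us].
Proof.
pose us := [seq k <- eig z0 | ~~ (modc k < 1)].
have uE : unQ z0 = \prod_(k <- us) ('X - k%:P) by rewrite big_filter.
have m1 : 1 <= modc z0 by rewrite z01.
have sz : size (stQ z0) = r.+1 by exact: (size_stable Hs Hl pbp).
have su : size us = p.
  by apply: succn_inj; rewrite -(size_prod_XsubC us (fun k => k)) -uE (size_unstable Hs).
have hus : all (fun k => 1 < modc k) us.
  apply/allP => k; rewrite mem_filter -leNgt => /andP[k1 ke].
  by rewrite lt_neqAle k1 eq_sym (eig_circle Hs m1 z0n1).
have [t t1 ht] := gap_above hus.
by exists t, us; split=> //; apply: sub_all ht => k; exact: ltW.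
Qed.

Lemma unstable_estimate : exists2 K, 0 <= K & forall w B, ell2 w ->
  l2le (act (unQ z0) w) B -> l2le w (K * B).
Proof.
have [t [us [t1 su uE hus]]] := unstable_gap.
exists (((t - 1) ^+ 2) ^+ size us)^-1; first by rewrite invr_ge0 exprn_ge0 // sqr_ge0.
by move=> w B hw; rewrite uE mulrC; exact: unstable_act.
Qed.

Lemma stable_estimate : exists2 K, 0 <= K & forall w B,
  l2le (act (stQ z0) w) B -> l2le w (K * (\sum_(i < r) modc (w i) ^+ 2 + B)).
Proof.
have [t [ss [t1 s1 sE hss]]] := stable_gap.
have [K [K0 h]] := stable_act t1 hss.
by exists K => // w B; rewrite sE => /h; rewrite s1.
Qed.

Lemma unstable_inj v : ell2 v -> act (unQ z0) v = 0 -> v = 0.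
Proof.
move=> hv h; have [K _ hK] := unstable_estimate; apply: l2le_zero.
by rewrite -(mulr0 K); apply: hK => //; rewrite h; exact: l2le0.
Qed.

(** The unstable factor is injective on square-summable sequences, so an eigenvector solves the
    stable recurrence, which its initial values determine. *)
Lemma eigen_window0 x : ell2 x -> T x = z0 *: x ->
  (forall j, (j < N)%N -> ext x j = 0) -> x = 0.
Proof.
move=> hx hT hj; have [K _ hK] := stable_estimate.
have hS : act (stQ z0) (ext x) = 0.
  apply: unstable_inj; first exact/ell2_act/ell2_ext.
  by rewrite -actM mulrC (stableM Hs) (act_charQ _ _ Hs) hT subrr scaler0 oppr0.
apply/l2le_zero/l2le_unext; rewrite -(mulr0 K) -[X in l2le _ (K * X)](addr0 0).
rewrite -[X in X + 0](_ : \sum_(i < r) modc (ext x i) ^+ 2 = 0).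
  by apply: hK; rewrite hS; exact: l2le0.
rewrite big1 // => i _; rewrite hj ?modc0 ?expr0n //.
by apply: leq_trans (ltn_ord i) _; exact: leq_addl.
Qed.

(* (z - T) (x + (z - z0) w) = (z - z0)^2 w is of higher order than what
   circle_estimate loses. *)
Lemma no_jordan_chain x w : ell2 x -> ell2 w -> T x = z0 *: x ->
  T w - z0 *: w = x -> x = 0.
Proof.
move=> hx [A hA] hT hw; apply: eigen_window0 => // j jN.
have [K [d [K0 d0 hK]]] := circle_estimate Hs Hl pbp z01 z0n1.
have A0 := l2le_ge0 hA.
apply/eqP; rewrite -modc_eq0 -sqrf_eq0 eq_le sqr_ge0 andbT.
apply: (@le0_eps _ (2 * (K * A) + 2 * modc (ext w j) ^+ 2) (Num.min 1 d)).
- by rewrite lt_min ltr01.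
- by have := mulr_ge0 K0 A0; have := sqr_ge0 (modc (ext w j)); lra.
move=> e /andP[e0]; rewrite lt_min => /andP[e1 ed].
pose z := (1 + e)%:C * z0.
have zz0 : z - z0 = e%:C * z0 by rewrite /z rmorphD rmorph1; ring.
have mz : modc (z - z0) = e by rewrite zz0 modcM z01 mulr1 modc_real gtr0_norm.
pose y := x + (z - z0) *: w.
have hy : ell2 y by case: hx => A' hA'; eexists; apply: l2leD hA' (l2leZ _ hA).
have hTy : z *: y - T y = (z - z0) ^+ 2 *: w.
  have hTw : T w = x + z0 *: w by rewrite -hw subrK.
  rewrite /y schemeTD schemeTZ hT hTw; apply/funext => i.
  change (z * (x i + (z - z0) * w i) - (z0 * x i + (z - z0) * (x i + z0 * w i)) =
    (z - z0) ^+ 2 * w i).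
  ring.
have := hK z; rewrite mz => /(_ ed y (e ^+ 4 * A) j hy).
rewrite hTy => /(_ _ jN) h.
have {}h : e ^+ 2 * modc (ext y j) ^+ 2 <= K * (e ^+ 4 * A).
  by rewrite -[X in X ^+ 2 * _ <= _]mz; apply: h; have := l2leZ ((z - z0) ^+ 2) hA; rewrite modcX mz -exprM.
have {}h : modc (ext y j) ^+ 2 <= K * A * e ^+ 2.
  rewrite -(ler_pM2l (exprn_gt0 2 e0)); apply: le_trans h _.
  by rewrite le_eqVlt; apply/orP; left; apply/eqP; ring.
have -> : ext x j = ext y j - (z - z0) * ext w j.
  rewrite /y extD extZ; change (ext x j = ext x j + (z - z0) * ext w j - (z - z0) * ext w j).
  by rewrite addrK.
have := modcD_sqr2 (ext y j) (- ((z - z0) * ext w j)).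
rewrite modcN modcM mz exprMn => /le_trans; apply.
have ee : e ^+ 2 <= e by rewrite expr2 ler_piMr // ltW.
have m0 := sqr_ge0 (modc (ext w j)).
have KA0 : 0 <= K * A by exact: mulr_ge0.
have h1 := ler_wpM2l KA0 ee; have h2 := ler_wpM2r m0 ee.
have {h1}h := le_trans h h1.
move: h h2; move: (modc (ext y j) ^+ 2) (modc (ext w j) ^+ 2) (K * A) (e ^+ 2) => Y m c e2.
move=> {}h h2; have -> : (2 * c + 2 * m) * e = 2 * (c * e) + 2 * (e * m) by ring.
by apply: lerD; rewrite ler_wpM2l.
Qed.

End SimpleEigenvalues.

Section RangeComplement.
Context {R : realType}.
Local Notation C := (R[i]).
Variables (lambda vel : R) (r p' pb : nat) (a : int -> R) (b : nat -> int -> R).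
Local Notation p := p'.+1.
Local Notation N := (p + r)%N.
Hypothesis Hs : scheme_hypothesis lambda vel r p a.
Hypothesis Hl : Lopatinskii_hypothesis r p pb a b.
Hypothesis pbp : (pb <= p)%N.

Local Notation al := (coef_a r a).
Local Notation stQ := (stableQ r p' a).
Local Notation unQ := (unstableQ r p' a).
Local Notation Bm := (boundary_mxC r p pb b).
Local Notation L := (Lmx r p' pb b).
Local Notation ext := (ext r pb b).
Local Notation T := (schemeT r p' pb a b).
Local Notation win := (window r p).

Definition source (v : nat -> C) : 'cV[C]_N := col_mx (\col_(i < p) v i) (0 : 'cV[C]_r).

Lemma sourceD v w : source (v + w) = source v + source w.
Proof.
rewrite /source add_col_mx addr0; congr col_mx; apply/colP => i; rewrite !mxE; exact.
Qed.

Lemma sourceZ c v : source (c *: v) = c *: source v.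
Proof.
rewrite /source scale_col_mx scaler0; congr col_mx; apply/colP => i; rewrite !mxE; exact.
Qed.

Lemma source0 : source 0 = 0.
Proof. by rewrite -(scale0r (0 : nat -> C)) sourceZ scale0r. Qed.

Lemma source_sum n (v : 'I_n -> nat -> C) : source (\sum_i v i) = \sum_i source (v i).
Proof.
elim/big_ind2: _ => [|u1 v1 u2 v2 <- <-|//]; last exact: sourceD.
exact: source0.
Qed.

Variable z0 : C.
Hypothesis z01 : modc z0 = 1.
Hypothesis z0n1 : z0 != 1.

Local Notation L0 := (L (stQ z0)).

Lemma size_stable0 : size (stQ z0) = r.+1.
Proof. by apply: (size_stable Hs Hl pbp) => //; rewrite z01. Qed.

Lemma window_inj (S : {poly C}) y (X : 'cV[C]_N) : S \is monic -> size S = r.+1 ->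
  (forall i, (i < r)%N -> forall j : 'I_N, j = (N.-1 - i)%N :> nat -> y i = X j ord0) ->
  Top r p S *m win y = Top r p S *m X -> win y = X.
Proof.
move=> mS sS hi hT; apply/eqP; rewrite -subr_eq0; apply/eqP.
have D0 := Mmx_unit p' mS sS.
suff h : Mmx r p' S *m (win y - X) = 0.
  have := mul_adj_mx (Mmx r p' S) => /(congr1 (fun A => A *m (win y - X))).
  rewrite -mulmxA h mulmx0 mul_scalar_mx => /esym/eqP.
  by rewrite scaler_eq0 (negPf D0) => /eqP.
rewrite /Mmx mul_col_mx mulmxBr hT subrr.
rewrite -[win y - X]vsubmxK mul_row_col mul0mx add0r mul1mx.
rewrite [dsubmx _](_ : _ = 0) ?col_mx0 //; apply/colP => i; rewrite !mxE.
have ir := ltn_ord i.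
apply/eqP; rewrite subr_eq0; apply/eqP; rewrite (hi _ _ (rshift p i)) //=.
  by move: (nat_of_ord i) ir => k kr; clear -kr; lia.
by move: (nat_of_ord i) ir => k kr; clear -kr; lia.
Qed.

(** Solving (T - z0) w = h is reduced to a finite linear system. The recurrence S y = v is run from
    the r lowest entries of X; the window of y is then X, so y satisfies the boundary conditions and
    is an extension. *)
Lemma range_solve h v X : act (unQ z0) v = (al N)^-1 *: h -> L0 *m X = source v ->
  exists w, [/\ T w - z0 *: w = h, win (ext w) = X & act (stQ z0) (ext w) = v].
Proof.
move=> hv hX; have mS := stableQ_monic r p' a z0; have sS := size_stable0.
pose x i : C := if insub (N.-1 - i)%N is Some j then X j ord0 else 0.
have [y [hy hyx]] := act_exists x v mS.
have hT : Top r p (stQ z0) *m win y = \col_(i < p) v i.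
  by apply/colP => i; rewrite Top_window // mxE hy.
have [hTX hBX] : Top r p (stQ z0) *m X = \col_(i < p) v i /\ Bm *m X = 0.
  by move: hX; rewrite /Lmx mul_col_mx => /eq_col_mx.
have wX : win y = X.
  apply: (window_inj mS sS); last by rewrite hT hTX.
  move=> i ir j ji; rewrite hyx ?sS //= /x -ji valK; exact: erefl.
pose w i := y (i + r)%N.
have ew : ext w = y by apply: (window_boundary pbp); rewrite wX.
exists w; rewrite ew; split=> //.
have ap0 : (al N)^-1 != 0 by rewrite invr_eq0 (ap_neq0 Hs).
apply: (scalerI ap0); rewrite -hv -hy -actM mulrC (stableM Hs) -ew (act_charQ _ _ Hs).
by rewrite -[RHS]scalerN opprB.
Qed.

Lemma kernel_projection (A : 'M[C]_N) : exists P : 'M[C]_N, A *m P = 0 /\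
  forall X : 'cV[C]_N, A *m X = 0 -> P *m X = X.
Proof.
exists (1%:M - pinvmx A *m A); split.
  by rewrite mulmxBr mulmx1 mulmxA mulmxKpV // subrr.
by move=> X hX; rewrite mulmxBl mul1mx -mulmxA hX mulmx0 subr0.
Qed.

Definition comb (X : 'cV[C]_N) (phi : 'I_N -> nat -> C) : nat -> C :=
  \sum_j X j ord0 *: phi j.

Lemma l2le_comb X phi A : (forall j, l2le (phi j) A) ->
  l2le (comb X phi) (N%:R * (\sum_j modc (X j ord0) ^+ 2) * A).
Proof.
move=> h; pose F k : nat -> C := if insub k is Some j then X j ord0 *: phi j else 0.
have -> : comb X phi = \sum_(k < N) F k.
  by apply: eq_bigr => k _; rewrite /F valK.
pose B k := if insub k is Some j then modc (X j ord0) ^+ 2 * A else 0.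
have := @l2le_sum R N F B.
have -> : \sum_(k < N) B k = (\sum_j modc (X j ord0) ^+ 2) * A.
  by rewrite mulr_suml; apply: eq_bigr => k _; rewrite /B valK.
rewrite mulrA; apply => k kN; rewrite /F /B insubT /=; exact: l2leZ.
Qed.

Lemma act_comb P X phi : act P (comb X phi) = comb X (fun j => act P (phi j)).
Proof.
rewrite /comb; elim/big_ind2: _ => [|u1 v1 u2 v2 <- <-|j _]; last exact: actZ.
  by rewrite -(scale0r (0 : nat -> C)) actZ !scale0r.
exact: actD.
Qed.

Lemma T_comb X phi : T (comb X phi) = comb X (fun j => T (phi j)).
Proof.
rewrite /comb; elim/big_ind2: _ => [|u1 v1 u2 v2 <- <-|j _]; last exact: schemeTZ.
  by rewrite -(scale0r (0 : nat -> C)) schemeTZ !scale0r.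
exact: schemeTD.
Qed.

Lemma ext_comb X phi : ext (comb X phi) = comb X (fun j => ext (phi j)).
Proof.
rewrite /comb; elim/big_ind2: _ => [|u1 v1 u2 v2 <- <-|j _]; last exact: extZ.
  by rewrite -(scale0r (0 : nat -> C)) extZ !scale0r.
exact: extD.
Qed.

Lemma comb_apply X phi i : comb X phi i = \sum_j X j ord0 * phi j i.
Proof.
rewrite /comb; elim/big_ind2: _ => [//|u1 v1 u2 v2 <- <-|//]; exact: erefl.
Qed.

Lemma sum_coord_le (G : 'M[C]_N) (V : 'cV[C]_N) B : (forall k, modc (V k ord0) ^+ 2 <= B) ->
  \sum_j modc ((G *m V) j ord0) ^+ 2 <= (\sum_j N%:R * \sum_k modc (G j k) ^+ 2) * B.
Proof.
move=> hV; rewrite mulr_suml; apply: ler_sum => j _; rewrite mxE.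
pose F k : C := if insub k is Some k' then G j k' * V k' ord0 else 0.
have -> : \sum_k G j k * V k ord0 = \sum_(k < N) F k.
  by apply: eq_bigr => k _; rewrite /F valK.
rewrite (le_trans (modc_sum_sqr N F)) // -mulrA ler_wpM2l // mulr_suml.
apply: ler_sum => k _; rewrite /F valK modcM exprMn ler_wpM2l ?sqr_ge0 ?hV //.
Qed.

Lemma source_le v B k : l2le v B -> modc (source v k ord0) ^+ 2 <= B.
Proof.
move=> hv; case: (split_ordP k) => k' ->.
  by rewrite col_mxEu mxE; exact: l2le_coord.
by rewrite col_mxEd mxE modc0 expr0n; exact: l2le_ge0 hv.
Qed.

Lemma ext_trace_window w X : win (ext w) = X ->
  \sum_(i < r) modc (ext w i) ^+ 2 <= r%:R * \sum_j modc (X j ord0) ^+ 2.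
Proof.
move=> hX; apply: (@le_trans _ _ (\sum_(i < r) \sum_j modc (X j ord0) ^+ 2)); last first.
  by rewrite sumr_const card_ord mulr_natl.
apply: ler_sum => i _; have ir := ltn_ord i.
have jN : (N.-1 - i < N)%N by rewrite addSn /= ltnS leq_subr.
have -> : ext w i = X (Ordinal jN) ord0.
  rewrite -hX mxE; congr (ext w _) => /=; move: (nat_of_ord i) ir => k kr; clear -kr; lia.
rewrite (bigD1 (Ordinal jN)) //= lerDl; apply: sumr_ge0 => k _; exact: sqr_ge0.
Qed.

Lemma unstable_solve f : ell2 f -> exists2 v, ell2 v & act (unQ z0) v = f.
Proof.
have [t [us [t1 su uE hus]]] := unstable_gap Hs Hl pbp z01 z0n1.
move=> hf; have [|v [hv hvf]] := @unstable_exists R us f _ hf.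
  by apply: sub_all hus => k; exact: lt_le_trans.
by exists v; rewrite ?uE.
Qed.

(* phi_j is the eigenvector with window P e_j, P the projection on Ker L0. If G X = 0,
   then comb X phi lies in the range of T - z0, hence vanishes. *)
Lemma generalized_inverse : exists (phi psi : 'I_N -> nat -> C) (G : 'M[C]_N) (A : R),
  [/\ 0 <= A, G \in unitmx,
    forall j, [/\ l2le (phi j) A, T (phi j) = z0 *: phi j, l2le (psi j) A &
      act (unQ z0) (psi j) = (al N)^-1 *: phi j] &
    forall X, G *m X = L0 *m X + source (comb X psi)].
Proof.
have [P [hP1 hP2]] := kernel_projection L0.
have [Ks Ks0 hKs] := stable_estimate Hs Hl pbp z01 z0n1.
have /choice[phi hphi] : forall j : 'I_N, exists phi, [/\ ell2 phi, T phi = z0 *: phi &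
    win (ext phi) = col j P].
  move=> j; have [||w [h1 h2 h3]] := @range_solve 0 0 (col j P).
  - by rewrite scaler0 -(scale0r (0 : nat -> C)) actZ !scale0r.
  - by rewrite source0 colE mulmxA hP1 mul0mx.
  exists w; split=> //; last by apply/eqP; rewrite -subr_eq0 h1.
  by eexists; apply: (l2le_unext (r := r) (pb := pb) (b := b)); apply: hKs; rewrite h3; exact: l2le0.
have /choice[psi hpsi] : forall j : 'I_N, exists psi, ell2 psi /\
    act (unQ z0) psi = (al N)^-1 *: phi j.
  move=> j; have [[B hB] _ _] := hphi j.
  have [|psi h1 h2] := @unstable_solve ((al N)^-1 *: phi j); last by exists psi.
  by exists (modc (al N)^-1 ^+ 2 * B); exact: l2leZ.
pose A := \sum_j (sqnorm (phi j) + sqnorm (psi j)).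
have s1 j : 0 <= sqnorm (phi j) by have [h _ _] := hphi j; exact: sqnorm_ge0.
have s2 j : 0 <= sqnorm (psi j) by have [h _] := hpsi j; exact: sqnorm_ge0.
have hA j : sqnorm (phi j) + sqnorm (psi j) <= A.
  by rewrite /A (bigD1 j) //= lerDl; apply: sumr_ge0 => k _; exact: addr_ge0.
(* If v solves the unstable recurrence for f / a_p, then G X = source v is the condition of
   [range_solve] for the datum f - comb X phi. *)
pose G := L0 + \matrix_(i, j) source (psi j) i ord0.
have GE X : G *m X = L0 *m X + source (comb X psi).
  rewrite mulmxDl; congr (_ + _); rewrite source_sum; apply/colP => i.
  rewrite mxE summxE; apply: eq_bigr => j _; rewrite sourceZ !mxE mulrC; exact: erefl.
exists phi, psi, G, A; split=> //.
- by apply: sumr_ge0 => j _; exact: addr_ge0.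
- rewrite -unitmx_tr -row_free_unit -kermx_eq0; apply/rowV0P => x /sub_kermxP hx.
  pose X := x^T; suff : X = 0 by move=> /(congr1 trmx); rewrite trmxK trmx0.
  have GX : G *m X = 0 by rewrite -[G]trmxK -trmx_mul hx trmx0.
  pose ph := comb X phi.
  have eph : ell2 ph.
    exists (N%:R * (\sum_j modc (X j ord0) ^+ 2) * A); apply: l2le_comb => j.
    have [h _ _] := hphi j; apply: l2leW (l2le_sqnorm h) _.
    by rewrite (le_trans _ (hA j)) // lerDl.
  have eps : ell2 (comb X psi).
    exists (N%:R * (\sum_j modc (X j ord0) ^+ 2) * A); apply: l2le_comb => j.
    have [h _] := hpsi j; apply: l2leW (l2le_sqnorm h) _.
    by rewrite (le_trans _ (hA j)) // lerDr.
  have Tph : T ph = z0 *: ph.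
    rewrite T_comb /ph /comb scaler_sumr; apply: eq_bigr => j _.
    by have [_ -> _] := hphi j; rewrite !scalerA mulrC.
  have aps : act (unQ z0) (comb X psi) = (al N)^-1 *: ph.
    rewrite act_comb /ph /comb scaler_sumr; apply: eq_bigr => j _.
    by have [_ ->] := hpsi j; rewrite !scalerA mulrC.
  have [||w [h1 h2 h3]] := @range_solve (- ph) (- comb X psi) X.
  - by rewrite -scaleN1r actZ aps scaleN1r scalerN.
  - rewrite -scaleN1r sourceZ scaleN1r; apply/eqP; rewrite -addr_eq0 -GE GX; exact/eqP.
  have ew : ell2 w.
    case: eps => B hB; eexists; apply: (l2le_unext (r := r) (pb := pb) (b := b)).
    by apply: hKs; rewrite h3; apply: l2leN; exact: hB.
  have ph0 : - ph = 0.
    apply: (no_jordan_chain Hs Hl pbp z01 z0n1 _ ew _ h1).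
      by case: eph => B hB; exists B; exact: l2leN.
    by rewrite schemeTN Tph scalerN.
  have {}ph0 : ph = 0 by rewrite -[ph]opprK ph0 oppr0.
  have ps0 : comb X psi = 0.
    apply: (unstable_inj Hs Hl pbp z01 z0n1 eps).
    by rewrite aps ph0 scaler0.
  have /hP2 PX : L0 *m X = 0.
    move: GX; rewrite GE ps0 source0 addr0; exact.
  (* [ph] is zero, while its window is P X = X because X now lies in Ker L0. *)
  have : win (ext ph) = P *m X.
    apply/colP => i; rewrite mxE /ph ext_comb comb_apply mxE; apply: eq_bigr => j _.
    have [_ _ /colP/(_ i)] := hphi j; rewrite !mxE mulrC => ->; exact: erefl.
  rewrite PX ph0 => <-; apply/colP => i; rewrite !mxE.
  by rewrite -(scale0r (0 : nat -> C)) extZ scale0r.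
- move=> j; have [h1 h2 h3] := hphi j; have [h4 h5] := hpsi j; split=> //.
    apply: l2leW (l2le_sqnorm h1) _; by rewrite (le_trans _ (hA j)) // lerDl.
  apply: l2leW (l2le_sqnorm h4) _; by rewrite (le_trans _ (hA j)) // lerDr.
Qed.

End RangeComplement.

Section SpectralDecomposition.
Context {R : realType}.
Local Notation C := (R[i]).
Variables (lambda vel : R) (r p' pb : nat) (a : int -> R) (b : nat -> int -> R).
Local Notation p := p'.+1.
Local Notation N := (p + r)%N.
Hypothesis Hs : scheme_hypothesis lambda vel r p a.
Hypothesis Hl : Lopatinskii_hypothesis r p pb a b.
Hypothesis pbp : (pb <= p)%N.

Local Notation al := (coef_a r a).
Local Notation stQ := (stableQ r p' a).
Local Notation ext := (ext r pb b).
Local Notation T := (schemeT r p' pb a b).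

(** Taking X as the inverse of G applied to the source of f splits off the eigenvector comb X phi,
    and what remains is in the range of T - z0. The bounds follow because G is a fixed finite
    matrix. *)
Lemma range_complement z0 : modc z0 = 1 -> z0 != 1 ->
  exists2 K, 0 <= K & forall f B, l2le f B -> exists phi w,
    [/\ f = phi + (T w - z0 *: w), T phi = z0 *: phi, l2le phi (K * B) & l2le w (K * B)].
Proof.
move=> z01 z0n1.
have [phi [psi [G [A [A0 uG hpp GE]]]]] := generalized_inverse Hs Hl pbp z01 z0n1.
have [Ks Ks0 hKs] := stable_estimate Hs Hl pbp z01 z0n1.
have [Ku Ku0 hKu] := unstable_estimate Hs Hl pbp z01 z0n1.
pose cu := Ku * modc (al N)^-1 ^+ 2.
pose g := \sum_j N%:R * \sum_k modc (invmx G j k) ^+ 2.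
have cu0 : 0 <= cu by rewrite mulr_ge0 ?sqr_ge0.
have g0 : 0 <= g.
  by apply: sumr_ge0 => j _; rewrite mulr_ge0 // sumr_ge0 // => k _; exact: sqr_ge0.
pose K1 := N%:R * (g * cu) * A.
pose K2 := Ks * (r%:R * (g * cu) + (2 * cu + 2 * K1)).
have K10 : 0 <= K1 by have := mulr_ge0 g0 cu0 => gc; apply: mulr_ge0 => //; apply: mulr_ge0 => //; exact: ler0n.
have K20 : 0 <= K2.
  have gc := mulr_ge0 g0 cu0.
  apply: mulr_ge0 => //; apply: addr_ge0; first by apply: mulr_ge0 => //; exact: ler0n.
  by apply: addr_ge0; apply: mulr_ge0.
exists (K1 + K2) => [|f B hf]; first exact: addr_ge0.
have B0 := l2le_ge0 hf.
have [|v ev hv] := @unstable_solve _ _ _ _ _ _ _ _ Hs Hl pbp _ z01 z0n1 ((al N)^-1 *: f).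
  by exists (modc (al N)^-1 ^+ 2 * B); exact: l2leZ.
have lv : l2le v (cu * B).
  by rewrite /cu -mulrA; apply: hKu => //; rewrite hv; exact: l2leZ.
pose X := invmx G *m source r p' v.
have hX : \sum_j modc (X j ord0) ^+ 2 <= g * cu * B.
  by rewrite -mulrA; apply: sum_coord_le => k; exact: source_le.
have GX : G *m X = source r p' v by rewrite mulmxA mulmxV // mul1mx.
have bcomb ph : (forall j, l2le (ph j) A) -> l2le (comb X ph) (K1 * B).
  move=> h; apply: l2leW (l2le_comb X h) _.
  have -> : K1 * B = N%:R * (g * cu * B) * A.
    by rewrite /K1; move: (g * cu) (N%:R) => x y; ring.
  by rewrite ler_wpM2r // ler_wpM2l.
have lphi : l2le (comb X phi) (K1 * B) by apply: bcomb => j; have [] := hpp j.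
have lpsi : l2le (comb X psi) (K1 * B) by apply: bcomb => j; have [] := hpp j.
have [||w [h1 h2 h3]] := @range_solve _ _ _ _ _ _ _ _ Hs Hl pbp _ z01 z0n1
    (f - comb X phi) (v - comb X psi) X.
- rewrite -scaleN1r actD actZ hv act_comb scaleN1r scalerBr; congr (_ - _).
  rewrite /comb scaler_sumr; apply: eq_bigr => j _.
  by have [_ _ _ ->] := hpp j; rewrite !scalerA mulrC.
- rewrite -scaleN1r sourceD sourceZ scaleN1r -GX GE addrK; exact: erefl.
exists (comb X phi), w; split.
- by rewrite h1 addrC subrK.
- rewrite T_comb /comb scaler_sumr; apply: eq_bigr => j _.
  by have [_ -> _ _] := hpp j; rewrite !scalerA mulrC.
- by apply: l2leW lphi _; rewrite mulrDl lerDl mulr_ge0.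
apply: (l2le_unext (r := r) (pb := pb) (b := b)).
have hw : l2le (act (stQ z0) (ext w)) (2 * (cu * B) + 2 * (K1 * B)).
  by rewrite h3; exact: l2leB.
apply: l2leW (hKs _ _ hw) _.
apply: (@le_trans _ _ (K2 * B)); last by rewrite mulrDl lerDr mulr_ge0.
rewrite /K2 -mulrA ler_wpM2l // [leRHS]mulrDl lerD //.
  by apply: le_trans (ext_trace_window h2) _; rewrite -mulrA ler_wpM2l.
by rewrite [leRHS]mulrDl -!mulrA.
Qed.

Lemma shifted_product_cons z s x :
  shifted_product T (z :: s) x = T (shifted_product T s x) - z *: shifted_product T s x.
Proof. by []. Qed.

Lemma spectral_decomposition (zs : seq C) : (forall z, z \in zs -> modc z = 1 /\ z != 1) ->
  exists2 K, 0 <= K & forall f B, l2le f B -> exists (phi : nat -> nat -> C) g,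
  [/\ f = \sum_(k < size zs) phi k + shifted_product T zs g,
      forall k, (k < size zs)%N -> T (phi k) = zs`_k *: phi k /\ l2le (phi k) (K * B)
    & l2le g (K * B)].
Proof.
elim: zs => [|z zs IH] hz.
  exists 1 => // f B hf; exists (fun=> 0), f; split; rewrite ?mul1r //.
  by rewrite big_ord0 add0r.
have [z1 zn1] := hz z (mem_head _ _).
have [|K K0 hK] := IH; first by move=> y ys; apply: hz; rewrite in_cons ys orbT.
have [K1 K10 hK1] := range_complement z1 zn1.
exists (K1 + 4 * (K * K1)) => [|f B hf]; first by rewrite addr_ge0 // mulr_ge0 // mulr_ge0.
have B0 := l2le_ge0 hf.
have [ph [w [fE Tph lph lw]]] := hK1 f B hf.
have [phi [g [wE Tphi lg]]] := hK w _ lw.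
exists (fun k => if k is k'.+1 then (zs`_k' - z) *: phi k' else ph), g; split.
- rewrite shifted_product_cons fE big_ord_recl /= -addrA; congr (_ + _).
  rewrite wE schemeTD scalerDr.
  have TS : T (\sum_(k < size zs) phi k) = \sum_(k < size zs) zs`_k *: phi k.
    under [RHS]eq_bigr do rewrite -(Tphi _ (ltn_ord _)).1.
    elim: (size zs) => [|n IHn]; last by rewrite !big_ord_recr schemeTD IHn.
    by rewrite !big_ord0 -(scale0r (0 : nat -> C)) schemeTZ !scale0r.
  rewrite TS opprD addrACA; congr (_ + _).
  rewrite scaler_sumr -sumrB; apply: eq_bigr => k _; by rewrite scalerBl.
- case=> [|k] /=; first by split=> //; apply: l2leW lph _; rewrite mulrDl lerDl !mulr_ge0.
  rewrite ltnS => ks; have [h1 h2] := Tphi k ks; split.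
    by rewrite schemeTZ h1 !scalerA mulrC.
  apply: l2leW (l2leZ _ h2) _.
  have m4 : modc (zs`_k - z) ^+ 2 <= 4.
    have hzk : modc zs`_k = 1 by have [] := hz zs`_k; rewrite ?in_cons ?mem_nth ?orbT.
    have : modc (zs`_k - z) <= 2 by rewrite (le_trans (modcB _ _)) // hzk z1.
    by have := modc_ge0 (zs`_k - z); nra.
  apply: (@le_trans _ _ (4 * (K * K1) * B)); last by rewrite ler_wpM2r // lerDr.
  have -> : 4 * (K * K1) * B = 4 * (K * (K1 * B)) by ring.
  by rewrite ler_wpM2r // !mulr_ge0.
- apply: l2leW lg _; rewrite mulrA ler_wpM2r //.
  by have := mulr_ge0 K0 K10; lra.
Qed.

End SpectralDecomposition.

(** * Power boundedness of the scheme *)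

Section SchemeBound.
Context {R : realType}.
Local Notation C := (R[i]).
Variables (lambda vel : R) (r p' pb : nat) (a : int -> R) (b : nat -> int -> R).
Local Notation p := p'.+1.
Local Notation N := (p + r)%N.
Hypothesis Hs : scheme_hypothesis lambda vel r p a.
Hypothesis Hl : Lopatinskii_hypothesis r p pb a b.
Hypothesis pbp : (pb <= p)%N.
Local Notation ext := (ext r pb b).
Local Notation T := (schemeT r p' pb a b).

Lemma schemeT_power_bounded : exists2 c, 0 < c & forall f B n, l2le f B ->
  l2le (iter n T f) (c * B).
Proof.
have [zs hzs] : exists s : seq C, circle_zeros r p' pb a b = [set` s].
  exact/finite_seqP/(Lopatinskii_finite Hl).
have zsP z : z \in zs -> modc z = 1 /\ z != 1.
  move=> hz; have : [set` zs] z by [].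
  by rewrite -hzs => -[/modc_eq1 h1 h2 _].
pose Ktr := bnorm r pb b.
have Ktr0 : 0 <= Ktr by exact: bnorm_ge0.
(* The radius Ktr + 2 serves as R0: it exceeds 1 and its square exceeds 1 + Ktr. *)
have R01 : 1 < Ktr + 2 by lra.
have [K K0 hK] : exists2 K, 0 <= K & forall z, 1 < modc z <= Ktr + 2 ->
    trace_estimate r p' pb a b K (fun z => \prod_(k <- zs) (z - k)) z.
  apply: (zeros_estimate Hs Hl pbp R01) => z; last by move=> /zsP[].
  by rewrite hzs.
have [KD KD0 hKD] := spectral_decomposition Hs Hl pbp zsP.
apply: (@power_bounded R T r (fun i x => ext x i) zs (Ktr + 2) Ktr (r%:R * K) KD).
- exact: schemeTD.
- exact: schemeTZ.
- by move=> i x y; rewrite extD.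
- by move=> i c x; rewrite extZ.
- by move=> x A; exact: (schemeT_energy _ _ Hs).
- exact: Ktr0.
- by move=> x A; exact: ext_trace_bound.
- exact: R01.
- by nra.
- by move=> z /zsP[].
- exact: mulr_ge0.
- move=> z x B /hK hz hx hB.
  rewrite /trace_energy mulr_sumr -mulrA.
  have -> : r%:R * (K * B) = \sum_(i < r) K * B by rewrite sumr_const card_ord mulr_natl.
  apply: ler_sum => i _; apply: hz => //.
  by apply: leq_trans (ltn_ord i) _; exact: leq_addl.
- exact: KD0.
- exact: hKD.
Qed.

End SchemeBound.

(** * Back to sequences indexed by the integers and extended-real norms *)

Section SequencesOnZ.
Context {R : realType}.
Local Notation C := (R[i]).
Implicit Types (w : int -> C).

Definition interior_seq w (i : nat) : C := w i.+1%:Z.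

Definition sqnormZ w : \bar R :=
  (\esum_(j in [set j : int | (1 <= j)%R]) ((Normc.normc (w j) ^+ 2)%:E))%E.

Lemma sqnormZ_ge0 w : (0 <= sqnormZ w)%E.
Proof. by apply: esum_ge0 => j _; rewrite lee_fin sqr_ge0. Qed.

Lemma sqnormZE w : sqnormZ w = (\sum_(i <oo) (modc (interior_seq w i) ^+ 2)%:E)%E.
Proof.
rewrite nneseries_esumT => [|i]; last by rewrite lee_fin sqr_ge0.
rewrite /sqnormZ (@reindex_esum R nat int setT _ (fun i : nat => i.+1%:Z)) //.
split.
- by move=> i _ /=; rewrite lez_nat.
- by move=> i j _ _ [].
- by case=> [[|n]|n] //= _; exists n.
Qed.

Lemma sqnormZ_le w A : (sqnormZ w <= A%:E)%E <-> l2le (interior_seq w) A.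
Proof.
have h0 n : (0 <= (modc (interior_seq w n) ^+ 2)%:E)%E by rewrite lee_fin sqr_ge0.
rewrite sqnormZE; split=> [h n|h].
  rewrite -lee_fin -sumEFin -(big_mkord xpredT (fun i => (modc (interior_seq w i) ^+ 2)%:E)).
  by apply: le_trans h; exact: nneseries_lim_ge.
apply: lime_le; first exact: is_cvg_nneseries.
by apply: nearW => n; rewrite sumEFin lee_fin big_mkord.
Qed.

Lemma normH_sqr w : ((normH w) `^ 2 = sqnormZ w)%E.
Proof.
by rewrite /normH -poweRrM mulVf // poweRe1 // sqnormZ_ge0.
Qed.

Lemma normH_le1 w : (normH w <= 1)%E -> l2le (interior_seq w) 1.
Proof.
move=> h; apply/sqnormZ_le; rewrite -normH_sqr -(poweR1r 2).
by apply: gt0_ler_poweR; rewrite ?in_itv /= ?leey ?andbT ?poweR_ge0.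
Qed.

Lemma normH_le w (v : int -> C) c : 0 <= c -> (sqnormZ w <= c%:E * sqnormZ v)%E ->
  (normH w <= (c `^ 2^-1)%:E * normH v)%E.
Proof.
move=> c0 h; rewrite /normH -poweR_EFin -poweRM ?lee_fin ?sqnormZ_ge0 //.
apply: gt0_ler_poweR; rewrite ?in_itv /= ?leey ?andbT ?invr_ge0 ?sqnormZ_ge0 //.
by rewrite mule_ge0 ?lee_fin ?sqnormZ_ge0.
Qed.

End SequencesOnZ.

Section SchemeDynamics.
Context {R : realType}.
Local Notation C := (R[i]).
Variables (r p' pb : nat) (a : int -> R) (b : nat -> int -> R).
Local Notation p := p'.+1.
Local Notation T := (schemeT r p' pb a b).

(** The boundary conditions at nu = m + 1 - r, without summability: this is enough to identify the
    scheme with [schemeT] on interior values. *)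
Definition compatible (w : int -> C) := forall m : nat, (m < r)%N ->
  w (m%:Z + 1 - r%:Z) = boundary_value pb b w (m%:Z + 1 - r%:Z).

Lemma boundary_valueE (w : int -> C) nu :
  boundary_value pb b w nu = \sum_(l < pb) (b l.+1 nu)%:C * w l.+1%:Z.
Proof. by rewrite /boundary_value big_add1 /= big_mkord. Qed.

Lemma ext_interior w m : compatible w ->
  ext r pb b (interior_seq w) m = w (m%:Z + 1 - r%:Z).
Proof.
move=> hw; rewrite /ext; case: ltnP => mr; first by rewrite hw // boundary_valueE.
by rewrite /interior_seq; congr w; lia.
Qed.

Lemma convolution_interior w i : compatible w ->
  convolution r p a w i.+1%:Z = T (interior_seq w) i.
Proof.
move=> hw; apply: eq_bigr => k _; rewrite ext_interior //; congr (_ * w _).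
by move: (nat_of_ord k) => k'; lia.
Qed.

Lemma compatible_range w :
  (forall nu : int, 1 - r%:Z <= nu <= 0 -> w nu = boundary_value pb b w nu) -> compatible w.
Proof. by move=> h m mr; apply: h; lia. Qed.

Lemma scheme_op_step w : compatible w -> compatible (scheme_op r p pb a b w) /\
  interior_seq (scheme_op r p pb a b w) = T (interior_seq w).
Proof.
move=> hw; split=> [m mr|].
  rewrite {1}/scheme_op ifF; last by lia.
  by rewrite !boundary_valueE.
by apply/funext => i; rewrite -convolution_interior.
Qed.

Lemma scheme_op_iter w n : compatible w ->
  compatible (iter n (scheme_op r p pb a b) w) /\
  interior_seq (iter n (scheme_op r p pb a b) w) = iter n T (interior_seq w).
Proof.
move=> hw; elim: n => [//|n [h1 h2]] /=.
by have [h3 ->] := scheme_op_step h1; rewrite h2.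
Qed.

Lemma scheme_solution_iter f u n : in_H r pb b f -> scheme_solution r p pb a b f u ->
  compatible (u n) /\ interior_seq (u n) = iter n T (interior_seq f).
Proof.
move=> [_ hf] [u0 u1 u2]; elim: n => [|n [h1 h2]] /=.
  have u0i l : u 0%N l.+1%:Z = f l.+1%:Z by rewrite u0 //; lia.
  split; last by apply/funext => i; exact: u0i.
  apply: compatible_range => nu hnu; have /andP[h _] := hnu.
  by rewrite u0 // hf // !boundary_valueE; apply: eq_bigr => l _; rewrite u0i.
split; first by apply: compatible_range => nu hnu; rewrite u2.
rewrite -h2; apply/funext => i; rewrite /interior_seq u1 //.
exact: convolution_interior.
Qed.

End SchemeDynamics.

Theorem theorem1 (R : realType) (lambda vel : R) (r p pb : nat)
    (a : int -> R) (b : nat -> int -> R)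
    (lambda_gt0 : 0 < lambda) (vel_gt0 : 0 < vel)
    (r_ge1 : (1 <= r)%N) (p_ge1 : (1 <= p)%N) (pb_bounds : (1 <= pb <= p)%N)
    (Hscheme : scheme_hypothesis lambda vel r p a)
    (Hlop : Lopatinskii_hypothesis r p pb a b) :
  exists C : R, [/\ 0 < C,
    (ereal_sup (range (fun n : nat =>
       opnormH r pb b (iter n (scheme_op r p pb a b)))) <= C%:E)%E
  & forall (f : int -> complex R) (u : nat -> int -> complex R),
      in_H r pb b f -> scheme_solution r p pb a b f u ->
      (ereal_sup (range (fun n : nat => normH (u n))) <= C%:E * normH f)%E].

Proof.
have /andP[pb1 pbp] := pb_bounds.
case: p p_ge1 pbp Hscheme Hlop {pb_bounds} => [//|p'] _ pbp Hs Hl.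
have [c c0 hc] := schemeT_power_bounded Hs Hl pbp.
(* [c] bounds squared norms, hence the square root. *)
exists (c `^ 2^-1); split; first exact: powR_gt0.
  apply: ge_ereal_sup => _ [n _ <-]; apply: ge_ereal_sup => _ [w [[_ hw] w1] <-].
  have [_ hi] := scheme_op_iter p' a n (compatible_range hw).
  rewrite /normH -poweR_EFin; apply: gt0_ler_poweR; rewrite ?in_itv /= ?leey ?andbT ?invr_ge0 //.
  - exact: sqnormZ_ge0.
  - by rewrite lee_fin ltW.
  by apply/sqnormZ_le; rewrite hi -[c]mulr1; apply: hc; exact: normH_le1.
move=> f u hf hu; apply: ge_ereal_sup => _ [n _ <-].
apply: normH_le; first exact: ltW.
have [_ hi] := scheme_solution_iter n hf hu.
(* [l2le] takes real bounds, so the squared norm of f must first be known to be finite; summability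
   in H includes the ghost indices and dominates it. *)
have hfin : (sqnormZ f < +oo)%E.
  case: hf => hf _; apply: le_lt_trans hf; rewrite /sqnormZ esum_mkcond [leRHS]esum_mkcond.
  apply: le_esum => j _; case: ifPn => [|_]; last first.
    by case: ifP => _; rewrite ?lee_fin ?sqr_ge0.
  rewrite !inE /= => j1; rewrite ifT // inE /=; lia.
have hfn : sqnormZ f = (fine (sqnormZ f))%:E.
  by rewrite fineK // ge0_fin_numE // sqnormZ_ge0.
rewrite hfn -EFinM; apply/sqnormZ_le; rewrite hi; apply: hc.
by apply/sqnormZ_le; rewrite -hfn.
Qed.
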